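(* Let $\tau>0$, $d_1>0$, and suppose the coefficients $c_1,c_2,d_1,d_2$ satisfy $$c_1>6c_2>0,\qquad d_2>0,\qquad d_1^2\ge\max\left\{\frac{9c_1^2d_2^2}{c_1^2-9c_2^2},\ \frac{18c_1c_2^2c_p}{c_1^2-36c_2^2}\right\}.$$ Let $V^0\in\mathscr{H}$, let $V=(y,\partial_t y,z,\partial_t z)^T$ be the mild solution of $\dot V=\mathscr{A}V$, $V(0)=V^0$, and let $\mathcal{E}(t)$ be its energy as defined in the context. Then there exist constants $\tilde\alpha,C>0$ such that $$\mathcal{E}(t)\le Ce^{-2\tilde\alpha t}\mathcal{E}(0)\quad\text{for all } t\ge0.$$
   Context: $\Omega \subset \mathbb{R}^d$ is a bounded Lipschitz domain with boundary $\Gamma$; $\Gamma_0,\Gamma_1\subset\Gamma$ are relatively open with $\Gamma = \bar{\Gamma}_0 \cup \bar{\Gamma}_1$, $\bar{\Gamma}_0 \cap \bar{\Gamma}_1 = \emptyset$, $\Gamma_0 \neq \emptyset$. $H^1_{\Gamma_0}(\Omega) = \{u \in H^1(\Omega) : u|_{\Gamma_0} = 0\}$; $\|\cdot\|$ is the norm of $L^2(\Omega)$. $c_p>0$ denotes the Poincaré–Friedrichs constant, i.e. $\|u\|^2\le c_p\|\nabla u\|^2$ for every $u\in H^1_{\Gamma_0}(\Omega)$. $\mathscr{H} = H^1_{\Gamma_0}(\Omega) \times L^2(\Omega) \times L^2(0,1; H^1_{\Gamma_0}(\Omega)) \times L^2(0,1; H^1_{\Gamma_0}(\Omega))$ with (a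 Hilbert norm equivalent to) the product norm. For $V=(v_1,v_2,v_3,v_4)^T$ set $$\mathscr{A} V = \big(v_2,\ c_1 \triangle v_1 + c_2 \triangle v_3|_{s=1} + d_1 \triangle v_2 + d_2 \triangle v_4|_{s=1},\ -\tau^{-1} \partial_s v_3,\ -\tau^{-1}\partial_s v_4\big)^T,$$ with $D(\mathscr{A})$ consisting of all $V\in\mathscr{H}$ such that $\mathscr{A}V\in\mathscr{H}$, $v_3|_{s=0}=v_1$, $v_4|_{s=0}=v_2$ and $$\int_\Omega \big(c_1 \triangle v_1 + c_2 \triangle v_3|_{s=1} + d_1 \triangle v_2 + d_2 \triangle v_4|_{s=1}\big)\psi\,dx = -\int_\Omega \big(c_1 \nabla v_1 + c_2 \nabla v_3|_{s=1} + d_1 \nabla v_2 + d_2 \nabla v_4|_{s=1}\big)\cdot \nabla\psi\,dx$$ for every $\psi\in H^1_{\Gamma_0}(\Omega)$. $\mathscr{A}$ generates a $C_0$-semigroup on $\mathscr{H}$. The equation $\dot V=\mathscr{A}V$ is the abstract form of the delay equation $\partial_{tt}y-c_1\triangle y-c_2\triangle y(t-\tau,\cdot)-d_1\partial_t\triangle y-d_2\partial_t\triangle y(t-\tau,\cdot)=0$ with $y=0$ on $\Gamma_0$, $\partial y/\partial\nu=0$ on $\Gamma_1$; the components of the solution $V=(v_1,v_2,v_3,v_4)^T$ are denoted $y:=v_1$, $\partial_t y:=v_2$, $z:=v_3$ (history variable $z(t,s,x)=y(t-\tau s,x)$), $\partial_t z:=v_4$. The energy is $$\mathcal{E}(t)=\frac12\|\partial_t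 y\|^2+\frac{c_1}{2}\|\nabla y\|^2+\frac{\tau d_1}{2}\int_0^1\|\nabla z(s,\cdot)\|^2\,ds+\frac{\tau d_2}{2}\int_0^1\|\partial_t\nabla z(s,\cdot)\|^2\,ds$$ evaluated at time $t$. *)

(* Defs.v *)
From HB Require Import structures.
From mathcomp Require Import all_boot all_order all_algebra.
From mathcomp Require Import all_classical all_reals all_analysis.
From mathcomp Require Import lra.
Import Order.TTheory GRing.Theory Num.Theory.
Import numFieldNormedType.Exports.
Set Implicit Arguments. Unset Strict Implicit. Unset Printing Implicit Defensive.
Local Open Scope classical_set_scope.
Local Open Scope ring_scope.

HB.instance Definition _ (R : realType) (d : nat) :=
  @isMeasurable.Build default_measure_display 'rV[R]_d
    <<s (@open 'rV[R]_d) >>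
    (@sigma_algebra0 _ _ _) (@sigma_algebraC _ _) (@sigma_algebra_bigcup _ _ _).

(* A copy of \x: the sigma-finite instance declared on \x itself in the library
   is only inferred for factors that are subprobabilities. *)
Section sigma_finite_product.
Local Open Scope ereal_scope.
Context d1 d2 (T1 : measurableType d1) (T2 : measurableType d2) (R : realType).
Variable m1 : {sigma_finite_measure set T1 -> \bar R}.
Variable m2 : {sigma_finite_measure set T2 -> \bar R}.

Definition product_sigma_finite : set (T1 * T2) -> \bar R := m1 \x m2.

HB.instance Definition _ := Measure.on product_sigma_finite.

Let sigma_finite_product_sigma_finite : sigma_finite setT product_sigma_finite.
Proof.
have /sigma_finiteP[F [TF ndF Foo]] := sigma_finiteT m1.
have /sigma_finiteP[G [TG ndG Goo]] := sigma_finiteT m2.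
exists (fun n => F n `*` G n) => [|k].
  rewrite -setXTT TF TG predeqE => -[x y]; split.
    move=> [/= [n _ Fnx] [k _ Gky]]; exists (maxn n k) => //; split.
    - by move: x Fnx; exact/subsetPset/ndF/leq_maxl.
    - by move: y Gky; exact/subsetPset/ndG/leq_maxr.
  by move=> [n _ []/= ? ?]; split; exists n.
have [? ?] := Foo k; have [? ?] := Goo k.
split; first exact: measurableX.
by rewrite /product_sigma_finite product_measure1E// lte_mul_pinfty// ge0_fin_numE.
Qed.

HB.instance Definition _ := Measure_isSigmaFinite.Build _ _ _ product_sigma_finite
  sigma_finite_product_sigma_finite.
End sigma_finite_product.
Section dirac_unit.
Context (R : realType).
Definition dirac_unit : set unit -> \bar R := dirac tt.
HB.instance Definition _ := Measure.on dirac_unit.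
Let dirac_unit_fin : fin_num_fun dirac_unit.
Proof. by move=> A _; rewrite /dirac_unit diracE. Qed.
HB.instance Definition _ := Measure_isFinite.Build _ _ _ dirac_unit
  dirac_unit_fin.
End dirac_unit.

(* The Lebesgue measure on R^d, as the image on row vectors of the d-fold
   product of the Lebesgue measure on R *)
Section lebesgue_measure_rV.
Variable R : realType.
Fixpoint iter_disp (d : nat) : measure_display :=
  if d is d'.+1 then
    measure_prod_display (sigma_display R.-ocitv.-measurable, iter_disp d')
  else default_measure_display.
Fixpoint iter_space (d : nat) : measurableType (iter_disp d) :=
  if d is d'.+1 then (measurableTypeR R * iter_space d')%type : measurableType _
  else unit.
Fixpoint iter_lebesgue (d : nat) : {sigma_finite_measure set (iter_space d) -> \bar R} :=
  match d return {sigma_finite_measure set (iter_space d) -> \bar R} with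
  | 0%N => @dirac_unit R
  | d'.+1 => product_sigma_finite lebesgue_measure (iter_lebesgue d')
  end.
Fixpoint row_of (d : nat) : iter_space d -> 'rV[R]_d :=
  if d is d'.+1 then fun p => row_mx (p.1)%:M (row_of p.2) else fun=> 0.

Lemma measurable_coord d (i : 'I_d) :
  measurable_fun setT (fun p : iter_space d => row_of p 0 i).
Proof.
elim: d i => [[]//|d IH] i /=.
case: (@split_ordP 1 d i) => j ij.
  rewrite (_ : (fun _ => _) = fst); first exact: measurable_fst.
  by apply/funext => p; rewrite ij; apply: etrans (row_mxEl _ _ _ _) _; rewrite (ord1 j) mxE eqxx mulr1n.
rewrite (_ : (fun _ => _) = (fun p => row_of p 0 j) \o snd); last first.
  by apply/funext => p; rewrite ij; exact: row_mxEr.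
by apply: measurableT_comp; [exact: IH|exact: measurable_snd].
Qed.

Lemma measurable_row_of d : measurable_fun setT (@row_of d).
Proof.
apply: (@measurability _ _ _ _ _ (@row_of d) (@open 'rV[R]_d)) => // _ [U oU <-].
rewrite setTI.
pose B (q : 'rV[rat]_d * rat) : set 'rV[R]_d :=
  [set x | forall i, x 0 i \in `]ratr (q.1 0 i - q.2), ratr (q.1 0 i + q.2)[].
pose F q := if pselect (B q `<=` U) then @row_of d @^-1` B q else set0.
have -> : @row_of d @^-1` U = \bigcup_q F q.
  apply/seteqP; split => [p /= Up|p [q _]]; last first.
    by rewrite /F; case: pselect => // BU /BU.
  have /nbhs_ballP[e /= e0 eU] : nbhs (row_of p) U by exact: open_nbhs_nbhs.
  have [r r0 re] : exists2 r : rat, 0 < r & (ratr r : R) < e / 2.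
    have /rat_in_itvoo[r] : 0 < e / 2 by rewrite divr_gt0.
    by rewrite in_itv/= => /andP[+ ?]; rewrite ltr0q; exists r.
  have /choice[q qP] : forall i, exists q : rat,
      row_of p 0 i - ratr r < (ratr q : R) < row_of p 0 i + ratr r.
    move=> i; have /rat_in_itvoo[q] :
        row_of p 0 i - ratr r < row_of p 0 i + ratr r.
      by rewrite ltrD2l gtrN// ltr0q.
    by rewrite in_itv/= => ?; exists q.
  exists (\row_i q i, r) => //.
  rewrite /F; case: pselect => [_ i|].
    rewrite /= mxE in_itv/= raddfB raddfD/=.
    by have /andP[q1 q2] := qP i; apply/andP; split; lra.
  case => x Bx; apply: eU; split => // j i; rewrite (ord1 j).
  have := qP i; have := Bx i; rewrite /ball/= in_itv/= mxE raddfB raddfD/=.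
  rewrite ltr_norml; move=> /andP[x1 x2] /andP[q1 q2].
  apply/andP; split; lra.
apply: countable_bigcupT_measurable; first exact: countableP.
move=> q; rewrite /F; case: pselect => //= _.
rewrite (_ : _ @^-1` _ = \bigcap_(i in [set: 'I_d])
    (fun p => row_of p 0 i) @^-1` `]ratr (q.1 0 i - q.2), ratr (q.1 0 i + q.2)[).
  apply: fin_bigcap_measurable => // i _; rewrite -[X in measurable X]setTI.
  by apply: measurable_coord.
by apply/seteqP; split => p /= + i; [move=> /(_ i)|move=> /(_ i Logic.I)].
Qed.

Definition lebesgue_rV (d : nat) : set 'rV[R]_d -> \bar R :=
  pushforward (iter_lebesgue d) (@row_of d).

Let lebesgue_rV_measure (d : nat) : {measure set 'rV[R]_d -> \bar R} :=
  measure_function_pushforward__canonical__measure_function_Measure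
    (iter_lebesgue d) (@measurable_row_of d).

HB.instance Definition _ (d : nat) := isMeasure.Build _ _ _ (@lebesgue_rV d)
  (measure0 (lebesgue_rV_measure d)) (@measure_ge0 _ _ _ (lebesgue_rV_measure d))
  (@measure_semi_sigma_additive _ _ _ (lebesgue_rV_measure d)).
End lebesgue_measure_rV.

Section domains.
Variables (R : realType) (d : nat).
Local Notation E := 'rV[R]_d.

Definition bdry (Om : set E) : set E := closure Om `\` interior Om.

(* Near each boundary point, in suitable orthonormal coordinates, Om is the
   region above the graph of a Lipschitz function of the d - 1 coordinates other
   than the i-th one *)
Definition lipschitz_boundary (Om : set E) := forall x, bdry Om x ->
  exists (Q : 'M[R]_d) (i : 'I_d) (r k : R) (gamma : 'rV[R]_d.-1 -> R),
  [/\ Q *m Q^T = 1%:M, 0 < r, k.-lipschitz gamma &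
      Om `&` ball x r =
      [set y | gamma (col' i (y *m Q)) < (y *m Q) 0 i] `&` ball x r].

Definition bounded_lipschitz_domain (Om : set E) :=
  [/\ open Om, connected Om, bounded_set Om & lipschitz_boundary Om].

Definition relatively_open (S G : set E) := exists2 U, open U & G = S `&` U.

(* N is null for the (d - 1)-dimensional Hausdorff measure; the index set I may
   be finite, so that for d = 1 only the empty set is null *)
Definition surface_null (N : set E) := forall e : R, 0 < e ->
  exists (I : set nat) (c : nat -> E) (r : nat -> R),
  [/\ forall k, 0 < r k, N `<=` \bigcup_(k in I) ball (c k) (r k) &
      (\esum_(k in I) (r k ^+ d.-1)%:E < e%:E)%E].

End domains.

Section test_functions.
Variables (R : realType) (d : nat).
Local Notation E := 'rV[R]_d.

Definition partial (i : 'I_d) (phi : E -> R) : E -> R :=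
  'D_(delta_mx 0 i) phi.

Fixpoint Ck (k : nat) (phi : E -> R) : Prop :=
  continuous phi /\
  if k is k'.+1 then forall i : 'I_d,
    (forall x, derivable phi x (delta_mx 0 i)) /\ Ck k' (partial i phi)
  else True.

Definition smooth (phi : E -> R) := forall k, Ck k phi.

Definition test_function (Om : set E) (phi : E -> R) := smooth phi /\
  exists K : set E, [/\ compact K, K `<=` Om & forall x, ~ K x -> phi x = 0].

Definition grad (phi : E -> R) : E -> E := fun x => \row_i partial i phi x.

End test_functions.

(* Elements of L^2, H^1 and of the state space are represented by functions; two
   of them are equal in the space when the norm of their difference is 0. *)
Section sobolev.
Variables (R : realType) (d : nat).
Local Notation E := 'rV[R]_d.
Local Notation leb := (@lebesgue_rV R d).
Variable Om : set E.

Definition L2 (f : E -> R) := measurable_fun Om f /\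
  (\int[leb]_(x in Om) (f x ^+ 2)%:E < +oo)%E.

Definition L2norm (f : E -> R) : R := Num.sqrt (\int[leb]_(x in Om) (f x ^+ 2)).

Definition L2vec (G : E -> E) := forall i, L2 (fun x => G x 0 i).

Definition dotp (u v : E) : R := \sum_i u 0 i * v 0 i.

Definition L2vec_dot (G K : E -> E) : R := \int[leb]_(x in Om) dotp (G x) (K x).

Definition L2vec_norm (G : E -> E) : R := Num.sqrt (L2vec_dot G G).

Definition weak_grad (u : E -> R) (G : E -> E) := forall phi, test_function Om phi ->
  forall i, \int[leb]_(x in Om) (u x * partial i phi x) =
            - \int[leb]_(x in Om) (G x 0 i * phi x).

(* f = div G in the sense of distributions on Om *)
Definition weak_div (G : E -> E) (f : E -> R) := forall phi, test_function Om phi ->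
  \int[leb]_(x in Om) (f x * phi x) = - L2vec_dot G (grad phi).

(* An element u of H^1 is represented by the pair (u, nabla u), an element of
   L^2 x (L^2)^d with the inner product h1dot *)
Definition h1 : lmodType R := ((E -> R^o) * (E -> E))%type.

Definition L2pair (P : h1) := L2 P.1 /\ L2vec P.2.

Definition h1dot (P Q : h1) : R :=
  \int[leb]_(x in Om) (P.1 x * Q.1 x) + L2vec_dot P.2 Q.2.

Definition h1norm (P : h1) : R := Num.sqrt (h1dot P P).

Definition H1 (P : h1) := L2pair P /\ weak_grad P.1 P.2.

(* The trace of u on the boundary part S is g: the boundary values of smooth
   functions approximating u in H^1 converge to g almost everywhere on S.
   (Approximations in H^1 have boundary values converging in L^2 of the boundary
   to the trace, so that almost everywhere convergence holds for a subsequence.) *)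
Definition has_trace (S : set E) (P : h1) (g : E -> R) :=
  exists phi : nat -> E -> R,
  [/\ forall n, smooth (phi n),
      h1norm ((phi n, grad (phi n)) - P) @[n --> \oo] --> (0 : R) &
      surface_null (S `&` [set x | ~ (phi n x @[n --> \oo] --> g x)])].

Definition H1_0 (G0 : set E) (P : h1) := H1 P /\ has_trace G0 P (fun=> 0).

Definition poincare_constant (G0 : set E) (cp : R) := forall P : h1, H1_0 G0 P ->
  L2norm P.1 ^+ 2 <= cp * L2vec_norm P.2 ^+ 2.

End sobolev.

Section bochner.
Variables (R : realType) (d : nat).
Local Notation E := 'rV[R]_d.
Local Notation h1 := (h1 R d).
Local Notation mu := (@lebesgue_measure R).
Variables (Om G0 : set E).

Definition simple_fun (S : R -> h1) :=
  exists (m : nat) (A : 'I_m -> set R) (w : 'I_m -> h1),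
  [/\ forall k, measurable (A k), forall k, H1_0 Om G0 (w k) &
      S = fun s => \sum_k (\1_(A k) s : R) *: w k].

(* L^2(0,1; H^1_{G0}): strongly measurable functions (pointwise limits of simple
   functions) of finite norm *)
Definition L2H1 (v : R -> h1) :=
  [/\ forall s : R, s \in `]0, 1[ -> H1_0 Om G0 (v s),
      (exists S : nat -> R -> h1, (forall n, simple_fun (S n)) /\
         forall s : R, s \in `]0, 1[ -> h1norm Om (S n s - v s) @[n --> \oo] --> (0 : R)) &
      (\int[mu]_(s in `]0%R, 1%R[) (h1norm Om (v s) ^+ 2)%:E < +oo)%E].

(* v is in H^1(0,1; H^1_{G0}), with derivative p in s and with absolutely continuous
   representative w on [0,1] (hence with traces w 0 and w 1): v = w almost
   everywhere and w s - w 0 is the integral of p over (0,s). The integral of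
   H^1_{G0}-valued functions is characterized by duality, H^1_{G0} being a closed
   subspace of the Hilbert space L^2 x (L^2)^d. *)
Definition W12H1 (v w p : R -> h1) :=
  [/\ L2H1 p,
      forall s : R, s \in `[0, 1] -> H1_0 Om G0 (w s),
      {ae mu, forall s : R, s \in `]0, 1[ -> h1norm Om (v s - w s) = 0} &
      forall s : R, s \in `[0, 1] -> forall P, L2pair Om P ->
        h1dot Om (w s - w 0) P = \int[mu]_(r in `]0, s[) h1dot Om (p r) P].

End bochner.

Section state_space.
Variables (R : realType) (d : nat).
Local Notation E := 'rV[R]_d.
Local Notation h1 := (h1 R d).
Local Notation mu := (@lebesgue_measure R).

Definition state : lmodType R := (h1 * (E -> R^o) * (R -> h1) * (R -> h1))%type.

Definition v1 (V : state) : h1 := V.1.1.1.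
Definition v2 (V : state) : E -> R := V.1.1.2.
Definition v3 (V : state) : R -> h1 := V.1.2.
Definition v4 (V : state) : R -> h1 := V.2.

Variables (Om G0 : set E).

Definition in_state_space (V : state) :=
  [/\ H1_0 Om G0 (v1 V), L2 Om (v2 V), L2H1 Om G0 (v3 V) & L2H1 Om G0 (v4 V)].

Definition state_norm (V : state) : R := Num.sqrt (
  h1norm Om (v1 V) ^+ 2 + L2norm Om (v2 V) ^+ 2 +
  \int[mu]_(s in `]0, 1[) (h1norm Om (v3 V s) ^+ 2) +
  \int[mu]_(s in `]0, 1[) (h1norm Om (v4 V s) ^+ 2)).

Variables (tau c1 c2 d1 d2 : R).

(* The graph of the operator A: V is in D(A) and F = A V.
   u2 is v2 as an element of H^1_{G0}, w3 and w4 are the continuous representatives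
   of v3 and v4, and f is the function
   c1 Laplacian v1 + c2 Laplacian v3|_{s=1} + d1 Laplacian v2 + d2 Laplacian v4|_{s=1} *)
Definition graph_A (V F : state) :=
  in_state_space V /\ in_state_space F /\
  exists (u2 : h1) (w3 p3 w4 p4 : R -> h1) (f : E -> R^o),
  let flux := c1 *: (v1 V).2 + c2 *: (w3 1).2 + d1 *: u2.2 + d2 *: (w4 1).2 in
  [/\ H1_0 Om G0 u2 /\ L2norm Om (u2.1 - v2 V) = 0,
      W12H1 Om G0 (v3 V) w3 p3 /\ h1norm Om (w3 0 - v1 V) = 0,
      W12H1 Om G0 (v4 V) w4 p4 /\ h1norm Om (w4 0 - u2) = 0,
      [/\ L2 Om f, weak_div Om flux f &
          forall psi, H1_0 Om G0 psi ->
            \int[@lebesgue_rV R d]_(x in Om) (f x * psi.1 x) = - L2vec_dot Om flux psi.2] &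
      state_norm (F - (u2, f, - tau^-1 *: p3, - tau^-1 *: p4)) = 0].

(* W t is the integral of V over [0,t], as the primitive of the continuous V *)
Definition primitive (V W : R -> state) :=
  [/\ forall t : R, 0 <= t -> in_state_space (W t), state_norm (W 0) = 0 &
      forall t : R, 0 <= t ->
        state_norm (h^-1 *: (W (t + h) - W t) - V t)
          @[h --> within [set h | h != 0 /\ 0 <= t + h] (nbhs 0)] --> (0 : R)].

(* V is continuous and V t = V0 + A (integral of V over [0,t]) *)
Definition mild_solution (V0 : state) (V : R -> state) :=
  [/\ forall t : R, 0 <= t -> in_state_space (V t),
      forall t : R, 0 <= t -> state_norm (V r - V t)
        @[r --> within [set r | 0 <= r] (nbhs t)] --> (0 : R),
      state_norm (V 0 - V0) = 0 &
      exists W, primitive V W /\ forall t : R, 0 <= t -> graph_A (W t) (V t - V0)].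

Definition energy (V : state) : R :=
  2^-1 * L2norm Om (v2 V) ^+ 2 + c1 / 2 * L2vec_norm Om (v1 V).2 ^+ 2 +
  tau * d1 / 2 * \int[mu]_(s in `]0, 1[) (L2vec_norm Om (v3 V s).2 ^+ 2) +
  tau * d2 / 2 * \int[mu]_(s in `]0, 1[) (L2vec_norm Om (v4 V s).2 ^+ 2).

End state_space.

(* Main.v *)
(** Let W be the primitive of the mild solution V.  For h > 0 the difference
    quotient U(t) = (W(t+h) - W(t)) / h is a classical solution: it lies in D(A),
    and its time derivative (V(t+h) - V(t)) / h equals A U(t).  It suffices to prove
    the decay for U, since U(t) tends to V(t) as h -> 0.

    Along U, with weight(s) = 1 + (1 - s)/2, the Lyapunov functional
      L = |y'|^2/2 + (c1 + N d1)/2 |grad y|^2 + N <y', y>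
          + tau a int_0^1 weight |grad z|^2 + tau b int_0^1 weight |grad z'|^2
    satisfies dL/dt <= - 2 alpha L.  Indeed, with X = grad y', Y = grad y and
    P = X + N Y, the delayed terms at s = 1 only occur as - c2 <Z, P> - d2 <T, P>;
    they are absorbed by the boundary terms - a |Z|^2 - b |T|^2 that come from
    integrating by parts in s, at the cost of (d1/3) |P|^2.  The hypotheses on the
    coefficients make the remaining form in (X, Y) negative definite for
    N = 3 c2^2 / (c1 d1), a = N c1 / 2, b = d1 / 6.

    The integration by parts is |w(1)|^2 - |w(0)|^2 = 2 int_0^1 <w, w'>, which is
    Fubini's theorem for <w'(r), w'(s)> on the triangle r < s, and its integral over
    the upper endpoint.

    Spaces of functions modulo null functions are handled as semi-inner products on
    predicates. *)

Require Import Defs.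
From HB Require Import structures.
From mathcomp Require Import all_boot all_order all_algebra.
From mathcomp Require Import all_classical all_reals all_analysis.
From mathcomp Require Import measurable_realfun ring lra.
Import Order.TTheory GRing.Theory Num.Theory.
Import numFieldNormedType.Exports.
Set Implicit Arguments. Unset Strict Implicit. Unset Printing Implicit Defensive.
Local Open Scope classical_set_scope.
Local Open Scope ring_scope.

(** * Semi-inner products *)

(** The quotients U are forced by the low regularity of a mild solution: V(t) need not lie in the
    domain, its history components need not have traces at s = 0 and s = 1, and L(V(t)) cannot be
    differentiated directly. W(t) does lie in the domain, and subtracting V(t) = V0 + A W(t) at two
    times removes V0. The multiple N d1 added to c1 in front of |grad y|^2 cancels the products <X,
    Y> produced by the damping tested with y, so that X and Y are coupled only through P. The weight
    decreases in s: it costs a factor 3/2 on the boundary terms at s = 0, and its slope yields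
    negative multiples of the history integrals, which L contains and which must decay as well. The
    s-derivative p of a history variable w is known only by duality, through the numbers <w(s) -
    w(0), P> for fixed P; no vector-valued integral is available to differentiate. The product rule
    for |w|^2 is therefore found by testing with P = p(s), which produces the kernel <p(r),
    p(s)>. *)

Section semi_inner_products.
Context (R : realType).

Definition submodule (X : lmodType R) (S : X -> Prop) :=
  S 0 /\ forall (a : R) x y, S x -> S y -> S (a *: x + y).

(** Linearity is asked only on [S]: the forms used below are integrals, which are additive only on
    square-integrable arguments. Linearity in the second argument follows from symmetry. *)
Definition sym_bilinear (X : lmodType R) (S : X -> Prop) (B : X -> X -> R) :=
  (forall x y, S x -> S y -> B x y = B y x) /\
  (forall a x y z, S x -> S y -> S z -> B (a *: x + y) z = a * B x z + B y z).

Definition semi_inner (X : lmodType R) (S : X -> Prop) (B : X -> X -> R) :=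
  [/\ submodule S, sym_bilinear S B & forall x, S x -> 0 <= B x x].

Definition seminorm_of (X : lmodType R) (B : X -> X -> R) (x : X) : R :=
  Num.sqrt (B x x).

Section submodule.
Context (X : lmodType R) (S : X -> Prop) (hS : submodule S).

Lemma submodule0 : S 0. Proof. by case: hS. Qed.

Lemma submoduleP a x y : S x -> S y -> S (a *: x + y).
Proof. by case: hS => _; apply. Qed.

Lemma submoduleZ a x : S x -> S (a *: x).
Proof. by move=> Sx; rewrite -[_ *: _]addr0; apply: submoduleP => //; exact: submodule0. Qed.

Lemma submoduleD x y : S x -> S y -> S (x + y).
Proof. by move=> Sx Sy; rewrite -[x]scale1r; exact: submoduleP. Qed.

Lemma submoduleB x y : S x -> S y -> S (x - y).
Proof. by move=> Sx Sy; rewrite addrC -scaleN1r; exact: submoduleP. Qed.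

End submodule.

Section bilinear.
Context (X : lmodType R) (S : X -> Prop) (B : X -> X -> R).
Hypotheses (hS : submodule S) (hB : sym_bilinear S B).

Lemma bilC x y : S x -> S y -> B x y = B y x. Proof. by case: hB => h _; apply: h. Qed.

Lemma bilPl a x y z : S x -> S y -> S z -> B (a *: x + y) z = a * B x z + B y z.
Proof. by case: hB => _; apply. Qed.

Lemma bil0l z : S z -> B 0 z = 0.
Proof.
move=> Sz; have S0 := submodule0 hS; have := bilPl 1 S0 S0 Sz.
by rewrite scale1r addr0 mul1r; lra.
Qed.

Lemma bilZl a x z : S x -> S z -> B (a *: x) z = a * B x z.
Proof.
move=> Sx Sz; have S0 := submodule0 hS.
by have := bilPl a Sx S0 Sz; rewrite addr0 bil0l// addr0.
Qed.

Lemma bilDl x y z : S x -> S y -> S z -> B (x + y) z = B x z + B y z.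
Proof. by move=> Sx Sy Sz; have := bilPl 1 Sx Sy Sz; rewrite scale1r mul1r. Qed.

Lemma bilBl x y z : S x -> S y -> S z -> B (x - y) z = B x z - B y z.
Proof.
by move=> Sx Sy Sz; rewrite addrC -scaleN1r bilPl// mulN1r addrC.
Qed.

Lemma bil0r z : S z -> B z 0 = 0.
Proof. by move=> Sz; rewrite bilC// ?bil0l//; exact: submodule0. Qed.

Lemma bilZr a x z : S x -> S z -> B z (a *: x) = a * B z x.
Proof. by move=> Sx Sz; rewrite bilC ?bilZl// 1?bilC//; exact: submoduleZ. Qed.

Lemma bilDr x y z : S x -> S y -> S z -> B z (x + y) = B z x + B z y.
Proof.
by move=> Sx Sy Sz; rewrite bilC ?bilDl// 1?(bilC Sz Sx) 1?(bilC Sz Sy)//; exact: submoduleD.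
Qed.

Lemma bilBr x y z : S x -> S y -> S z -> B z (x - y) = B z x - B z y.
Proof.
by move=> Sx Sy Sz; rewrite bilC ?bilBl// 1?(bilC Sz Sx) 1?(bilC Sz Sy)//; exact: submoduleB.
Qed.

Lemma bil_sqD x y : S x -> S y -> B (x + y) (x + y) = B x x + 2 * B x y + B y y.
Proof.
move=> Sx Sy; have Sxy := submoduleD hS Sx Sy.
by rewrite bilDl// !bilDr// (bilC Sy Sx); ring.
Qed.

End bilinear.

Section semi_inner_theory.
Context (X : lmodType R) (S : X -> Prop) (B : X -> X -> R).
Hypothesis h : semi_inner S B.
Local Notation n := (seminorm_of B).

Lemma semi_inner_submodule : submodule S. Proof. by case: h. Qed.
Lemma semi_inner_bil : sym_bilinear S B. Proof. by case: h. Qed.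
Lemma semi_inner_ge0 x : S x -> 0 <= B x x. Proof. by case: h => _ _; apply. Qed.
Let hS := semi_inner_submodule.
Let hB := semi_inner_bil.

Lemma seminorm_ge0 x : 0 <= n x. Proof. exact: sqrtr_ge0. Qed.

Lemma seminorm_sq x : S x -> n x ^+ 2 = B x x.
Proof. by move=> Sx; rewrite sqr_sqrtr// semi_inner_ge0. Qed.

Lemma seminorm0 : n 0 = 0.
Proof. by rewrite /seminorm_of (bil0l hS hB) ?sqrtr0//; exact: submodule0 hS. Qed.

Lemma cauchy_schwarz_sq x y : S x -> S y -> B x y ^+ 2 <= B x x * B y y.
Proof.
move=> Sx Sy.
have q a : 0 <= a ^+ 2 * B x x + 2 * a * B x y + B y y.
  have Sax := submoduleZ hS a Sx.
  have := semi_inner_ge0 (submoduleD hS Sax Sy).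
  by rewrite (bil_sqD hS hB)// (bilZl hS hB)// (bilZl hS hB)// (bilZr hS hB)//; lra.
have Bx := semi_inner_ge0 Sx; have By := semi_inner_ge0 Sy.
move: Bx; rewrite le_eqVlt => /predU1P[Bx0|Bx].
  suff -> : B x y = 0 by rewrite expr0n/= mulr_ge0// -?Bx0.
  apply/eqP; apply: contraT => Bxy.
  (* With [B x x = 0] the quadratic in [q] is affine in [a]; this [a] gives it the value -1. *)
  have := q (- (B y y + 1) / (2 * B x y)).
  have -> : 2 * (- (B y y + 1) / (2 * B x y)) * B x y = - (B y y + 1) by field.
  rewrite -Bx0; lra.
(* The minimizer of the quadratic. *)
have := q (- B x y / B x x).
have -> : (- B x y / B x x) ^+ 2 * B x x + 2 * (- B x y / B x x) * B x y + B y y =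
   (B x x * B y y - B x y ^+ 2) / B x x by field; rewrite gt_eqF.
by rewrite pmulr_lge0 ?invr_gt0// subr_ge0.
Qed.

Lemma cauchy_schwarz x y : S x -> S y -> `|B x y| <= n x * n y.
Proof.
move=> Sx Sy.
rewrite -sqrtrM ?semi_inner_ge0// -sqrtr_sqr ler_wsqrtr//.
exact: cauchy_schwarz_sq.
Qed.

Lemma seminormD x y : S x -> S y -> n (x + y) <= n x + n y.
Proof.
move=> Sx Sy.
rewrite -(@ler_pXn2r _ 2)// ?nnegrE ?addr_ge0// ?seminorm_ge0//.
rewrite seminorm_sq; last exact: submoduleD.
rewrite (bil_sqD hS hB)// sqrrD !seminorm_sq//.
have := cauchy_schwarz Sx Sy; have := ler_norm (B x y).
rewrite -mulr_natl; nra.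
Qed.

Lemma seminormZ a x : S x -> n (a *: x) = `|a| * n x.
Proof.
move=> Sx; rewrite /seminorm_of (bilZl hS hB)// ?(bilZr hS hB)//; last exact: submoduleZ.
by rewrite mulrA -expr2 sqrtrM ?sqr_ge0// sqrtr_sqr.
Qed.

Lemma seminormN x : S x -> n (- x) = n x.
Proof. by move=> Sx; rewrite -scaleN1r seminormZ// normrN1 mul1r. Qed.

Lemma seminormB x y : S x -> S y -> n (x - y) <= n x + n y.
Proof.
move=> Sx Sy; rewrite -(seminormN Sy) seminormD// -scaleN1r; exact: submoduleZ.
Qed.

Lemma seminorm_triangle x y : S x -> S y -> n x <= n y + n (x - y).
Proof.
move=> Sx Sy; rewrite -{1}[x](subrK y) addrC seminormD//; exact: submoduleB.
Qed.

Lemma seminorm_dist x y : S x -> S y -> `|n x - n y| <= n (x - y).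
Proof.
move=> Sx Sy; have := seminorm_triangle Sx Sy; have := seminorm_triangle Sy Sx.
rewrite -(seminormN (submoduleB hS Sy Sx)) opprB ler_norml; lra.
Qed.

Lemma bil_null x y : S x -> S y -> n x = 0 -> B x y = 0.
Proof.
move=> Sx Sy nx; apply/eqP; rewrite -normr_le0.
by rewrite (le_trans (cauchy_schwarz Sx Sy))// nx mul0r.
Qed.

(** Elements at distance 0 can be exchanged inside the form; this takes the place of a quotient
    space. *)
Lemma bil_eql x x' y : S x -> S x' -> S y -> n (x - x') = 0 -> B x y = B x' y.
Proof.
move=> Sx Sx' Sy nx; apply/eqP; rewrite -subr_eq0 -(bilBl hB)//.
by apply/eqP/bil_null => //; exact: submoduleB.
Qed.

Lemma seminorm_eq x x' : S x -> S x' -> n (x - x') = 0 -> n x = n x'.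
Proof.
by move=> Sx Sx' nx; apply/eqP; rewrite -subr_eq0 -normr_le0 -nx seminorm_dist.
Qed.

End semi_inner_theory.

Lemma sym_bilinear_comp (X Y : lmodType R) (f : {linear Y -> X}) (S : X -> Prop) B :
  sym_bilinear S B -> sym_bilinear (S \o f) (fun x y => B (f x) (f y)).
Proof.
move=> [h1 h2]; split => [x y Sx Sy|a x y z Sx Sy Sz]; first exact: h1.
by rewrite linearP h2.
Qed.

Lemma submodule_comp (X Y : lmodType R) (f : {linear Y -> X}) (S : X -> Prop) :
  submodule S -> submodule (S \o f).
Proof.
by move=> [h1 h2]; split => [|a x y Sx Sy] /=; rewrite ?linear0// linearP; exact: h2.
Qed.

Lemma semi_inner_comp (X Y : lmodType R) (f : {linear Y -> X}) (S : X -> Prop) B :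
  semi_inner S B -> semi_inner (S \o f) (fun x y => B (f x) (f y)).
Proof.
move=> [h1 h2 h3]; split; [exact: submodule_comp|exact: sym_bilinear_comp|].
by move=> x Sx; exact: h3.
Qed.

Lemma submoduleI (X : lmodType R) (S T : X -> Prop) :
  submodule S -> submodule T -> submodule (fun x => S x /\ T x).
Proof.
move=> [h1 h2] [h3 h4]; split => [//|a x y [Sx Tx] [Sy Ty]].
by split; [exact: h2|exact: h4].
Qed.

Lemma sym_bilinearS (X : lmodType R) (S T : X -> Prop) B :
  (forall x, T x -> S x) -> sym_bilinear S B -> sym_bilinear T B.
Proof.
move=> TS [h1 h2]; split => [x y /TS Sx /TS|a x y z /TS Sx /TS Sy /TS]; [exact: h1|exact: h2].
Qed.

Lemma semi_innerS (X : lmodType R) (S T : X -> Prop) B :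
  submodule T -> (forall x, T x -> S x) -> semi_inner S B -> semi_inner T B.
Proof.
move=> sT TS [_ h1 h2]; split => [//||x /TS]; [exact: sym_bilinearS h1|exact: h2].
Qed.

Lemma sym_bilinearD (X : lmodType R) (S : X -> Prop) B C :
  sym_bilinear S B -> sym_bilinear S C -> sym_bilinear S (fun x y => B x y + C x y).
Proof.
move=> [h1 h2] [h3 h4]; split => [x y Sx Sy|a x y z Sx Sy Sz].
  by rewrite h1// h3.
by rewrite h2// h4//; ring.
Qed.

Lemma sym_bilinearZ (X : lmodType R) (S : X -> Prop) k B :
  sym_bilinear S B -> sym_bilinear S (fun x y => k * B x y).
Proof.
move=> [h1 h2]; split => [x y Sx Sy|a x y z Sx Sy Sz].
  by rewrite h1.
by rewrite h2//; ring.
Qed.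

Lemma semi_innerD (X : lmodType R) (S : X -> Prop) B C :
  semi_inner S B -> semi_inner S C -> semi_inner S (fun x y => B x y + C x y).
Proof.
move=> [h1 h2 h3] [_ h4 h5]; split => // [|x Sx]; first exact: sym_bilinearD.
by rewrite addr_ge0 ?h3 ?h5.
Qed.

(** Cauchy-Schwarz for [C] itself carries a bound on the diagonal over to all pairs. *)
Lemma semi_inner_bound (X : lmodType R) (S : X -> Prop) C G (K : R) x y :
  semi_inner S C -> semi_inner S G -> 0 <= K ->
  (forall z, S z -> C z z <= K * G z z) -> S x -> S y ->
  `|C x y| <= K * (seminorm_of G x * seminorm_of G y).
Proof.
move=> hC hG K0 CG Sx Sy; rewrite (le_trans (cauchy_schwarz hC Sx Sy))//.
have le z : S z -> seminorm_of C z <= Num.sqrt K * seminorm_of G z.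
  by move=> Sz; rewrite -sqrtrM// ler_wsqrtr// CG.
rewrite -[X in _ <= X * _](sqr_sqrtr K0) expr2 mulrACA.
by rewrite ler_pM ?seminorm_ge0// le.
Qed.

End semi_inner_products.

(** * Square-integrable functions with values in a semi-inner product space *)

Section bochner_space.
Context (R : realType) (X : lmodType R) (S : X -> Prop) (B : X -> X -> R).
Local Notation mu := (@lebesgue_measure R).
Local Notation n := (seminorm_of B).

(* An inductive closure rather than finite sums, so that joint measurability of
   B (f r) (g s) is proved by induction on f and g. *)
Inductive simple_map : (R -> X) -> Prop :=
| simple_map0 : simple_map (fun=> 0)
| simple_map_indic (A : set R) (w : X) : measurable A -> S w ->
    simple_map (fun s => (\1_A s : R) *: w)
| simple_map_comb (a : R) f g : simple_map f -> simple_map g ->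
    simple_map (fun s => a *: f s + g s).

(** The abstract form of [L2H1], to be used with the H^1 product and again with the gradient form
    alone. *)
Definition bochner_L2 (v : R -> X) :=
  [/\ forall s : R, s \in `]0, 1[ -> S (v s),
      (exists F : nat -> R -> X, (forall k, simple_map (F k)) /\
         forall s : R, s \in `]0, 1[ -> n (F k s - v s) @[k --> \oo] --> (0 : R)) &
      (\int[mu]_(s in `]0%R, 1%R[) (B (v s) (v s))%:E < +oo)%E].

Hypothesis h : semi_inner S B.
Let hS := semi_inner_submodule h.
Let hB := semi_inner_bil h.

Lemma simple_map_in f s : simple_map f -> S (f s).
Proof.
elim => [|A w mA Sw|a f1 g _ Sf _ Sg]; first exact: submodule0 hS.
  exact: (submoduleZ hS).
exact: (submoduleP hS).
Qed.

Lemma cvg_bil (f g : nat -> X) x y :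
  (forall i, S (f i)) -> (forall i, S (g i)) -> S x -> S y ->
  n (f i - x) @[i --> \oo] --> (0 : R) -> n (g i - y) @[i --> \oo] --> (0 : R) ->
  B (f i) (g i) @[i --> \oo] --> B x y.
Proof.
move=> Sf Sg Sx Sy fx gy; apply/subr_cvg0/norm_cvg0P.
apply: (@squeeze_cvgr _ _ _ _ (cst 0) (fun i => n (f i - x) * (n y + n (g i - y)) + n x * n (g i - y))).
- near=> i; rewrite normr_ge0/=.
  have -> : B (f i) (g i) - B x y = B (f i - x) (g i) + B x (g i - y).
    by rewrite (bilBl hB)// (bilBr hS hB)//; ring.
  have S1 := submoduleB hS (Sf i) Sx; have S2 := submoduleB hS (Sg i) Sy.
  rewrite (le_trans (ler_normD _ _))// lerD ?(cauchy_schwarz h)//.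
  rewrite (le_trans (cauchy_schwarz h S1 (Sg i)))// ler_wpM2l ?seminorm_ge0//.
  exact: (seminorm_triangle h).
- exact: cvg_cst.
- have -> : 0 = 0 * (n y + 0) + n x * 0 :> R by ring.
  apply: cvgD; last by apply: cvgM => //; exact: cvg_cst.
  by apply: cvgM => //; apply: cvgD => //; exact: cvg_cst.
Unshelve. all: end_near. Qed.

Lemma measurable_simple_bil f g : simple_map f -> simple_map g ->
  measurable_fun setT (fun z : measurableTypeR R * measurableTypeR R => B (f z.1) (g z.2)).
Proof.
move=> sf sg.
elim: sf => [|A w mA Sw|a f1 f2 sf1 m1 sf2 m2].
- rewrite (_ : (fun _ => _) = cst 0); first exact: measurable_cst.
  by apply/funext => z; rewrite (bil0l hS hB)//; exact: simple_map_in.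
- rewrite (_ : (fun _ => _) = (\1_A \o fst) \* ((fun s => B w (g s)) \o snd)); last first.
    by apply/funext => z /=; rewrite (bilZl hS hB)//; exact: simple_map_in.
  apply: measurable_funM.
    by apply: measurableT_comp; [exact: measurable_indic|exact: measurable_fst].
  apply: measurableT_comp; last exact: measurable_snd.
  elim: sg => [|C w' mC Sw'|a g1 g2 sg1 m1 sg2 m2].
  + rewrite (_ : (fun _ => _) = cst 0); first exact: measurable_cst.
    by apply/funext => z; rewrite (bil0r hS hB).
  + rewrite (_ : (fun _ => _) = \1_C \* cst (B w w')); last first.
      by apply/funext => z /=; rewrite (bilZr hS hB).
    by apply: measurable_funM; [exact: measurable_indic|exact: measurable_cst].
  + rewrite (_ : (fun _ => _) = (fun s => a * B w (g1 s)) \+ (fun s => B w (g2 s))).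
      by apply: measurable_funD => //; apply: measurable_funM => //; exact: measurable_cst.
    apply/funext => z /=; have S1 := simple_map_in z sg1; have S2 := simple_map_in z sg2.
    by rewrite (bilDr hS hB)// ?(bilZr hS hB)//; exact: (submoduleZ hS).
- rewrite (_ : (fun _ => _) = (fun z => a * B (f1 z.1) (g z.2)) \+ (fun z => B (f2 z.1) (g z.2))).
    by apply: measurable_funD => //; apply: measurable_funM => //; exact: measurable_cst.
  by apply/funext => z /=; rewrite (bilPl hB)//; exact: simple_map_in.
Qed.

Definition strongly_measurable (v : R -> X) :=
  (forall s : R, s \in `]0, 1[ -> S (v s)) /\
  exists F : nat -> R -> X, (forall k, simple_map (F k)) /\
    forall s : R, s \in `]0, 1[ -> n (F k s - v s) @[k --> \oo] --> (0 : R).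

Lemma bochner_strongly_measurable v : bochner_L2 v -> strongly_measurable v.
Proof. by case. Qed.

Lemma bochner_L2_in v s : bochner_L2 v -> s \in `]0, 1[ -> S (v s).
Proof. by case => + _ _; apply. Qed.

(** Measurability in the pair of variables, as Fubini's theorem requires; it passes from simple maps
    to their pointwise limits by [cvg_bil]. *)
Lemma measurable_bil2 v w : strongly_measurable v -> strongly_measurable w ->
  measurable_fun ((`]0, 1[ : set (measurableTypeR R)) `*` (`]0, 1[ : set (measurableTypeR R)))
    (fun z : measurableTypeR R * measurableTypeR R => B (v z.1) (w z.2)).
Proof.
move=> [Sv [F [sF Fv]]] [Sw [G [sG Gw]]].
apply: (@measurable_fun_cvg _ _ _ _ (fun k z => B (F k z.1) (G k z.2))).
  by move=> k; apply: measurable_funTS; exact: measurable_simple_bil.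
move=> -[r s] [/= rI sI]; apply: cvg_bil; [..|exact: Fv|exact: Gw].
- by move=> i; exact: simple_map_in.
- by move=> i; exact: simple_map_in.
- exact: Sv.
- exact: Sw.
Qed.

Lemma measurable_bil v w : strongly_measurable v -> strongly_measurable w ->
  measurable_fun (`]0, 1[ : set (measurableTypeR R)) (fun s => B (v s) (w s)).
Proof.
move=> hv hw.
have := measurable_bil2 hv hw.
rewrite (_ : (fun s => B (v s) (w s)) =
  (fun z : measurableTypeR R * measurableTypeR R => B (v z.1) (w z.2)) \o (fun s => (s, s)))//.
move=> m; apply: (measurable_comp _ _ m).
- exact: measurableX.
- by move=> _ [s sI <-].
- by apply: measurable_funTS; apply: measurable_fun_pair => //; exact: measurable_id.
Qed.

Lemma integrable_bochner_sq v : bochner_L2 v ->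
  mu.-integrable `]0, 1[ (EFin \o (fun s => B (v s) (v s))).
Proof.
move=> hv; apply/integrableP; split.
  by apply/measurable_EFinP; by apply: measurable_bil; exact: bochner_strongly_measurable.
case: (hv) => Sv _; apply: le_lt_trans.
rewrite le_eqVlt; apply/orP; left; apply/eqP.
apply: eq_integral => s; rewrite inE/= => sI.
by rewrite /= ger0_norm// (semi_inner_ge0 h)//; exact: Sv.
Qed.

Lemma integrable_bochner v w (rho : R -> R) (M : R) : bochner_L2 v -> bochner_L2 w ->
  measurable_fun (setT : set (measurableTypeR R)) rho ->
  (forall s, s \in `]0, 1[ -> `|rho s| <= M) ->
  mu.-integrable `]0, 1[ (EFin \o (fun s => rho s * B (v s) (w s))).
Proof.
move=> hv hw mrho rhoM.
refine (le_integrable (g := EFin \o (fun s : measurableTypeR R => M * (B (v s) (v s) + B (w s) (w s)))) _ _ _ _) => //.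
- apply/measurable_EFinP; apply: measurable_funM; first exact: measurable_funTS.
  by apply: measurable_bil; exact: bochner_strongly_measurable.
- move=> s /= sI; rewrite lee_fin.
  have Sv := bochner_L2_in hv sI; have Sw := bochner_L2_in hw sI.
  have M0 : 0 <= M by rewrite (le_trans _ (rhoM _ sI)).
  have v0 := semi_inner_ge0 h Sv; have w0 := semi_inner_ge0 h Sw.
  rewrite normrM [leRHS]ger0_norm; last by rewrite mulr_ge0// addr_ge0.
  rewrite ler_pM//; first exact: rhoM.
  rewrite (le_trans (cauchy_schwarz h Sv Sw))// -(seminorm_sq h Sv) -(seminorm_sq h Sw).
  by have := seminorm_ge0 B (v s); have := seminorm_ge0 B (w s); nra.
- have := integrable_bochner_sq hv; have := integrable_bochner_sq hw => iw iv.
  rewrite (_ : EFin \o _ = (fun s => (M%:E * (EFin \o (fun s => B (v s) (v s)) \+ (EFin \o (fun s => B (w s) (w s)))) s)%E))//.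
  by apply: integrableZl => //; apply: integrableD.
Qed.

Lemma integrable_bochner_bil v w : bochner_L2 v -> bochner_L2 w ->
  mu.-integrable `]0, 1[ (EFin \o (fun s => B (v s) (w s))).
Proof.
move=> hv hw; have := @integrable_bochner v w (cst 1) 1 hv hw.
rewrite (_ : (fun s => cst 1 s * _) = (fun s => B (v s) (w s))); last first.
  by apply/funext => s; rewrite mul1r.
by apply; [exact: measurable_cst|move=> s _; rewrite normr1].
Qed.

Lemma integrable_bil_cst p Q : bochner_L2 p -> S Q ->
  mu.-integrable `]0, 1[ (EFin \o (fun r => B (p r) Q)).
Proof.
move=> hp SQ.
(* A constant function, written with the indicator of the whole line to match [simple_map_indic]. *)
have bQ : bochner_L2 (fun s => \1_setT s *: Q).
  split => [s _||]; first by apply: (submoduleZ hS).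
    exists (fun _ s => \1_setT s *: Q); split => [_|s _].
      by apply: simple_map_indic => //; exact: measurableT.
    by rewrite subrr (seminorm0 h); exact: cvg_cst.
  under eq_integral do rewrite indicE in_setT scale1r.
  rewrite integral_cst//= lebesgue_measure_itv/= lte_fin ltr01.
  by rewrite -EFinD -EFinM ltry.
have := integrable_bochner_bil hp bQ.
rewrite (_ : (fun s => B (p s) (\1_setT s *: Q)) = (fun s => B (p s) Q))//.
by apply/funext => s; rewrite indicE in_setT scale1r.
Qed.

Lemma submodule_bochner : submodule bochner_L2.
Proof.
split.
  split => [s _||]; first exact: submodule0 hS.
    exists (fun _ => cst 0); split => [k|s _]; first exact: simple_map0.
    by rewrite /= subrr (seminorm0 h); exact: cvg_cst.
  rewrite integral0_eq ?ltry// => s _; congr EFin.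
  by rewrite (bil0l hS hB)//; exact: submodule0 hS.
move=> a v w hv hw.
have [Sv [F [sF Fv]] _] := hv; have [Sw [G [sG Gw]] _] := hw.
have Svw : forall s, s \in `]0, 1[ -> S ((a *: v + w) s).
  by move=> s sI; apply: (submoduleP hS); [exact: Sv|exact: Sw].
have FG : exists H : nat -> R -> X, (forall k, simple_map (H k)) /\
    forall s : R, s \in `]0, 1[ -> n (H k s - (a *: v + w) s) @[k --> \oo] --> (0 : R).
  exists (fun k s => a *: F k s + G k s); split => [k|s sI]; first exact: simple_map_comb.
  apply: (@squeeze_cvgr _ _ _ _ (cst 0) (fun k => `|a| * n (F k s - v s) + n (G k s - w s))).
  - near=> k; rewrite seminorm_ge0/=.
    have -> : a *: F k s + G k s - (a *: v + w) s = a *: (F k s - v s) + (G k s - w s).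
      by rewrite [(a *: v + w) s](_ : _ = a *: v s + w s)// scalerBr opprD addrACA.
    have S1 := submoduleB hS (simple_map_in s (sF k)) (Sv s sI).
    have S2 := submoduleB hS (simple_map_in s (sG k)) (Sw s sI).
    by rewrite -(seminormZ h)// (seminormD h)//; exact: submoduleZ.
  - exact: cvg_cst.
  - have -> : 0 = `|a| * 0 + 0 :> R by ring.
    by apply: cvgD; [apply: cvgM; [exact: cvg_cst|exact: Fv]|exact: Gw].
split => //.
have iv := integrable_bochner_sq hv; have iw := integrable_bochner_sq hw.
have ivw := integrable_bochner_bil hv hw.
have : mu.-integrable `]0, 1[ (EFin \o (fun s => B ((a *: v + w) s) ((a *: v + w) s))).
  apply: (@eq_integrable _ _ _ _ _ _ (EFin \o (fun s : measurableTypeR R => a ^+ 2 * B (v s) (v s) +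
     (2 * a * B (v s) (w s) + B (w s) (w s))))) => //.
    move=> s; rewrite inE/= => sI; congr EFin.
    have S1 := Sv _ sI; have S2 := Sw _ sI; have S3 := submoduleZ hS a S1.
    rewrite [RHS](bil_sqD hS hB)// (bilZl hS hB)// (bilZr hS hB)// (bilZl hS hB)//.
    by ring.
  rewrite (_ : EFin \o _ = (fun s => ((a ^+ 2)%:E * (EFin \o (fun s => B (v s) (v s))) s)%E) \+
     ((fun s => ((2 * a)%:E * (EFin \o (fun s => B (v s) (w s))) s)%E) \+ (EFin \o (fun s => B (w s) (w s)))))//.
  by apply: integrableD => //; [exact: integrableZl|apply: integrableD => //; exact: integrableZl].
move=> /integrableP[_]; apply: le_lt_trans.
rewrite le_eqVlt; apply/orP; left; apply/eqP.
apply: eq_integral => s; rewrite inE/= => sI.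
by rewrite /= ger0_norm// (semi_inner_ge0 h)//; exact: Svw.
Unshelve. all: end_near. Qed.

Lemma semi_inner_bochner (rho : R -> R) (M : R) :
  measurable_fun (setT : set (measurableTypeR R)) rho ->
  (forall s, s \in `]0, 1[ -> 0 <= rho s <= M) ->
  semi_inner bochner_L2 (fun v w => \int[mu]_(s in `]0, 1[) (rho s * B (v s) (w s))).
Proof.
move=> mrho rhoM.
have rhoM' s : s \in `]0, 1[ -> `|rho s| <= M.
  by move=> /rhoM/andP[r0 ?]; rewrite ger0_norm.
split; first exact: submodule_bochner.
  split => [v w hv hw|a v w z hv hw hz].
    apply: eq_Rintegral => s; rewrite inE/= => sI; congr (_ * _).
    by apply: (bilC hB); exact: bochner_L2_in.
  rewrite -RintegralZl//; last exact: (integrable_bochner hv hz mrho rhoM').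
  rewrite -RintegralD//; last 2 first.
  - rewrite (_ : EFin \o _ = (fun s => (a%:E * (EFin \o (fun s => (rho s * B (v s) (z s))%R)) s)%E))//.
    by apply: integrableZl => //; exact: (integrable_bochner hv hz mrho rhoM').
  - exact: (integrable_bochner hw hz mrho rhoM').
  apply: eq_Rintegral => s; rewrite inE/= => sI.
  rewrite [B _ _](bilPl hB); [by ring|exact: bochner_L2_in..].
move=> v hv; apply: Rintegral_ge0 => s /= sI; have /andP[r0 _] := rhoM _ sI.
by rewrite mulr_ge0// (semi_inner_ge0 h)//; exact: bochner_L2_in.
Qed.

End bochner_space.

(** * Integration by parts in the history variable *)

Section dominated_fubini.
Context (R : realType) d1 d2 (T1 : measurableType d1) (T2 : measurableType d2).
Context (m1 : {sigma_finite_measure set T1 -> \bar R}).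
Context (m2 : {sigma_finite_measure set T2 -> \bar R}).
Context (f : T1 * T2 -> R) (a : T1 -> R) (b : T2 -> R).
Hypotheses (mf : measurable_fun setT f).
Hypotheses (ia : m1.-integrable setT (EFin \o a)) (ib : m2.-integrable setT (EFin \o b)).
Hypothesis fab : forall x y, `|f (x, y)| <= a x * b y.

(** The bound holds at every point, so every section is integrable, and not just almost every one;
    the inner integrals are finite and can be written as real numbers throughout. *)
Lemma dominated_integrable1 y : m1.-integrable setT (EFin \o (fun x => f (x, y))).
Proof.
refine (le_integrable (g := EFin \o (fun x => b y * a x)) _ _ _ _) => //.
- by apply/measurable_EFinP; apply: measurableT_comp.
- by move=> x _; rewrite lee_fin mulrC (le_trans (fab _ _))// ler_norm.
- by rewrite (_ : EFin \o _ = (fun x => ((b y)%:E * (EFin \o a) x)%E))//; exact: integrableZl.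
Qed.

Lemma dominated_integrable2 x : m2.-integrable setT (EFin \o (fun y => f (x, y))).
Proof.
refine (le_integrable (g := EFin \o (fun y => a x * b y)) _ _ _ _) => //.
- by apply/measurable_EFinP; apply: measurableT_comp.
- by move=> y _; rewrite lee_fin (le_trans (fab _ _))// ler_norm.
- by rewrite (_ : EFin \o _ = (fun y => ((a x)%:E * (EFin \o b) y)%E))//; exact: integrableZl.
Qed.

Let mF : measurable_fun setT (EFin \o f). Proof. exact/measurable_EFinP. Qed.

Lemma dominated_integrable_prod : (m1 \x m2)%E.-integrable setT (EFin \o f).
Proof.
apply/integrable12ltyP => //.
(* The majorant of the inner integral: the L^1 norm of [b] times [|a x|]. *)
have ina : m1.-integrable setT (fun x => (fine (\int[m2]_y `|(b y)%:E|) )%:E * `|(a x)%:E|)%E.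
  apply: integrableZl => //; exact: integrable_abse ia.
have /integrableP[_] := ina; apply: le_lt_trans.
apply: ge0_le_integral => //.
- by move=> x _; apply: integral_ge0.
- by apply: (measurable_fun_fubini_tonelli_F (abse \o (EFin \o f))) => //=; exact: measurableT_comp.
- by apply: measurableT_comp => //; exact: measurable_int ina.
move=> x _; have /integrableP[mb bfin] := ib.
have b0 : (0 <= \int[m2]_y `|(b y)%:E|)%E by exact: integral_ge0.
rewrite fineK ?ge0_fin_numE// gee0_abs ?mule_ge0//.
rewrite muleC -ge0_integralZl//; last exact: measurableT_comp.
apply: ge0_le_integral => //.
- by do 2 apply: measurableT_comp => //.
- by apply: emeasurable_funM => //; apply: measurableT_comp.
- by move=> y _; rewrite -abseM -EFinM lee_fin (le_trans (fab _ _))// ler_norm.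
Qed.

Let fE1 x : (\int[m2]_y f (x, y))%:E = (\int[m2]_y (f (x, y))%:E)%E.
Proof. by rewrite fineK//; apply: integrable_fin_num => //; exact: dominated_integrable2. Qed.

Let fE2 y : (\int[m1]_x f (x, y))%:E = (\int[m1]_x (f (x, y))%:E)%E.
Proof. by rewrite fineK//; apply: integrable_fin_num => //; exact: dominated_integrable1. Qed.

Lemma dominated_integrable_inner2 :
  m1.-integrable setT (EFin \o (fun x => \int[m2]_y f (x, y))).
Proof.
rewrite (_ : _ \o _ = (fun x => \int[m2]_y (EFin \o f) (x, y))%E); last first.
  by apply/funext => x /=; exact: fE1.
exact: (integrable_fubini_F dominated_integrable_prod).
Qed.

Lemma fubini_Rintegral :
  \int[m1]_x \int[m2]_y f (x, y) = \int[m2]_y \int[m1]_x f (x, y).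
Proof.
congr fine.
under eq_integral do rewrite fE1.
under [RHS]eq_integral do rewrite fE2.
exact: (Fubini dominated_integrable_prod).
Qed.

End dominated_fubini.

(** * Fubini's theorem on the triangle 0 < r < s < t *)

Section triangle_fubini.
Context (R : realType).
Local Notation T := (measurableTypeR R).
Local Notation mu := (@lebesgue_measure R).
Local Notation I := (`]0%R, 1%R[%classic : set T).
Context (g : T * T -> R) (a b : T -> R) (t : R).
Hypothesis mg : measurable_fun (I `*` I) g.
Hypotheses (ia : mu.-integrable I (EFin \o a)) (ib : mu.-integrable I (EFin \o b)).
Hypothesis gab : forall x y, I x -> I y -> `|g (x, y)| <= a x * b y.
Hypothesis t01 : t \in `[0, 1].

(** The pairs (s, r) with 0 < r < s < t, in this order. Below, [g] is extended by 0 outside [D] so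
    that Fubini's theorem applies on the whole plane. *)
Let D : set (T * T) := [set z | [&& 0 < z.2, z.2 < z.1 & z.1 < t]].

Let DI : D `<=` I `*` I.
Proof.
move=> [s r] /and3P[/= r0 rs st]; move: t01; rewrite in_itv/= => /andP[_ t1].
split; rewrite /= in_itv/=.
  by rewrite (lt_trans r0)//= (lt_le_trans st).
by rewrite r0 (lt_trans rs)// (lt_le_trans st).
Qed.

Let mD : measurable D.
Proof.
have mlt (u v : T * T -> R) : measurable_fun setT u -> measurable_fun setT v ->
    measurable [set z | u z < v z].
  move=> mu' mv; have := measurable_fun_ltr mu' mv measurableT.
  by move=> /(_ [set true]); rewrite setTI; apply.
rewrite (_ : D = [set z | 0 < z.2] `&` ([set z | z.2 < z.1] `&` [set z | z.1 < t])).
  apply: measurableI; [|apply: measurableI]; apply: mlt.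
  - exact: measurable_cst.
  - exact: measurable_snd.
  - exact: measurable_snd.
  - exact: measurable_fst.
  - exact: measurable_fst.
  - exact: measurable_cst.
apply/seteqP; split => [z /and3P[]//|z [/= z1 [z2 z3]]].
by rewrite /D/= z1 z2 z3.
Qed.

Let f := g \_ D.

Let mf : measurable_fun setT f.
Proof.
apply/(measurable_restrict g mD measurableT); rewrite setTI.
by apply: measurable_funS mg => //; exact: measurableX.
Qed.

Let ia' : mu.-integrable setT (EFin \o (a \_ I)).
Proof. by rewrite -restrict_EFin -integrable_mkcond. Qed.

Let ib' : mu.-integrable setT (EFin \o (b \_ I)).
Proof. by rewrite -restrict_EFin -integrable_mkcond. Qed.

Let fab x y : `|f (x, y)| <= (a \_ I) x * (b \_ I) y.
Proof.
rewrite /f patchE; case: ifPn => [|_].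
  rewrite inE => /DI[/= xI yI]; rewrite !patchE !mem_set//; exact: gab.
rewrite normr0 !patchE; case: ifPn; case: ifPn; rewrite ?mulr0 ?mul0r// !inE => yI xI.
by rewrite (le_trans _ (gab xI yI)).
Qed.

Let in_D s r : (s, r) \in D = [&& 0 < r, r < s & s < t].
Proof. by apply/idP/idP; [rewrite inE|move=> h; rewrite inE]. Qed.

Let inner_r s : \int[mu]_r f (s, r) = ((fun s => \int[mu]_(r in `]0, s[) g (s, r)) \_ `]0, t[) s.
Proof.
rewrite patchE; case: ifPn => sI.
  rewrite [RHS]Rintegral_mkcond; apply: eq_Rintegral => r _.
  rewrite /f !patchE in_D.
  move: sI; rewrite inE/= in_itv/= => /andP[s0 st].
  have -> : (r \in `]0%R, s[%classic) = (0 < r) && (r < s).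
    by apply/idP/idP; rewrite inE/= in_itv.
  by rewrite st andbT.
(* For s outside ]0, t[ the section of [D] is empty, so 0 is written as an integral over the empty
   set. *)
rewrite -[RHS](@Rintegral_set0 _ _ _ mu (cst 0)) [RHS]Rintegral_mkcond; apply: eq_Rintegral => r _.
rewrite /f !patchE in_D in_set0; case: ifPn => // /and3P[r0 rs st].
by move: sI; rewrite notin_setE/= in_itv/= st (lt_trans r0 rs).
Qed.

Let inner_s r : \int[mu]_s f (s, r) = ((fun r => \int[mu]_(s in `]r, t[) g (s, r)) \_ `]0, t[) r.
Proof.
rewrite patchE; case: ifPn => rI.
  rewrite [RHS]Rintegral_mkcond; apply: eq_Rintegral => s _.
  rewrite /f !patchE in_D.
  move: rI; rewrite inE/= in_itv/= => /andP[r0 rt].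
  have -> : (s \in `]r, t[%classic) = (r < s) && (s < t).
    by apply/idP/idP; rewrite inE/= in_itv.
  by rewrite r0.
rewrite -[RHS](@Rintegral_set0 _ _ _ mu (cst 0)) [RHS]Rintegral_mkcond; apply: eq_Rintegral => s _.
rewrite /f !patchE in_D in_set0; case: ifPn => // /and3P[r0 rs st].
by move: rI; rewrite notin_setE/= in_itv/= r0 (lt_trans rs st).
Qed.

Lemma triangle_integrable :
  mu.-integrable `]0, t[ (EFin \o (fun s => \int[mu]_(r in `]0, s[) g (s, r))).
Proof.
have i := dominated_integrable_inner2 mf ia' ib' fab.
by rewrite integrable_mkcond// restrict_EFin -(funext inner_r).
Qed.

Lemma triangle_fubini :
  \int[mu]_(s in `]0, t[) \int[mu]_(r in `]0, s[) g (s, r) =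
  \int[mu]_(r in `]0, t[) \int[mu]_(s in `]r, t[) g (s, r).
Proof.
rewrite [LHS]Rintegral_mkcond [RHS]Rintegral_mkcond.
have := fubini_Rintegral mf ia' ib' fab.
under eq_Rintegral do rewrite inner_r.
by under [in RHS]eq_Rintegral do rewrite inner_s.
Qed.

End triangle_fubini.

(** * The energy identity and its weighted form *)

Section integration_by_parts.
Context (R : realType) (X : lmodType R) (S : X -> Prop) (B : X -> X -> R).
Local Notation T := (measurableTypeR R).
Local Notation mu := (@lebesgue_measure R).
Local Notation I := (`]0%R, 1%R[%classic : set T).
Hypothesis h : semi_inner S B.
Let hS := semi_inner_submodule h.
Let hB := semi_inner_bil h.
Context (v w p : R -> X).
Hypotheses (hv : bochner_L2 S B v) (hp : bochner_L2 S B p).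
Hypothesis wS : forall s : R, s \in `[0, 1] -> S (w s).
Hypothesis hw : forall s : R, s \in `[0, 1] -> forall Q, S Q ->
  B (w s - w 0) Q = \int[mu]_(r in `]0, s[) B (p r) Q.
Hypothesis hvw : {ae mu, forall s : R, s \in `]0, 1[ -> seminorm_of B (v s - w s) = 0}.

Let S0 : S (w 0). Proof. by apply: wS; rewrite in_itv/= lexx ler01. Qed.

Let oc (s : R) : s \in `]0, 1[ -> s \in `[0, 1].
Proof. by rewrite !in_itv/= => /andP[/ltW-> /ltW->]. Qed.

Let Sg (s : R) : s \in `[0, 1] -> S (w s - w 0).
Proof. by move=> s01; apply: (submoduleB hS) => //; exact: wS. Qed.

Let Sp (s : R) : s \in `]0, 1[ -> S (p s). Proof. exact: bochner_L2_in hp. Qed.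

Let sub_oo (s t : R) : t \in `[0, 1] -> s \in `]0, t[ -> s \in `]0, 1[.
Proof.
rewrite !in_itv/= => /andP[_ t1] /andP[-> st]; exact: lt_le_trans st t1.
Qed.

Let integrable_cst_bil Q : S Q -> mu.-integrable I (EFin \o (fun r => B (p r) Q)).
Proof. exact: (integrable_bil_cst h hp). Qed.

Let integrable_sub (t : R) (f : T -> R) : t \in `[0, 1] ->
  mu.-integrable I (EFin \o f) -> mu.-integrable (`]0%R, t[ : set T) (EFin \o f).
Proof.
move=> t01; apply: integrableS => // s; exact: sub_oo.
Qed.

Let phi (z : T * T) := B (p z.1) (p z.2).
(** A majorant for Fubini: |<p(s), p(r)>| <= |p(s)| |p(r)| <= a(s) a(r), and [a] is integrable
    because |p|^2 is. *)
Let a (s : T) := 1 + B (p s) (p s).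

Let ione : mu.-integrable I (EFin \o (cst 1 : T -> R)).
Proof.
apply/integrableP; split; first by apply/measurable_EFinP; exact: measurable_cst.
rewrite [ltLHS](_ : _ = (\int[mu]_(x in I) 1)%E); last first.
  by apply: eq_integral => s _; rewrite /= normr1.
by rewrite integral_cst//= lebesgue_measure_itv/= lte_fin ltr01 -EFinD -EFinM ltry.
Qed.

Let ia : mu.-integrable I (EFin \o a).
Proof.
have i2 := integrable_bochner_sq h hp.
have mI : measurable I by exact: measurable_itv.
exact: (integrableD mI ione i2).
Qed.

Let phi_le s r : I s -> I r -> `|phi (s, r)| <= a s * a r.
Proof.
move=> sI rI; have S1 := Sp sI; have S2 := Sp rI.
rewrite (le_trans (cauchy_schwarz h S1 S2))// /a -(seminorm_sq h S1) -(seminorm_sq h S2).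
have := seminorm_ge0 B (p s); have := seminorm_ge0 B (p r).
set x := seminorm_of B (p s); set y := seminorm_of B (p r) => y0 x0.
have : 0 <= x ^+ 2 * y ^+ 2 by rewrite mulr_ge0 ?sqr_ge0.
nra.
Qed.

Let k s := B (w s - w 0) (p s).

(** The duality identity tested with Q = p(s), where s is also the upper endpoint of the
    integral. *)
Let kE (s : R) : s \in `]0, 1[ -> \int[mu]_(r in `]0, s[) phi (s, r) = k s.
Proof.
move=> sI; rewrite /k hw; [|exact: oc|exact: Sp].
apply: eq_Rintegral => r; rewrite inE/= => rs; rewrite /phi/= (bilC hB)//; first exact: Sp.
by apply: Sp; apply: sub_oo rs; exact: oc.
Qed.

Let integrable_k : mu.-integrable I (EFin \o k).
Proof.
have := triangle_integrable (measurable_bil2 h (bochner_strongly_measurable hp) (bochner_strongly_measurable hp)) ia ia phi_le.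
move=> /(_ 1); rewrite in_itv/= ler01 lexx => /(_ isT).
by apply: eq_integrable => // s; rewrite inE/= => sI; congr EFin; exact: kE.
Qed.

(** Let K be the integral of the symmetric kernel <p(s), p(r)> over the triangle, which is the
    integral of [k]. In the other order the inner integral over ]r, t[ is <w(t) - w(0), p(r)> -
    k(r), so K = |w(t) - w(0)|^2 - K. *)
Let int_k (t : R) : t \in `[0, 1] ->
  2 * \int[mu]_(s in `]0, t[) k s = B (w t - w 0) (w t - w 0).
Proof.
move=> t01.
have ik := integrable_sub t01 integrable_k.
have ig := integrable_sub t01 (integrable_cst_bil (Sg t01)).
have E1 : \int[mu]_(s in `]0, t[) \int[mu]_(r in `]0, s[) phi (s, r) =
    \int[mu]_(s in `]0, t[) k s.
  by apply: eq_Rintegral => s; rewrite inE/= => st; apply: kE; exact: sub_oo st.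
have E2 : \int[mu]_(r in `]0, t[) \int[mu]_(s in `]r, t[) phi (s, r) =
    \int[mu]_(r in `]0, t[) (B (p r) (w t - w 0) - k r).
  apply: eq_Rintegral => r; rewrite inE/= => rt; have rI := sub_oo t01 rt.
  have irt := integrable_sub t01 (integrable_cst_bil (Sp rI)).
  have E (u : R) : u \in `[0, 1] -> \int[mu]_(s in `]0, u[) phi (s, r) = B (w u - w 0) (p r).
    by move=> u01; rewrite hw//; exact: Sp.
  move: (rt); rewrite in_itv/= => /andP[r0 r1].
  (* ]r, t[ is ]0, t[ minus ]0, r], whose endpoint r is then dropped. *)
  rewrite -(@Rintegral_itvB R (fun s => phi (s, r)) (BRight 0) (BLeft t) r irt)//.
  - rewrite -Rintegral_itv_bndo_bndc; last first.
      by apply: integrable_sub; [exact: oc|exact: integrable_cst_bil (Sp rI)].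
    rewrite !E//; last exact: oc.
    by rewrite /k (bilC hB (Sp rI))//; exact: Sg.
  - by rewrite bnd_simp ltW.
have := triangle_fubini (measurable_bil2 h (bochner_strongly_measurable hp) (bochner_strongly_measurable hp)) ia ia phi_le t01.
rewrite -/(phi _) E1 E2 RintegralB// -hw//; last exact: Sg.
by move=> e; rewrite mulr_natl mulr2n {2}e addrC subrK.
Qed.

Let q s := B (w s) (p s).

Let qE (s : R) : s \in `]0, 1[ -> q s = k s + B (p s) (w 0).
Proof.
move=> sI; rewrite /q /k (bilC hB (Sp sI) S0) -(bilDl hB) ?subrK//; first exact/Sg/oc.
exact: Sp.
Qed.

Let integrable_q : mu.-integrable I (EFin \o q).
Proof.
have mI : measurable I by exact: measurable_itv.
have := integrableD mI integrable_k (integrable_cst_bil S0).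
by apply: eq_integrable => // s; rewrite inE/= => sI; rewrite qE.
Qed.

(** Expand the square of (w(t) - w(0)) + w(0): [int_k] gives the first square, and the duality
    identity with Q = w(0) the cross term. *)
Lemma energy_identity (t : R) : t \in `[0, 1] ->
  B (w t) (w t) = B (w 0) (w 0) + 2 * \int[mu]_(s in `]0, t[) B (w s) (p s).
Proof.
move=> t01.
have -> : \int[mu]_(s in `]0, t[) B (w s) (p s) = \int[mu]_(s in `]0, t[) (k s + B (p s) (w 0)).
  by apply: eq_Rintegral => s; rewrite inE/= => st; apply: qE; exact: sub_oo st.
rewrite RintegralD//; last 2 first.
  exact: integrable_sub integrable_k.
  by apply: integrable_sub => //; exact: integrable_cst_bil.
rewrite mulrDr int_k// -hw//.
rewrite -{1 2}(subrK (w 0) (w t)) (bil_sqD hS hB (Sg t01) S0).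
by ring.
Qed.

(** The constant part of the weight is [energy_identity] at t = 1. In the part (1 - s), this factor
    is the length of ]s, 1[, so Fubini turns the integral into that of int_0^s <w, p>, which is
    (|w(s)|^2 - |w(0)|^2) / 2, again by [energy_identity]. Under the integrals [v] stands in for its
    representative [w], with which it agrees almost everywhere. *)
Lemma integral_by_parts (e : R) :
  2 * \int[mu]_(s in `]0, 1[) ((1 + e * (1 - s)) * B (v s) (p s)) =
  B (w 1) (w 1) - (1 + e) * B (w 0) (w 0) + e * \int[mu]_(s in `]0, 1[) B (v s) (v s).
Proof.
have o01 : 1 \in `[0%R, 1%R : R] by rewrite in_itv/= ler01 lexx.
have mlin : measurable_fun setT (fun s : T => 1 + e * (1 - s)).
  apply: measurable_funD => //; apply: measurable_funM => //.
  by apply: measurable_funB.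
have linM (s : R) : s \in `]0, 1[ -> `|1 + e * (1 - s)| <= 1 + `|e|.
  rewrite in_itv/= => /andP[s0 s1].
  rewrite (le_trans (ler_normD _ _))// normr1 lerD2l normrM ler_piMr//.
  by rewrite ger0_norm; lra.
have vw : ae_eq mu I (EFin \o (fun s => (1 + e * (1 - s)) * B (v s) (p s)))
                     (EFin \o (fun s => (1 + e * (1 - s)) * q s)).
  move: hvw; apply: filterS; first exact: (ae_filter_ringOfSetsType mu).
  move=> s H sI /=; congr ((_ * _)%:E).
  by apply: (bil_eql h) (H sI); [exact: bochner_L2_in hv sI|exact/wS/oc|exact: Sp].
have ilin (f : T -> R) (M : R) (rho : T -> R) : measurable_fun setT rho ->
    (forall s : R, s \in `]0, 1[ -> `|rho s| <= M) -> mu.-integrable I (EFin \o f) ->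
    mu.-integrable I (EFin \o (fun s => rho s * f s)).
  move=> mr rM iff.
  refine (le_integrable (g := EFin \o (fun s : T => M * f s)) _ _ _ _) => //.
  - apply/measurable_EFinP; apply: measurable_funM; first exact: measurable_funTS.
    by apply/measurable_EFinP; exact: measurable_int iff.
  - move=> s sI /=; rewrite lee_fin !normrM ler_wpM2r//.
    by rewrite (le_trans (rM _ sI))// ler_norm.
  - by rewrite (_ : EFin \o _ = (fun s => M%:E * (EFin \o f) s)%E)//; exact: integrableZl.
have iq := integrable_q.
have i1q : mu.-integrable I (EFin \o (fun s => (1 - s) * q s)).
  apply: (ilin q 1) => //; first exact: measurable_funB.
  by move=> s; rewrite in_itv/= => /andP[s0 s1]; rewrite ger0_norm; lra.
have -> : \int[mu]_(s in `]0, 1[) ((1 + e * (1 - s)) * B (v s) (p s)) =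
    \int[mu]_(s in `]0, 1[) (q s + e * ((1 - s) * q s)).
  congr fine; rewrite (ae_eq_integral (EFin \o (fun s : T => (1 + e * (1 - s)) * q s)) _ _ _ _ vw)//.
  - by apply: eq_integral => s _; congr EFin => /=; ring.
  - exact: measurable_int (integrable_bochner h hv hp mlin linM).
  - exact: measurable_int (ilin _ _ _ mlin linM iq).
rewrite RintegralD//; last first.
  by rewrite (_ : _ \o _ = (fun s => e%:E * (EFin \o (fun s => (1 - s) * q s)%R) s)%E)//; exact: integrableZl.
rewrite RintegralZl// mulrDr.
have := energy_identity o01; rewrite -/q => ->.
suff : 2 * \int[mu]_(s in `]0, 1[) ((1 - s) * q s) = \int[mu]_(s in `]0, 1[) B (v s) (v s) - B (w 0) (w 0).
  by move=> E; rewrite (mulrCA 2 e) E; ring.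
(* Independent of the first variable, so that its integral over ]r, 1[ is (1 - r) q(r). *)
pose g (z : T * T) := q z.2.
have mg : measurable_fun (I `*` I) g.
  apply: (@measurable_comp _ _ _ _ _ _ I q _ snd) => //.
  - by move=> _ [[s r] [? ?] <-].
  - by apply/measurable_EFinP; exact: measurable_int iq.
  - by apply: measurable_funTS; exact: measurable_snd.
have iaq : mu.-integrable I (EFin \o (fun s => `|q s|)) by exact: integrable_abse iq.
have gle s r : I s -> I r -> `|g (s, r)| <= cst 1 s * `|q r| by rewrite /g/= mul1r.
have := triangle_fubini mg ione iaq gle o01.
have -> : \int[mu]_(r in `]0, 1[) \int[mu]_(s in `]r, 1[) g (s, r) = \int[mu]_(s in `]0, 1[) ((1 - s) * q s).
  apply: eq_Rintegral => r; rewrite inE/= in_itv/= => /andP[r0 r1].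
  by rewrite /g/= Rintegral_cst//= lebesgue_measure_itv/= lte_fin r1 -EFinD/= mulrC.
move=> <-.
have iQ := triangle_integrable mg ione iaq gle o01.
rewrite -RintegralZl//.
have -> : \int[mu]_(s in `]0, 1[) B (v s) (v s) =
    \int[mu]_(s in `]0, 1[) (B (w 0) (w 0) + 2 * \int[mu]_(r in `]0, s[) g (s, r)).
  congr fine; apply: ae_eq_integral => //.
  - exact: measurable_int (integrable_bochner_sq h hv).
  - apply/measurable_EFinP; apply: measurable_funD => //; apply: measurable_funM => //.
    by apply/measurable_EFinP; exact: measurable_int iQ.
  - move: hvw; apply: filterS; first exact: (ae_filter_ringOfSetsType mu).
  move=> s H sI; congr EFin.
    have s01 := oc sI; have Sv := bochner_L2_in hv sI; have Sw := wS s01.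
    rewrite -energy_identity// (bil_eql h Sv Sw Sv (H sI)) (bilC hB Sw Sv).
    by rewrite (bil_eql h Sv Sw Sw (H sI)).
rewrite RintegralD//.
- rewrite [X in _ = X + _ - _](@Rintegral_cst _ _ _ mu)//=; rewrite lebesgue_measure_itv/= lte_fin ltr01 -EFinD/=.
  ring.
- by rewrite (_ : _ \o _ = (fun s => (B (w 0) (w 0))%:E * (EFin \o cst 1%R) s)%E); [exact: integrableZl|apply/funext => s /=; rewrite mule1].
- by rewrite (_ : _ \o _ = (fun s => 2%:E * (EFin \o (fun s => \int[mu]_(r in `]0%R, s[) g (s, r))%R) s)%E)//; exact: integrableZl.
Qed.

End integration_by_parts.

(** * The spaces L^2, H^1 and H^1_{G0} *)

Section square_integrable.
Context (R : realType) d (T : measurableType d) (mu : {measure set T -> \bar R}).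
Context (D : set T) (mD : measurable D).

Definition sq_integrable (f : T -> R^o) := measurable_fun D (f : T -> R) /\
  (\int[mu]_(x in D) (f x ^+ 2)%:E < +oo)%E.

Definition sq_dot (f g : T -> R^o) : R := \int[mu]_(x in D) (f x * g x).

Lemma sq_integrableP (f : T -> R^o) : sq_integrable f <->
  measurable_fun D (f : T -> R) /\ mu.-integrable D (EFin \o (fun x => (f x : R) ^+ 2)).
Proof.
split=> -[mf fi]; split=> //.
  apply/integrableP; split; first by apply/measurable_EFinP; exact: measurable_funX.
  apply: le_lt_trans fi; rewrite le_eqVlt; apply/orP; left; apply/eqP.
  by apply: eq_integral => x _; rewrite /= ger0_norm// sqr_ge0.
move/integrableP : fi => [_]; apply: le_lt_trans.
rewrite le_eqVlt; apply/orP; left; apply/eqP.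
by apply: eq_integral => x _; rewrite /= ger0_norm// sqr_ge0.
Qed.

Lemma integrable_sq_dot f g : sq_integrable f -> sq_integrable g ->
  mu.-integrable D (EFin \o (fun x => (f x : R) * (g x : R))).
Proof.
move=> /sq_integrableP[mf fi] /sq_integrableP[mg gi].
have i := integrableD mD fi gi.
apply: le_integrable i => //.
  by apply/measurable_EFinP; exact: measurable_funM.
move=> x _; rewrite lee_fin normrM [leRHS]ger0_norm ?addr_ge0 ?sqr_ge0//.
rewrite -(real_normK (num_real (f x))) -(real_normK (num_real (g x))).
by have := normr_ge0 (f x); have := normr_ge0 (g x); nra.
Qed.

Lemma submodule_sq_integrable : submodule sq_integrable.
Proof.
split.
  split; first exact: measurable_cst.
  by under eq_integral do rewrite expr0n/=; rewrite integral0 ltry.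
move=> a f g hf hg; have [mf _] := hf; have [mg _] := hg.
apply/sq_integrableP; split.
  apply: measurable_funD => //; exact: measurable_funM.
have ff := integrable_sq_dot hf hf; have gg := integrable_sq_dot hg hg.
have fg := integrable_sq_dot hf hg.
have := integrableD mD (integrableZl mD (a ^+ 2) ff) (integrableD mD (integrableZl mD (2 * a) fg) gg).
apply: eq_integrable => // x _; congr EFin.
rewrite /= [((a *: f + g) x)](_ : _ = a * f x + g x)//; ring.
Qed.

Lemma semi_inner_sq_dot : semi_inner sq_integrable sq_dot.
Proof.
split; first exact: submodule_sq_integrable.
  split => [f g hf hg|a f g k hf hg hk].
    by apply: eq_Rintegral => x _; rewrite mulrC.
  have fk := integrable_sq_dot hf hk; have gk := integrable_sq_dot hg hk.
  rewrite /sq_dot -RintegralZl// -RintegralD//; last exact: (integrableZl mD a fk).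
  by apply: eq_Rintegral => x _; rewrite [((a *: f + g) x)](_ : _ = a * f x + g x)// mulrDl mulrA.
by move=> f hf; apply: Rintegral_ge0 => x _; rewrite -expr2 sqr_ge0.
Qed.

Lemma bounded_sq_integrable (f : T -> R^o) (M : R) :
  (mu D < +oo)%E -> measurable_fun D (f : T -> R) ->
  (forall x, D x -> `|f x| <= M) -> sq_integrable f.
Proof.
move=> muD mf fM; apply/sq_integrableP; split => //.
apply: measurable_bounded_integrable => //; first exact: measurable_funX.
exists (M ^+ 2); split; first exact: num_real.
move=> y My x Dx; rewrite /= (le_trans _ (ltW My))// normrX.
by rewrite lerXn2r ?nnegrE// ?fM// (le_trans _ (fM _ Dx)).
Qed.

Lemma Rintegral_sum (I : Type) (s : seq I) (f : I -> T -> R) :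
  (forall i, mu.-integrable D (EFin \o f i)) ->
  \int[mu]_(x in D) (\sum_(i <- s) f i x) = \sum_(i <- s) \int[mu]_(x in D) f i x.
Proof.
move=> fi; elim: s => [|i s IH].
  rewrite big_nil; under eq_Rintegral do rewrite big_nil.
  by rewrite /Rintegral integral0.
rewrite big_cons -IH -RintegralD//; first by under eq_Rintegral do rewrite big_cons.
rewrite (_ : _ \o _ = (fun x => (\sum_(j <- s) (EFin \o f j) x)%E)).
  by apply: integrable_sum.
by apply/funext => x /=; rewrite sumEFin.
Qed.

End square_integrable.

Section sobolev_forms.
Context (R : realType) (d : nat) (Om : set 'rV[R]_d).
Hypothesis mOm : measurable Om.
Local Notation E := 'rV[R]_d.
Local Notation leb := (@lebesgue_rV R d).

Definition l2dot (f g : E -> R^o) : R := \int[leb]_(x in Om) (f x * g x).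

Lemma semi_inner_l2 : semi_inner (L2 Om : (E -> R^o) -> Prop) l2dot.
Proof. exact: semi_inner_sq_dot. Qed.

Lemma L2normE f : L2norm Om f = seminorm_of l2dot f.
Proof. by rewrite /L2norm /seminorm_of /l2dot; congr Num.sqrt; apply: eq_Rintegral => x _; rewrite expr2. Qed.

Definition coordf (i : 'I_d) (G : E -> E) : E -> R^o := fun x => G x 0 i.

Lemma coordf_is_linear i : linear (coordf i).
Proof. by move=> a G K; apply/funext => x; rewrite /coordf !mxE. Qed.

HB.instance Definition _ i := GRing.isLinear.Build R (E -> E) (E -> R^o) _ (coordf i) (coordf_is_linear i).

Lemma L2vec_dotE G K : L2vec Om G -> L2vec Om K ->
  L2vec_dot Om G K = \sum_i l2dot (coordf i G) (coordf i K).
Proof.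
move=> hG hK; rewrite /L2vec_dot /dotp /l2dot.
have iGK i : leb.-integrable Om (EFin \o (fun x => coordf i G x * coordf i K x)).
  by apply: integrable_sq_dot => //; [exact: hG|exact: hK].
by rewrite -Rintegral_sum.
Qed.

Lemma submodule_L2vec : submodule (L2vec Om : (E -> E) -> Prop).
Proof.
split => [i|a G K hG hK i]; first by have := submodule0 (semi_inner_submodule semi_inner_l2); congr L2; apply/funext => x; rewrite mxE.
have := submoduleP (semi_inner_submodule semi_inner_l2) a (hG i) (hK i).
by congr L2; apply/funext => x; rewrite !mxE.
Qed.

Lemma semi_inner_L2vec : semi_inner (L2vec Om : (E -> E) -> Prop) (L2vec_dot Om).
Proof.
split; first exact: submodule_L2vec.
  split => [G K hG hK|a G K L hG hK hL].
    by apply: eq_Rintegral => x _; apply: eq_bigr => i _; rewrite mulrC.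
  have haGK := submoduleP submodule_L2vec a hG hK.
  rewrite !L2vec_dotE// mulr_sumr -big_split; apply: eq_bigr => i _ /=.
  rewrite linearP; apply: (bilPl (semi_inner_bil semi_inner_l2)); [exact: hG|exact: hK|exact: hL].
by move=> G hG; apply: Rintegral_ge0 => x _; apply: sumr_ge0 => i _; rewrite -expr2 sqr_ge0.
Qed.

Definition h1_grad (P : h1 R d) : E -> E := P.2.
Definition h1_fun (P : h1 R d) : E -> R^o := P.1.
Lemma h1_grad_is_linear : linear h1_grad. Proof. by []. Qed.
Lemma h1_fun_is_linear : linear h1_fun. Proof. by []. Qed.
HB.instance Definition _ := GRing.isLinear.Build R (h1 R d) (E -> E) _ h1_grad h1_grad_is_linear.
HB.instance Definition _ := GRing.isLinear.Build R (h1 R d) (E -> R^o) _ h1_fun h1_fun_is_linear.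

Definition graddot (P Q : h1 R d) := L2vec_dot Om P.2 Q.2.
Definition fundot (P Q : h1 R d) := l2dot P.1 Q.1.

Lemma submodule_L2pair : submodule (L2pair Om).
Proof.
apply: submoduleI.
  exact: (submodule_comp h1_fun (semi_inner_submodule semi_inner_l2)).
exact: (submodule_comp h1_grad submodule_L2vec).
Qed.

Lemma semi_inner_graddot : semi_inner (L2pair Om) graddot.
Proof.
apply: semi_innerS (semi_inner_comp h1_grad semi_inner_L2vec); first exact: submodule_L2pair.
by move=> P [].
Qed.

Lemma semi_inner_fundot : semi_inner (L2pair Om) fundot.
Proof.
apply: semi_innerS (semi_inner_comp h1_fun semi_inner_l2); first exact: submodule_L2pair.
by move=> P [].
Qed.

Lemma semi_inner_h1dot : semi_inner (L2pair Om) (h1dot Om).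
Proof. exact: semi_innerD semi_inner_fundot semi_inner_graddot. Qed.

End sobolev_forms.

(** * Bounded sets have finite Lebesgue measure *)

Section cube.
Context (R : realType).

(** Closed balls of the sup norm: they are compact and fit the construction of the measure
    coordinate by coordinate. *)
Definition cube d (M : R) : set 'rV[R]_d := [set v | forall i, v 0 i \in `[- M, M]].

Lemma open_measurable_rV d (U : set 'rV[R]_d) : open U -> measurable U.
Proof. by move=> oU; exact: sub_sigma_algebra. Qed.

Lemma compact_cube d M : compact (@cube d M).
Proof.
by apply: (@rV_compact _  _ (fun=> `[- M, M]%classic)) => i; exact: segment_compact.
Qed.

Lemma measurable_cube d M : measurable (@cube d M).
Proof.
rewrite -[cube M]setCK; apply: measurableC; apply: open_measurable_rV.
rewrite openC; apply: compact_closed; last exact: compact_cube.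
exact: norm_hausdorff.
Qed.

Lemma bounded_sub_cube d (A : set 'rV[R]_d) : bounded_set A -> exists M, A `<=` cube M.
Proof.
move=> [M [Mreal AM]]; exists (M + 1) => v Av i.
have vM : `|v| <= M + 1 by apply: AM => //; rewrite ltrDl.
rewrite in_itv/= -ler_norml; apply: le_trans vM.
rewrite (_ : `|v| = mx_norm v)// mx_normrE.
by apply/bigmax_geP; right => /=; exists (ord0, i).
Qed.

Lemma row_of_head d (p : iter_space R d.+1) (j : 'I_1) :
  @row_of R d.+1 p 0 (lshift d j) = p.1.
Proof. by apply: etrans (row_mxEl _ _ _ _) _; rewrite (ord1 j) mxE eqxx mulr1n. Qed.

Lemma row_of_tail d (p : iter_space R d.+1) (j : 'I_d) :
  @row_of R d.+1 p 0 (rshift 1 j) = row_of p.2 0 j.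
Proof. exact: row_mxEr. Qed.

(** By induction on d: under [row_of], the cube in dimension d + 1 pulls back to an interval times
    the pullback of the cube in dimension d. In dimension 0 the measure is a Dirac mass. *)
Lemma lebesgue_cube_lty d M : (@lebesgue_rV R d (@cube d M) < +oo)%E.
Proof.
rewrite /lebesgue_rV /pushforward.
elim: d => [|d IH].
  set A := _ @^-1` _.
  by rewrite (_ : _ A = @dirac _ unit tt R A)// diracE ltry.
have -> : @row_of R d.+1 @^-1` @cube d.+1 M =
    (`[- M, M]%classic : set (measurableTypeR R)) `*` (@row_of R d @^-1` @cube d M).
  apply/seteqP; split => [p /= H|p [/= H0 H1] i].
    split => [|i]; first by have := H (lshift d (0 : 'I_1)); rewrite row_of_head.
    by have := H (rshift 1 i); rewrite row_of_tail.
  by case: (@split_ordP 1 d i) => j ->; rewrite ?row_of_head ?row_of_tail.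
set I : set (measurableTypeR R) := `[- M, M]%classic.
have mY : measurable (@row_of R d @^-1` @cube d M).
  rewrite -[X in measurable X]setTI; apply: measurable_row_of => //.
  exact: measurable_cube.
have -> : iter_lebesgue R d.+1 (I `*` (@row_of R d @^-1` @cube d M)) =
    (lebesgue_measure I * iter_lebesgue R d (@row_of R d @^-1` @cube d M))%E.
  by rewrite -product_measure1E//; exact: measurable_itv.
rewrite lte_mul_pinfty//.
by rewrite lebesgue_measure_itv/=; case: ifP => // _; rewrite -EFinD.
Qed.

End cube.

(** * Smooth functions, and linearity of H^1 and of the zero trace condition *)

Section smooth.
Context (R : realType) (d : nat).
Local Notation E := 'rV[R]_d.
Local Notation leb := (@lebesgue_rV R d).
Implicit Types (phi psi : E -> R^o).

Lemma Ck_comb k (a : R) phi psi : Ck k phi -> Ck k psi ->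
  Ck k (a *: phi + psi).
Proof.
elim: k phi psi => [|k IH] phi psi /= [cphi hphi] [cpsi hpsi]; split => //.
- by move=> x; apply: continuousD; [apply: continuousZl_tmp; exact: cphi|exact: cpsi].
- by move=> x; apply: continuousD; [apply: continuousZl_tmp; exact: cphi|exact: cpsi].
move=> i; have [dphi Cphi] := hphi i; have [dpsi Cpsi] := hpsi i; split.
  by move=> x; apply: derivableD => //; exact: derivableZ.
rewrite (_ : partial i _ = a *: (partial i phi : E -> R^o) + partial i psi); first exact: IH.
apply/funext => x; rewrite /partial deriveD//; last exact: derivableZ.
by rewrite deriveZ.
Qed.

Lemma smooth_comb (a : R) phi psi : smooth phi -> smooth psi -> smooth (a *: phi + psi).
Proof. by move=> hphi hpsi k; exact: Ck_comb. Qed.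

Lemma grad_comb (a : R) phi psi : smooth phi -> smooth psi ->
  grad (a *: phi + psi) = a *: grad phi + grad psi.
Proof.
move=> /(_ 1%N)[_ hphi] /(_ 1%N)[_ hpsi]; apply/funext => x; apply/rowP => i.
rewrite !mxE /partial deriveD; [|apply: derivableZ; exact: (hphi i).1|exact: (hpsi i).1].
by rewrite deriveZ//; exact: (hphi i).1.
Qed.

Lemma smooth_partial i phi : smooth phi -> smooth (partial i phi).
Proof. by move=> hphi k; have [_ /(_ i)[]] := hphi k.+1. Qed.

Lemma partial0 i : partial i (0 : E -> R^o) = 0.
Proof. by apply/funext => x; exact: derive_cst. Qed.

Lemma smooth0 : smooth (0 : E -> R^o).
Proof.
have c0 : continuous (0 : E -> R^o) by exact: (@cst_continuous E R^o 0).
move=> k; elim: k => [|k IH] /=; split => //.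
move=> i; split => [x|]; first exact: derivable_cst.
by rewrite partial0.
Qed.

Lemma continuous_measurable_rV (phi : E -> R) : continuous phi -> measurable_fun setT phi.
Proof.
move=> cphi; apply: (measurability _ (RGenOpens.measurableE R)).
move=> _ [_ [a [b ->] <-]]; rewrite setTI; apply: open_measurable_rV.
move/continuousP : cphi; apply; exact: interval_open.
Qed.

Variable (Om : set E).
Hypotheses (oOm : open Om) (bOm : bounded_set Om).

(** A continuous function is bounded on a compact cube containing [Om]. This puts test functions and
    smooth approximations in L^2, so that integrals against them are linear. *)
Lemma continuous_L2 (phi : E -> R) : continuous phi -> L2 Om phi.
Proof.
move=> cphi; have mphi := continuous_measurable_rV cphi.
have [M OmM] := bounded_sub_cube bOm.
have mOm := open_measurable_rV oOm.
have : compact (phi @` cube M).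
  by apply: continuous_compact; [exact: continuous_subspaceT|exact: compact_cube].
move=> /compact_bounded[K [_ HK]].
apply: (@bounded_sq_integrable _ _ _ leb Om mOm phi (K + 1)).
- apply: le_lt_trans (lebesgue_cube_lty d M).
  by apply: le_measure => //; rewrite inE//; exact: measurable_cube.
- exact: measurable_funTS.
- by move=> x Omx; apply: HK; [rewrite ltrDl|exists x => //; exact: OmM].
Qed.

Lemma smooth_continuous phi : smooth phi -> continuous phi.
Proof. by move=> /(_ 0%N)[]. Qed.

Lemma smooth_L2pair phi : smooth phi -> L2pair Om (phi, grad phi).
Proof.
move=> hphi; split => [|i] /=; first exact/continuous_L2/smooth_continuous.
rewrite (_ : (fun x => _) = partial i phi); last by apply/funext => x; rewrite mxE.
exact/continuous_L2/smooth_continuous/smooth_partial.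
Qed.

(** Two covers of total size below e / 2 each are interleaved, the first on the even indices and the
    second on the odd ones. The index sets are arbitrary subsets of the integers, hence the two
    images and the splitting of the sum by parity. *)
Lemma surface_nullU (N1 N2 : set E) :
  surface_null N1 -> surface_null N2 -> surface_null (N1 `|` N2).
Proof.
move=> h1 h2 e e0; have e20 : 0 < e / 2 by rewrite divr_gt0.
have [I1 [cc1 [r1 [r1_gt0 N1c s1]]]] := h1 _ e20.
have [I2 [cc2 [r2 [r2_gt0 N2c s2]]]] := h2 _ e20.
pose c k := if odd k then cc2 k./2 else cc1 k./2.
pose r k := if odd k then r2 k./2 else r1 k./2.
pose o n := n.*2.+1.
have cd n : c n.*2 = cc1 n by rewrite /c odd_double doubleK.
have rd n : r n.*2 = r1 n by rewrite /r odd_double doubleK.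
have co n : c (o n) = cc2 n by rewrite /c /= odd_double /= uphalf_double.
have ro n : r (o n) = r2 n by rewrite /r /= odd_double /= uphalf_double.
have r_gt0 k : 0 < r k by rewrite /r; case: ifP.
exists ((double @` I1) `|` (o @` I2)), c, r; split => //.
  move=> x [/N1c[k Ik bk]|/N2c[k Ik bk]].
    by exists k.*2; [left; exists k|rewrite cd rd].
  by exists (o k); [right; exists k|rewrite co ro].
have p0 k : (0 <= (r k ^+ d.-1)%:E)%E by rewrite lee_fin exprn_ge0// ltW.
rewrite (esumID [set k | ~~ odd k])//.
have -> : (double @` I1 `|` o @` I2) `&` [set k | ~~ odd k] = double @` I1.
  apply/seteqP; split => [k [[//|[n _ <-]]]|_ [n In <-]] /=; first by rewrite odd_double.
  by split; [left; exists n|rewrite odd_double].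
have -> : (double @` I1 `|` o @` I2) `&` ~` [set k | ~~ odd k] = o @` I2.
  apply/seteqP; split => [k [[[n _ <-]|//]]|_ [n In <-]] /=; first by rewrite odd_double.
  by split; [right; exists n|rewrite /= odd_double].
rewrite !esum_image; last 2 first.
- by move=> m n _ _ [] /double_inj.
- by move=> m n _ _ /double_inj.
rewrite [e]splitr EFinD; apply: lteD.
  by under eq_esum do rewrite rd.
by under eq_esum do rewrite ro.
Qed.

Lemma surface_nullS (N1 N2 : set E) : N1 `<=` N2 -> surface_null N2 -> surface_null N1.
Proof.
by move=> N12 h e /h[I [c [r [r0 N2c s]]]]; exists I, c, r; split => //; exact: subset_trans N2c.
Qed.

Lemma surface_null0 : surface_null (set0 : set E).
Proof.
move=> e e0; exists set0, (fun=> 0), (fun=> 1); split => //.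
by rewrite esum_set0 lte_fin.
Qed.

Let mOm := open_measurable_rV oOm.
Let sh1 := semi_inner_h1dot mOm.
Let nh1 P : h1norm Om P = seminorm_of (h1dot Om) P. Proof. by []. Qed.

(** Linearity of the weak gradient reduces to linearity of integrals against a test function and its
    partial derivatives, which all lie in L^2. *)
Lemma submodule_H1 : submodule (H1 Om).
Proof.
have sL := submodule_L2pair mOm.
have hl := semi_inner_bil (semi_inner_l2 mOm).
have hsub := semi_inner_submodule (semi_inner_l2 mOm).
split.
  split; first exact: submodule0 sL.
  move=> phi [sphi _] i.
  have L1 : L2 Om (partial i phi) by exact/continuous_L2/smooth_continuous/smooth_partial.
  have L2' : L2 Om phi by exact/continuous_L2/smooth_continuous.
  have := bil0l hsub hl L1; have := bil0l hsub hl L2'; rewrite /l2dot => e1 e2.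
  rewrite [LHS]e2; apply/esym/eqP; rewrite oppr_eq0; apply/eqP; rewrite -[RHS]e1.
  by apply: eq_Rintegral => x _; rewrite mxE.
move=> a P Q [LP wP] [LQ wQ]; split; first exact: submoduleP.
move=> phi tphi i; have [sphi _] := tphi.
have L1 : L2 Om (partial i phi) by exact/continuous_L2/smooth_continuous/smooth_partial.
have L2' : L2 Om phi by exact/continuous_L2/smooth_continuous.
have := bilPl hl a LP.1 LQ.1 L1; rewrite /l2dot => ->.
have := bilPl hl a (LP.2 i) (LQ.2 i) L2'; rewrite /l2dot => e1.
rewrite wP// wQ// mulrN -opprD -e1; congr (- _).
by apply: eq_Rintegral => x _; rewrite !mxE.
Qed.

(** The same combination of the smooth approximations works: it converges in H^1, and its values on
    [G0] tend to 0 off the union of the two null sets. *)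
Lemma submodule_H1_0 G0 : submodule (H1_0 Om G0).
Proof.
have sH := submodule_H1; have sL := submodule_L2pair mOm.
split.
  split; first exact: submodule0 sH.
  exists (fun _ => 0); split => [n||]; first exact: smooth0.
    rewrite (_ : (fun _ => _) = fun _ => 0); first exact: cvg_cst.
    apply/funext => n; rewrite nh1 (_ : _ - _ = 0) ?(seminorm0 sh1)//.
    rewrite subr0; congr pair; apply/funext => x; apply/rowP => i.
    by rewrite !mxE partial0.
  apply: surface_nullS surface_null0 => x [_ /=]; apply; exact: cvg_cst.
move=> a P Q [HP [f [sf fP nf]]] [HQ [g [sg gQ ng]]]; split; first exact: submoduleP.
exists (fun n => a *: (f n : E -> R^o) + g n); split => [n||].
- exact: smooth_comb.
- apply: (@squeeze_cvgr _ _ _ _ (cst 0)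
    (fun n => `|a| * h1norm Om ((f n, grad (f n)) - P) + h1norm Om ((g n, grad (g n)) - Q))).
  + near=> n; rewrite sqrtr_ge0/= !nh1.
    have -> : ((a *: (f n : E -> R^o) + g n, grad (a *: (f n : E -> R^o) + g n)) : h1 R d) - (a *: P + Q) =
       a *: (((f n, grad (f n)) : h1 R d) - P) + (((g n, grad (g n)) : h1 R d) - Q).
      rewrite grad_comb// scalerBr opprD addrACA; congr (_ + _).
    have S1 := submoduleB sL (smooth_L2pair (sf n)) HP.1.
    have S2 := submoduleB sL (smooth_L2pair (sg n)) HQ.1.
    by rewrite -(seminormZ sh1)// (seminormD sh1)//; exact: submoduleZ.
  + exact: cvg_cst.
  + have -> : 0 = `|a| * 0 + 0 :> R by ring.
    by apply: cvgD => //; apply: cvgM => //; exact: cvg_cst.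
- apply: surface_nullS (surface_nullU nf ng) => x [G0x nx].
  apply: contrapT => /not_orP[nf' ng']; apply: nx.
  have fx : f n x @[n --> \oo] --> (0 : R).
    by apply: contrapT => H; apply: nf'; split.
  have gx : g n x @[n --> \oo] --> (0 : R).
    by apply: contrapT => H; apply: ng'; split.
  have -> : 0 = a * 0 + 0 :> R by ring.
  by apply: cvgD => //; apply: cvgM => //; exact: cvg_cst.
Unshelve. all: end_near. Qed.

End smooth.

(** * The Lyapunov functional on the state space *)

(* Stated for abstract modules: on the function modules of the state space the
   conversion test unfolds the pointwise operations and takes minutes. *)
Section quadruples.
Context (R : realType) (X Y Z W : lmodType R) (a : R) (u v : (X * Y * Z * W)%type).
Lemma proj1_comb : (a *: u + v).1.1.1 = a *: u.1.1.1 + v.1.1.1. Proof. by []. Qed.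
Lemma proj2_comb : (a *: u + v).1.1.2 = a *: u.1.1.2 + v.1.1.2. Proof. by []. Qed.
Lemma proj3_comb : (a *: u + v).1.2 = a *: u.1.2 + v.1.2. Proof. by []. Qed.
Lemma proj4_comb : (a *: u + v).2 = a *: u.2 + v.2. Proof. by []. Qed.
End quadruples.

Section state_forms.
Context (R : realType) (d : nat) (Om G0 : set 'rV[R]_d).
Hypothesis mOm : measurable Om.
Local Notation E := 'rV[R]_d.
Local Notation mu := (@lebesgue_measure R).
Local Notation state := (state R d).
Local Notation h1 := (h1 R d).
Let sh := semi_inner_h1dot mOm.
Let sg := semi_inner_graddot mOm.
Let s2 := semi_inner_l2 mOm.

(** The projections [v1] to [v4] under names that carry linear structures, so that forms can be
    pulled back along them. *)
Definition st1 (V : state) : h1 := v1 V.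
Definition st2 (V : state) : E -> R^o := v2 V.
Definition st3 (V : state) : R -> h1 := v3 V.
Definition st4 (V : state) : R -> h1 := v4 V.
Lemma st1_is_linear : linear st1.
Proof. by move=> a u v; exact: (@proj1_comb R h1 (E -> R^o) (R -> h1) (R -> h1)). Qed.
Lemma st2_is_linear : linear st2.
Proof. by move=> a u v; exact: (@proj2_comb R h1 (E -> R^o) (R -> h1) (R -> h1)). Qed.
Lemma st3_is_linear : linear st3.
Proof. by move=> a u v; exact: (@proj3_comb R h1 (E -> R^o) (R -> h1) (R -> h1)). Qed.
Lemma st4_is_linear : linear st4.
Proof. by move=> a u v; exact: (@proj4_comb R h1 (E -> R^o) (R -> h1) (R -> h1)). Qed.
HB.instance Definition _ := GRing.isLinear.Build R state h1 _ st1 st1_is_linear.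
HB.instance Definition _ := GRing.isLinear.Build R state (E -> R^o) _ st2 st2_is_linear.
HB.instance Definition _ := GRing.isLinear.Build R state (R -> h1) _ st3 st3_is_linear.
HB.instance Definition _ := GRing.isLinear.Build R state (R -> h1) _ st4 st4_is_linear.

Definition boch_h1 (v : R -> h1) := bochner_L2 (L2pair Om) (h1dot Om) v.

Lemma h1norm_sq P : h1norm Om P ^+ 2 = h1dot Om P P.
Proof.
rewrite sqr_sqrtr//; apply: addr_ge0; apply: Rintegral_ge0 => x _.
  by rewrite -expr2 sqr_ge0.
by apply: sumr_ge0 => i _; rewrite -expr2 sqr_ge0.
Qed.

Lemma L2H1_bochner v : L2H1 Om G0 v -> boch_h1 v.
Proof.
move=> [H [S [sS Sv]] fin]; split.
- by move=> s /H[[]].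
- exists S; split => // k; have [m [A [w [mA Hw ->]]]] := sS k.
  (* The finite sum is rebuilt along its index sequence as a chain of [simple_map_comb]. *)
  have big (r : seq 'I_m) : simple_map (L2pair Om) (fun s => \sum_(k <- r) (\1_(A k) s : R) *: w k).
    elim: r => [|i r IH].
      by under eq_fun do rewrite big_nil; exact: simple_map0.
    under eq_fun do rewrite big_cons -[_ *: w i]scale1r.
    apply: simple_map_comb => //; apply: simple_map_indic => //.
    by have [[]] := Hw i.
  exact: big.
- by under eq_integral do rewrite -h1norm_sq.
Qed.

Lemma graddot_le_h1dot P : graddot Om P P <= h1dot Om P P.
Proof.
rewrite /h1dot lerDr; apply: Rintegral_ge0 => x _.
by rewrite -expr2 sqr_ge0.
Qed.

(** The gradient seminorm is at most the H^1 norm, so the same simple maps approximate [v] and the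
    same integral dominates. *)
Lemma bochner_h1_grad v : boch_h1 v -> bochner_L2 (L2pair Om) (graddot Om) v.
Proof.
move=> hv; have [Sv [F [sF Fv]] fin] := hv.
have Fv' (s : R) : s \in `]0, 1[ -> seminorm_of (graddot Om) (F k s - v s) @[k --> \oo] --> (0 : R).
  move=> sI.
  apply: (@squeeze_cvgr _ _ _ _ (cst 0) (fun k => seminorm_of (h1dot Om) (F k s - v s))).
  - by near=> k; rewrite seminorm_ge0/= ler_wsqrtr// graddot_le_h1dot.
  - exact: cvg_cst.
  - exact: Fv.
split => //; first by exists F.
apply: le_lt_trans fin; apply: ge0_le_integral => //.
- by move=> s sI; rewrite lee_fin (semi_inner_ge0 sg)//; exact: Sv.
- apply/measurable_EFinP; apply: (measurable_bil sg); split => //; exists F; split => // s sI; exact: Fv'.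
- by apply/measurable_EFinP; apply: (measurable_bil sh); exact: bochner_strongly_measurable.
- by move=> s sI; rewrite lee_fin graddot_le_h1dot.
Unshelve. all: end_near. Qed.


Definition weighted_int (rho : R -> R) (C : h1 -> h1 -> R) (v w : R -> h1) : R :=
  \int[mu]_(s in `]0, 1[) (rho s * C (v s) (w s)).

(* The membership in H^1_{G0} is dropped here; it is only needed for the
   Poincare inequality. *)
Definition weak_state (V : state) :=
  [/\ L2pair Om (st1 V), L2 Om (st2 V), boch_h1 (st3 V) & boch_h1 (st4 V)].

Definition state_dot (U V : state) : R :=
  h1dot Om (st1 U) (st1 V) + l2dot Om (st2 U) (st2 V) +
  weighted_int (cst 1) (h1dot Om) (st3 U) (st3 V) +
  weighted_int (cst 1) (h1dot Om) (st4 U) (st4 V).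

Lemma in_state_space_weak V : in_state_space Om G0 V -> weak_state V.
Proof.
move=> [h1 h2 h3 h4].
split; [exact: h1.1.1|exact: h2|exact: L2H1_bochner h3|exact: L2H1_bochner h4].
Qed.

Lemma submodule_weak_state : submodule weak_state.
Proof.
have [s10 s1P] := semi_inner_submodule sh; have [s20 s2P] := semi_inner_submodule s2.
have [s30 s3P] := submodule_bochner sh.
split => [|a U V [U1 U2 U3 U4] [V1 V2 V3 V4]].
  split; [exact: s10|exact: s20|exact: s30|exact: s30].
have e1 := linearP st1 a U V; have e2 := linearP st2 a U V.
have e3 := linearP st3 a U V; have e4 := linearP st4 a U V.
split; [rewrite e1|rewrite e2|rewrite e3|rewrite e4].
- exact: (s1P _ _ _ U1 V1).
- exact: (s2P _ _ _ U2 V2).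
- exact: (s3P _ _ _ U3 V3).
- exact: (s3P _ _ _ U4 V4).
Qed.

Lemma semi_inner_weak (X : lmodType R) (f : {linear state -> X}) (S : X -> Prop) B :
  (forall U, weak_state U -> S (f U)) -> semi_inner S B ->
  semi_inner weak_state (fun U V => B (f U) (f V)).
Proof.
move=> wS hB; apply: (semi_innerS submodule_weak_state) (semi_inner_comp f hB).
exact: wS.
Qed.

Lemma semi_inner_weighted_h1 : semi_inner boch_h1 (weighted_int (cst 1) (h1dot Om)).
Proof.
apply: (semi_inner_bochner sh (M := 1)); first exact: measurable_cst.
by move=> s _ /=; rewrite ler01 lexx.
Qed.

Lemma weak_state1 U : weak_state U -> L2pair Om (st1 U). Proof. by case. Qed.
Lemma weak_state2 U : weak_state U -> L2 Om (st2 U). Proof. by case. Qed.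
Lemma weak_state3 U : weak_state U -> boch_h1 (st3 U). Proof. by case. Qed.
Lemma weak_state4 U : weak_state U -> boch_h1 (st4 U). Proof. by case. Qed.

Lemma semi_inner_state : semi_inner weak_state state_dot.
Proof.
apply: semi_innerD; [apply: semi_innerD; [apply: semi_innerD|]|].
- exact: (semi_inner_weak weak_state1 sh).
- exact: (semi_inner_weak weak_state2 s2).
- exact: (semi_inner_weak weak_state3 semi_inner_weighted_h1).
- exact: (semi_inner_weak weak_state4 semi_inner_weighted_h1).
Qed.

Lemma state_normE V : state_norm Om V = seminorm_of state_dot V.
Proof.
rewrite /state_norm /seminorm_of /state_dot h1norm_sq; congr (Num.sqrt (_ + _ + _ + _)).
- rewrite sqr_sqrtr; first by apply: eq_Rintegral => x _; rewrite expr2.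
  by apply: Rintegral_ge0 => x _; rewrite sqr_ge0.
- by apply: eq_Rintegral => s _; rewrite h1norm_sq mul1r.
- by apply: eq_Rintegral => s _; rewrite h1norm_sq mul1r.
Qed.

(** It falls from 3/2 at s = 0 to 1 at s = 1. These values become the coefficients of the boundary
    terms in the integration by parts, and the rate of decrease 1/2 that of the interior term. *)
Definition weight (s : R) : R := 1 + 2^-1 * (1 - s).

Lemma measurable_weight : measurable_fun (setT : set (measurableTypeR R)) weight.
Proof.
apply: measurable_funD; first exact: measurable_cst.
apply: measurable_funM; first exact: measurable_cst.
by apply: measurable_funB; [exact: measurable_cst|exact: measurable_id].
Qed.

Lemma weight_bound s : s \in `]0, 1[ -> 0 <= weight s <= 3 / 2.
Proof. by rewrite in_itv/= /weight => /andP[s0 s1]; apply/andP; split; lra. Qed.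

Lemma semi_inner_weighted_grad : semi_inner boch_h1 (weighted_int weight (graddot Om)).
Proof.
apply: semi_innerS (semi_inner_bochner sg measurable_weight weight_bound).
  exact: submodule_bochner.
exact: bochner_h1_grad.
Qed.

Lemma weighted_grad_le v : boch_h1 v ->
  weighted_int weight (graddot Om) v v <= 3 / 2 * weighted_int (cst 1) (h1dot Om) v v.
Proof.
move=> hv; have hg := bochner_h1_grad hv.
have i1 : mu.-integrable `]0, 1[ (EFin \o (fun s => cst 1 s * h1dot Om (v s) (v s))).
  apply: (integrable_bochner sh hv hv (M := 1)); first exact: measurable_cst.
  by move=> s _; rewrite normr1.
have i2 : mu.-integrable `]0, 1[ (EFin \o (fun s => weight s * graddot Om (v s) (v s))).
  apply: (integrable_bochner sg hg hg measurable_weight (M := 3 / 2)).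
  by move=> s /weight_bound/andP[w0 ?]; rewrite ger0_norm.
rewrite /weighted_int -RintegralZl//; apply: le_Rintegral => //; first exact: integrableZl i1.
move=> s /= sI; have /andP[w0 w1] := weight_bound sI; rewrite mul1r.
have Sv := bochner_L2_in hv sI.
by rewrite ler_pM ?graddot_le_h1dot// (semi_inner_ge0 sg).
Qed.

Lemma weighted_grad_ge v : boch_h1 v ->
  weighted_int (cst 1) (graddot Om) v v <= weighted_int weight (graddot Om) v v <=
  3 / 2 * weighted_int (cst 1) (graddot Om) v v.
Proof.
move=> hv; have hg := bochner_h1_grad hv.
have i1 : mu.-integrable `]0, 1[ (EFin \o (fun s => cst 1 s * graddot Om (v s) (v s))).
  apply: (integrable_bochner sg hg hg (M := 1)); first exact: measurable_cst.
  by move=> s _; rewrite normr1.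
have i2 : mu.-integrable `]0, 1[ (EFin \o (fun s => weight s * graddot Om (v s) (v s))).
  apply: (integrable_bochner sg hg hg measurable_weight (M := 3 / 2)).
  by move=> s /weight_bound/andP[w0 ?]; rewrite ger0_norm.
rewrite /weighted_int; apply/andP; split.
  apply: le_Rintegral => // s /= sI.
  have Sv := bochner_L2_in hv sI; rewrite ler_wpM2r ?(semi_inner_ge0 sg)//.
  by move: sI; rewrite in_itv/= /weight => /andP[s0 s1]; lra.
rewrite -RintegralZl//; apply: le_Rintegral => //; first exact: integrableZl i1.
move=> s /= sI; have /andP[w0 w1] := weight_bound sI; rewrite mul1r.
by rewrite ler_wpM2r ?(semi_inner_ge0 sg)//; exact: bochner_L2_in hv sI.
Qed.

Variables (A N a b : R).

Definition cross_dot (U V : state) : R :=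
  l2dot Om (st2 U) (h1_fun (st1 V)) + l2dot Om (h1_fun (st1 U)) (st2 V).

(** The polarized Lyapunov functional. The product N <y', y> is symmetrized by [cross_dot], hence
    the factor N / 2. Later A is (c1 + N d1) / 2, and [a], [b] receive the factor tau. *)
Definition lyap (U V : state) : R :=
  2^-1 * l2dot Om (st2 U) (st2 V) + A * graddot Om (st1 U) (st1 V) +
  N / 2 * cross_dot U V +
  a * weighted_int weight (graddot Om) (st3 U) (st3 V) +
  b * weighted_int weight (graddot Om) (st4 U) (st4 V).

Lemma sym_bilinear_cross : sym_bilinear weak_state cross_dot.
Proof.
have hb := semi_inner_bil s2; rewrite /cross_dot.
split => [U V [U1 U2 _ _] [V1 V2 _ _]|k U V Q [U1 U2 _ _] [V1 V2 _ _] [Q1 Q2 _ _]].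
  by rewrite addrC (bilC hb U1.1 V2) (bilC hb U2 V1.1).
rewrite !linearP (bilPl hb k U2 V2 Q1.1) (bilPl hb k U1.1 V1.1 Q2); ring.
Qed.

Let le_sum4 (x y z w : R) : 0 <= x -> 0 <= y -> 0 <= z -> 0 <= w ->
  [/\ x <= x + y + z + w, y <= x + y + z + w, z <= x + y + z + w & w <= x + y + z + w].
Proof. by move=> *; split; lra. Qed.

Let state_dot_ge Q : weak_state Q ->
  [/\ h1dot Om (st1 Q) (st1 Q) <= state_dot Q Q, l2dot Om (st2 Q) (st2 Q) <= state_dot Q Q,
     weighted_int (cst 1) (h1dot Om) (st3 Q) (st3 Q) <= state_dot Q Q &
     weighted_int (cst 1) (h1dot Om) (st4 Q) (st4 Q) <= state_dot Q Q].
Proof.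
move=> WQ; apply: le_sum4.
- exact: (semi_inner_ge0 sh (weak_state1 WQ)).
- exact: (semi_inner_ge0 s2 (weak_state2 WQ)).
- exact: (semi_inner_ge0 semi_inner_weighted_h1 (weak_state3 WQ)).
- exact: (semi_inner_ge0 semi_inner_weighted_h1 (weak_state4 WQ)).
Qed.

Lemma cross_dot_bound U V : weak_state U -> weak_state V ->
  `|cross_dot U V| <= 2 * (seminorm_of state_dot U * seminorm_of state_dot V).
Proof.
move=> WU WV.
have le2 Q : weak_state Q -> seminorm_of (l2dot Om) (st2 Q) <= seminorm_of state_dot Q.
  by move=> WQ; apply: ler_wsqrtr; have [] := state_dot_ge WQ.
have le1 Q : weak_state Q -> seminorm_of (l2dot Om) (h1_fun (st1 Q)) <= seminorm_of state_dot Q.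
  move=> WQ; apply: ler_wsqrtr; have [le _ _ _] := state_dot_ge WQ; apply: le_trans le.
  by rewrite lerDl; exact: (semi_inner_ge0 sg (weak_state1 WQ)).
have U1 := (weak_state1 WU).1; have V1 := (weak_state1 WV).1.
have U2 := weak_state2 WU; have V2 := weak_state2 WV.
apply: (le_trans (ler_normD _ _)); rewrite mulr_natl mulr2n; apply: lerD.
  apply: (le_trans (cauchy_schwarz s2 U2 V1)).
  by apply: ler_pM; [exact: seminorm_ge0|exact: seminorm_ge0|exact: le2|exact: le1].
apply: (le_trans (cauchy_schwarz s2 U1 V2)).
by apply: ler_pM; [exact: seminorm_ge0|exact: seminorm_ge0|exact: le1|exact: le2].
Qed.

Let sw1 := semi_inner_weak weak_state1 sg.
Let sw2 := semi_inner_weak weak_state2 s2.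
Let sw3 := semi_inner_weak weak_state3 semi_inner_weighted_grad.
Let sw4 := semi_inner_weak weak_state4 semi_inner_weighted_grad.

Lemma sym_bilinear_lyap : sym_bilinear weak_state lyap.
Proof.
apply: sym_bilinearD; [apply: sym_bilinearD; [apply: sym_bilinearD; [apply: sym_bilinearD|]|]|].
- exact: (sym_bilinearZ _ (semi_inner_bil sw2)).
- exact: (sym_bilinearZ _ (semi_inner_bil sw1)).
- exact: (sym_bilinearZ _ sym_bilinear_cross).
- exact: (sym_bilinearZ _ (semi_inner_bil sw3)).
- exact: (sym_bilinearZ _ (semi_inner_bil sw4)).
Qed.

(** Continuity of [lyap] in the state norm: it allows exchanging states at distance 0,
    differentiating along trajectories and letting h tend to 0. *)
Lemma lyap_bound U V : weak_state U -> weak_state V ->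
  `|lyap U V| <= (2^-1 + `|A| + `|N| + 3 / 2 * `|a| + 3 / 2 * `|b|) *
     (seminorm_of state_dot U * seminorm_of state_dot V).
Proof.
move=> WU WV.
have h32 : 0 <= 3 / 2 :> R by rewrite divr_ge0.
have b1 := @semi_inner_bound _ _ _ _ _ 1 U V sw1 semi_inner_state ler01 _ WU WV.
have b2 := @semi_inner_bound _ _ _ _ _ 1 U V sw2 semi_inner_state ler01 _ WU WV.
have b3 := @semi_inner_bound _ _ _ _ _ (3 / 2) U V sw3 semi_inner_state h32 _ WU WV.
have b4 := @semi_inner_bound _ _ _ _ _ (3 / 2) U V sw4 semi_inner_state h32 _ WU WV.
have {}b1 : `|graddot Om (st1 U) (st1 V)| <= 1 * (seminorm_of state_dot U * seminorm_of state_dot V).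
  apply: b1 => Q WQ; rewrite mul1r; have [le _ _ _] := state_dot_ge WQ; apply: le_trans le.
  exact: graddot_le_h1dot.
have {}b2 : `|l2dot Om (st2 U) (st2 V)| <= 1 * (seminorm_of state_dot U * seminorm_of state_dot V).
  by apply: b2 => Q WQ; rewrite mul1r; have [] := state_dot_ge WQ.
have {}b3 : `|weighted_int weight (graddot Om) (st3 U) (st3 V)| <= 3 / 2 * (seminorm_of state_dot U * seminorm_of state_dot V).
  apply: b3 => Q WQ; apply: (le_trans (weighted_grad_le (weak_state3 WQ))).
  have [_ _ le _] := state_dot_ge WQ; exact: ler_wpM2l h32 _ _ le.
have {}b4 : `|weighted_int weight (graddot Om) (st4 U) (st4 V)| <= 3 / 2 * (seminorm_of state_dot U * seminorm_of state_dot V).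
  apply: b4 => Q WQ; apply: (le_trans (weighted_grad_le (weak_state4 WQ))).
  have [_ _ _ le] := state_dot_ge WQ; exact: ler_wpM2l h32 _ _ le.
move: b1 b2 b3 b4 (cross_dot_bound WU WV); rewrite /lyap.
move: (seminorm_of state_dot U * seminorm_of state_dot V) (graddot _ _ _) (l2dot _ _ _) (weighted_int _ _ _ _) (weighted_int _ _ _ _) (cross_dot _ _).
move=> p x1 x2 x4 x3 xc b1 b2 b3 b4 bc.
rewrite mul1r in b1; rewrite mul1r in b2.
have tri (k x K : R) : `|x| <= K * p -> `|k * x| <= K * `|k| * p.
  move=> xK; rewrite normrM [leRHS](_ : _ = `|k| * (K * p)); last by ring.
  exact: ler_wpM2l.
have t1 := tri A x1 1; have t2 := tri 2^-1 x2 1; have t3 := tri a x3 (3 / 2).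
have t4 := tri b x4 (3 / 2); have tc := tri (N / 2) xc 2.
rewrite !mul1r in t1 t2; have {}t1 := t1 b1; have {}t2 := t2 b2.
have {}t3 := t3 b3; have {}t4 := t4 b4; have {}tc := tc bc.
have n2 : `|2^-1 : R| = 2^-1 by rewrite ger0_norm ?invr_ge0.
have nN : `|N / 2| = `|N| / 2 by rewrite normrM n2.
rewrite n2 in t2; rewrite nN in tc.
have -> : (2^-1 + `|A| + `|N| + 3 / 2 * `|a| + 3 / 2 * `|b|) * p =
  2^-1 * p + `|A| * p + 2 * (`|N| / 2) * p + 3 / 2 * `|a| * p + 3 / 2 * `|b| * p by field.
do 4 (apply: (le_trans (ler_normD _ _)); apply: lerD => //).
Qed.

End state_forms.

(** * Differentiating a quadratic form along a trajectory *)

Section evolution.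
Context (R : realType) (X : lmodType R) (S : X -> Prop) (G B : X -> X -> R) (M : R).
Local Notation n := (seminorm_of G).
Hypotheses (hG : semi_inner S G) (hB : sym_bilinear S B).
Hypothesis BM : forall x y, S x -> S y -> `|B x y| <= M * (n x * n y).
Hypothesis M0 : 0 <= M.
Let hS := semi_inner_submodule hG.

Lemma cvg_bil_sq (I : Type) (F : set_system I) {FF : Filter F} (f : I -> X) x :
  (\forall i \near F, S (f i)) -> S x -> n (f i - x) @[i --> F] --> (0 : R) ->
  B (f i) (f i) @[i --> F] --> B x x.
Proof.
move=> Sf Sx fx; apply/subr_cvg0/norm_cvg0P.
apply: (@squeeze_cvgr _ _ _ _ (cst 0)
   (fun i => M * (2 * (n (f i - x) * n x) + n (f i - x) * n (f i - x)))).
- near=> i; rewrite normr_ge0/=.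
  have Si : S (f i) by near: i.
  have Sd := submoduleB hS Si Sx.
  have -> : B (f i) (f i) - B x x = 2 * B (f i - x) x + B (f i - x) (f i - x).
    have := bil_sqD hS hB Sd Sx; rewrite subrK => ->; ring.
  rewrite (le_trans (ler_normD _ _))// mulrDr lerD//; last exact: BM.
  by rewrite normrM ger0_norm// mulrCA ler_pM2l// BM.
- exact: cvg_cst.
- have -> : 0 = M * (2 * (0 * n x) + 0 * 0) :> R by ring.
  apply: cvgM; first exact: cvg_cst.
  apply: cvgD; last exact: cvgM.
  by apply: cvgM; [exact: cvg_cst|apply: cvgM => //; exact: cvg_cst].
Unshelve. all: end_near. Qed.

Context (U F : R -> X) (al : R).
Hypothesis SU : forall t : R, 0 <= t -> S (U t).
Hypothesis SF : forall t : R, 0 <= t -> S (F t).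
Hypothesis dU : forall t : R, 0 <= t ->
  n (k^-1 *: (U (t + k) - U t) - F t)
    @[k --> within [set k | k != 0 /\ 0 <= t + k] (nbhs 0)] --> (0 : R).
Hypothesis dissip : forall t : R, 0 <= t ->
  B (U t) (F t) <= - al * B (U t) (U t).

Let f t := B (U t) (U t).
(** Near 0 these are all nonzero increments when t > 0, and the positive ones when t = 0. *)
Let W t := [set k : R | k != 0 /\ 0 <= t + k].

(** With e(k) the error of the difference quotient, U(t + k) = U(t) + k (F(t) + e(k)). Expanding the
    square leaves the error 2 B(U, e) + k B(F + e, F + e), which tends to 0. *)
Let quotient t : 0 <= t ->
  k^-1 * (f (t + k) - f t) @[k --> within (W t) (nbhs 0)] --> 2 * B (U t) (F t).
Proof.
move=> t0; pose e k := k^-1 *: (U (t + k) - U t) - F t.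
have St := SU t0; have Ft := SF t0.
apply/subr_cvg0/norm_cvg0P.
apply: (@squeeze_cvgr _ _ _ _ (cst 0)
   (fun k => M * (2 * (n (U t) * n (e k))) + `|k| * (M * ((n (F t) + n (e k)) * (n (F t) + n (e k)))))).
- rewrite near_withinE; near=> k => -[k0 tk]; rewrite normr_ge0/=.
  have Sk := SU tk.
  have SD : S (k^-1 *: (U (t + k) - U t)) by apply: submoduleZ => //; exact: submoduleB.
  have Se : S (e k) by exact: submoduleB.
  have E : U (t + k) = U t + k *: (F t + e k).
    by rewrite /e [F t + _]addrC -addrA addNr addr0 scalerA mulfV// scale1r [U t + _]addrC -addrA addNr addr0.
  have SFe := submoduleD hS Ft Se.
  have SkFe := submoduleZ hS k SFe.
  have -> : k^-1 * (f (t + k) - f t) - 2 * B (U t) (F t) =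
      2 * B (U t) (e k) + k * B (F t + e k) (F t + e k).
    rewrite /f E (bil_sqD hS hB)// (bilZr hS hB)// (bilZl hS hB)// (bilZr hS hB)//.
    by rewrite (bilDr hS hB Ft Se St); field.
  rewrite (le_trans (ler_normD _ _))// lerD//.
    by rewrite normrM ger0_norm// mulrCA ler_pM2l// BM.
  rewrite normrM ler_wpM2l// (le_trans (BM SFe SFe))//.
  have nFe := seminormD hG Ft Se.
  by rewrite ler_wpM2l// ler_pM// seminorm_ge0.
- exact: cvg_cst.
- rewrite [X in _ --> X](_ : _ = M * (2 * (n (U t) * 0)) + 0 * (M * ((n (F t) + 0) * (n (F t) + 0))) :> R); last by ring.
  have ce : n (e k) @[k --> within (W t) (nbhs 0)] --> (0 : R) by exact: dU.
  have cF : n (F t) + n (e k) @[k --> within (W t) (nbhs 0)] --> (n (F t) + 0 : R).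
    by apply: cvgD => //; exact: cvg_cst.
  apply: cvgD.
    by apply: cvgM; [exact: cvg_cst|apply: cvgM; [exact: cvg_cst|apply: cvgM; [exact: cvg_cst|exact: ce]]].
  apply: cvgM; last by apply: cvgM; [exact: cvg_cst|exact: cvgM].
  rewrite -[X in _ --> X](@normr0 _ R); apply: cvg_norm; apply: cvg_within_filter.
  exact: cvg_id.
Unshelve. all: end_near. Qed.

Let f_derive (t : R) : 0 < t -> is_derive t 1 f (2 * B (U t) (F t)).
Proof.
move=> t0.
have c : h^-1 *: (f (h *: 1 + t) - f t) @[h --> (0 : R)^'] --> (2 * B (U t) (F t) : R^o).
  move=> A /(quotient (ltW t0)); rewrite /within /= /dnbhs /within/=.
  have : nbhs (0 : R) [set k | 0 <= t + k].
    apply/nbhs_ballP; exists t => // k; rewrite /ball/= sub0r normrN ltr_norml.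
    by move=> /andP[tk _]; lra.
  apply: filterS2 => k /= tk H k0.
  by rewrite (_ : k%:A = k :> R) ?(addrC k t); [exact: H|exact: mulr1].
apply: DeriveDef; first by apply/cvg_ex; eexists; exact: c.
exact: cvg_lim c.
Qed.

(** At 0 the quotient is one-sided; multiplied by k it gives the right continuity that the
    monotonicity argument on [0, t] needs at its left end. *)
Let f_right0 : f t @[t --> 0^'+] --> f 0.
Proof.
have c : k * (k^-1 * (f (0 + k) - f 0)) @[k --> within (W 0) (nbhs 0)] --> (0 : R).
  rewrite -[X in _ --> X](mul0r (2 * B (U 0) (F 0))); apply: cvgM; last exact: quotient.
  by apply: cvg_within_filter; exact: (@cvg_id _ (nbhs (0 : R))).
apply/subr_cvg0.
move=> A /c {c}; rewrite /within/= /at_right /within/=; apply: (@filterS _ (nbhs (0 : R)) _) => k H k0.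
have k1 : k != 0 by rewrite gt_eqF.
have kk : k * (k^-1 * (f (0 + k) - f 0)) = f k - f 0.
  by rewrite mulrA mulfV// mul1r add0r.
by rewrite /= -kk; apply: H; split => //; rewrite add0r ltW.
Qed.

(** exp(2 al s) B(U(s), U(s)) is nonincreasing, since its derivative is a positive multiple of al
    B(U, U) + B(U, F). *)
Lemma evolution_decay t : 0 <= t -> B (U t) (U t) <= expR (- 2 * al * t) * B (U 0) (U 0).
Proof.
rewrite le_eqVlt => /predU1P[<-|t0]; first by rewrite mulr0 expR0 mul1r.
pose g s := expR (2 * al * s) * f s.
have ed (s : R) : is_derive s 1 (fun s => expR (2 * al * s)) (2 * al * expR (2 * al * s)).
  have hl : is_derive s 1 (fun s => 2 * al * s : R) (2 * al).
    exact: (is_derive_eq (is_deriveZ (2 * al) (is_derive_id (s : R^o) 1)) (mulr1 _)).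
  exact: (is_derive_eq (is_derive1_comp (is_derive_expR (2 * al * s)) hl) (mulrC _ _)).
have g_derive (s : R) : 0 < s -> is_derive s 1 g (expR (2 * al * s) * (2 * al * f s + 2 * B (U s) (F s))).
  move=> s0; have fd := f_derive s0.
  apply: (is_derive_eq (is_deriveM (ed s) fd)).
  by rewrite /GRing.scale/=; ring.
have gt : g t <= g 0.
  apply: (@ler0_derive1_le_cc _ g 0 t).
  - by move=> s; rewrite in_itv/= => /andP[s0 _]; have := g_derive _ s0 => -[].
  - move=> s; rewrite in_itv/= => /andP[s0 _]; have := g_derive _ s0 => gd.
    rewrite derive1E derive_val pmulr_rle0 ?expR_gt0//.
    by have := dissip (ltW s0); rewrite /f; lra.
  - apply/continuous_within_itvP => //; split.
    + move=> s; rewrite in_itv/= => /andP[s0 _].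
      by apply: differentiable_continuous; apply/derivable1_diffP; have := g_derive _ s0 => -[].
    + apply: cvgM; last exact: f_right0.
      apply: cvg_at_right_filter.
      have ce : {for 0, continuous (fun s : R => expR (2 * al * s))}.
        by apply: differentiable_continuous; apply/derivable1_diffP; have := ed 0 => -[].
      exact: ce.
    + apply: cvg_at_left_filter.
      have cg : {for t, continuous g}.
        by apply: differentiable_continuous; apply/derivable1_diffP; have := g_derive _ t0 => -[].
      exact: cg.
  - by rewrite in_itv/= lexx ltW.
  - by rewrite in_itv/= lexx ltW.
  - exact: ltW.
rewrite -(@ler_pM2l _ (expR (2 * al * t))) ?expR_gt0//.
rewrite mulrA -expRD (_ : 2 * al * t + _ = 0) ?expR0 ?mul1r; last by ring.
by move: gt; rewrite /g /f mulr0 expR0 mul1r.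
Qed.

End evolution.

(** * Scaled differences of elements of the graph of A *)

Section scaled_differences.
Context (R : realType).

Lemma subr_interchange (X : zmodType) (x x' y y' : X) :
  (x - x') - (y - y') = (x - y) - (x' - y').
Proof. by rewrite !opprB addrACA [RHS]addrACA [- x' - y]addrC. Qed.

Lemma submodule_sdiff (X : lmodType R) (S : X -> Prop) (hS : submodule S) (a : R) x y :
  S x -> S y -> S (a *: (x - y)).
Proof. by move=> Sx Sy; apply: submoduleZ => //; exact: submoduleB. Qed.

Lemma bil_sdiffl (X : lmodType R) (S : X -> Prop) B (h : semi_inner S B) (a : R) x y z :
  S x -> S y -> S z -> B (a *: (x - y)) z = a * (B x z - B y z).
Proof.
move=> Sx Sy Sz; have hS := semi_inner_submodule h; have hB := semi_inner_bil h.
by rewrite (bilZl hS hB a (submoduleB hS Sx Sy) Sz) (bilBl hB Sx Sy Sz).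
Qed.

Lemma seminorm0_sdiff (X : lmodType R) (S : X -> Prop) B (h : semi_inner S B) (a : R) x y x' y' :
  S x -> S y -> S x' -> S y' -> seminorm_of B (x - y) = 0 -> seminorm_of B (x' - y') = 0 ->
  seminorm_of B (a *: (x - x') - a *: (y - y')) = 0.
Proof.
move=> Sx Sy Sx' Sy' n0 n0'; have hS := semi_inner_submodule h.
have -> : a *: (x - x') - a *: (y - y') = a *: ((x - y) - (x' - y')).
  by rewrite -scalerBr subr_interchange.
have S1 := submoduleB hS Sx Sy; have S2 := submoduleB hS Sx' Sy'.
rewrite (seminormZ h)//; last exact: submoduleB.
apply/eqP; rewrite eq_le mulr_ge0 ?seminorm_ge0// andbT.
rewrite mulr_ge0_le0//; apply: (le_trans (seminormB h S1 S2)).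
by rewrite n0 n0' addr0.
Qed.

Lemma quadruple_sdiff (X Y Z : lmodType R) (a k : R) (u u' : X) (f f' : Y) (p p' q q' : Z) :
  ((a *: (u - u'), a *: (f - f'), k *: (a *: (p - p')), k *: (a *: (q - q'))) : (X * Y * Z * Z)%type) =
  a *: (((u, f, k *: p, k *: q) : (X * Y * Z * Z)%type) - (u', f', k *: p', k *: q')).
Proof. by rewrite !(scalerA k a) (mulrC k a) -!(scalerA a k) !(scalerBr k). Qed.

End scaled_differences.

(** * A linear weakening of the graph of A *)

Section weak_graph.
Context (R : realType) (d : nat) (Om G0 : set 'rV[R]_d).
Hypotheses (oOm : open Om) (bOm : bounded_set Om).
Local Notation E := 'rV[R]_d.
Local Notation mu := (@lebesgue_measure R).
Local Notation state := (state R d).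
Local Notation h1 := (h1 R d).
Let mOm := open_measurable_rV oOm.
Let sh := semi_inner_h1dot mOm.
Let sg := semi_inner_graddot mOm.
Let s2 := semi_inner_l2 mOm.
Let sv := semi_inner_L2vec mOm.
Let ss := semi_inner_state mOm.
Let hL := submodule_L2pair mOm.

(** [W12H1] with H^1_{G0} weakened to pairs in L^2, on which the H^1 product is already a semi-inner
    product. *)
Definition weak_W12 (v w p : R -> h1) :=
  [/\ boch_h1 Om p, forall s : R, s \in `[0, 1] -> L2pair Om (w s),
      {ae mu, forall s : R, s \in `]0, 1[ -> h1norm Om (v s - w s) = 0} &
      forall s : R, s \in `[0, 1] -> forall P, L2pair Om P ->
        h1dot Om (w s - w 0) P = \int[mu]_(r in `]0, s[) h1dot Om (p r) P].

Lemma W12H1_sdiff (a : R) v w p v' w' p' : boch_h1 Om v -> boch_h1 Om v' ->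
  W12H1 Om G0 v w p -> W12H1 Om G0 v' w' p' ->
  weak_W12 (a *: (v - v')) (fun s => a *: (w s - w' s)) (a *: (p - p')).
Proof.
move=> bv bv' [Hp Hw aw iw] [Hp' Hw' aw' iw'].
have bp := L2H1_bochner Hp; have bp' := L2H1_bochner Hp'.
have Lw s : s \in `[0, 1] -> L2pair Om (w s) by move=> /Hw[[]].
have Lw' s : s \in `[0, 1] -> L2pair Om (w' s) by move=> /Hw'[[]].
have o01 : 0 \in `[0%R, 1%R : R] by rewrite in_itv/= ler01 lexx.
split.
- exact: (submodule_sdiff (submodule_bochner sh) a bp bp').
- by move=> s s01; exact: (submodule_sdiff hL a (Lw _ s01) (Lw' _ s01)).
- move: aw aw'; apply: filterS2; first exact: (ae_filter_ringOfSetsType mu).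
  move=> s H H' sI.
  have s01 : s \in `[0, 1] by move: sI; rewrite !in_itv/= => /andP[/ltW-> /ltW->].
  exact: (seminorm0_sdiff sh a (bochner_L2_in bv sI) (Lw _ s01) (bochner_L2_in bv' sI) (Lw' _ s01) (H sI) (H' sI)).
- move=> s s01 P LP.
  have iP q : boch_h1 Om q -> mu.-integrable `]0, s[ (EFin \o (fun r => h1dot Om (q r) P)).
    move=> bq; apply: integrableS (integrable_bil_cst sh bq LP) => //.
    move=> r /=; rewrite !in_itv/= => /andP[-> rs]; rewrite (lt_le_trans rs)//.
    by move: s01; rewrite in_itv/= => /andP[].
  have -> : a *: (w s - w' s) - a *: (w 0 - w' 0) = a *: ((w s - w 0) - (w' s - w' 0)).
    by rewrite -scalerBr subr_interchange.
  rewrite (bil_sdiffl sh a (submoduleB hL (Lw _ s01) (Lw _ o01)) (submoduleB hL (Lw' _ s01) (Lw' _ o01)) LP).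
  rewrite iw// iw'// -RintegralB//; [|exact: iP|exact: iP].
  rewrite -RintegralZl//; last exact: integrableB (iP _ bp) (iP _ bp').
  apply: eq_Rintegral => r; rewrite inE/= => rs.
  have rI : r \in `]0, 1[.
    move: s01 rs; rewrite !in_itv/= => /andP[_ s1] /andP[-> rs]; exact: lt_le_trans s1.
  exact/esym/(bil_sdiffl sh a (bochner_L2_in bp rI) (bochner_L2_in bp' rI) LP).
Qed.

Variables (tau c1 c2 d1 d2 : R).

(** What the energy computation uses of [graph_A]. Membership in H^1_{G0} is kept for y and [u2],
    which serve as test functions and enter the Poincare inequality; the flux equation is expanded
    into gradient products. *)
Definition weak_graph (U F : state) :=
  [/\ weak_state Om U, weak_state Om F & H1_0 Om G0 (st1 U)] /\
  exists (u2 : h1) (w3 p3 w4 p4 : R -> h1) (f : E -> R^o),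
  [/\ H1_0 Om G0 u2 /\ seminorm_of (l2dot Om) (h1_fun u2 - st2 U) = 0,
      weak_W12 (st3 U) w3 p3 /\ h1norm Om (w3 0 - st1 U) = 0,
      weak_W12 (st4 U) w4 p4 /\ h1norm Om (w4 0 - u2) = 0,
      L2 Om f /\ (forall psi, H1_0 Om G0 psi ->
         l2dot Om f (h1_fun psi) = - (c1 * graddot Om (st1 U) psi + c2 * graddot Om (w3 1) psi +
            d1 * graddot Om u2 psi + d2 * graddot Om (w4 1) psi)) &
      seminorm_of (state_dot Om) (F - (u2, f, - tau^-1 *: p3, - tau^-1 *: p4)) = 0].

Lemma flux_dot (P1 P2 P3 P4 psi : h1) : L2pair Om P1 -> L2pair Om P2 -> L2pair Om P3 ->
  L2pair Om P4 -> L2pair Om psi ->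
  L2vec_dot Om (c1 *: P1.2 + c2 *: P2.2 + d1 *: P3.2 + d2 *: P4.2) psi.2 =
  c1 * graddot Om P1 psi + c2 * graddot Om P2 psi + d1 * graddot Om P3 psi + d2 * graddot Om P4 psi.
Proof.
move=> [_ L1] [_ L2] [_ L3] [_ L4] [_ Lpsi]; have hv := submodule_L2vec mOm.
have bv := semi_inner_bil sv; have Z k G := @submoduleZ _ _ _ hv k G.
have D G K := @submoduleD _ _ _ hv G K.
rewrite (bilDl bv (D _ _ (D _ _ (Z c1 _ L1) (Z c2 _ L2)) (Z d1 _ L3)) (Z d2 _ L4) Lpsi).
rewrite (bilDl bv (D _ _ (Z c1 _ L1) (Z c2 _ L2)) (Z d1 _ L3) Lpsi).
rewrite (bilDl bv (Z c1 _ L1) (Z c2 _ L2) Lpsi).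
by rewrite (bilZl hv bv c1 L1 Lpsi) (bilZl hv bv c2 L2 Lpsi) (bilZl hv bv d1 L3 Lpsi) (bilZl hv bv d2 L4 Lpsi).
Qed.

Lemma weak_state_generator u2 f p3 p4 : L2pair Om u2 -> L2 Om f -> boch_h1 Om p3 -> boch_h1 Om p4 ->
  weak_state Om ((u2, f, - tau^-1 *: p3, - tau^-1 *: p4) : state).
Proof.
move=> L1 L2' b3 b4; have hb := submodule_bochner sh.
split; [exact: L1|exact: L2'|exact: (submoduleZ hb _ b3)|exact: (submoduleZ hb _ b4)].
Qed.

(** The graph is linear once all its witnesses are combined with the same coefficients. For W(t + h)
    and W(t) the images are V(t + h) - V0 and V(t) - V0, and V0 cancels. *)
Lemma graph_A_sdiff (a : R) U F U' F' :
  graph_A Om G0 tau c1 c2 d1 d2 U F -> graph_A Om G0 tau c1 c2 d1 d2 U' F' ->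
  weak_graph (a *: (U - U')) (a *: (F - F')).
Proof.
move=> [sU [sF [u2 [w3 [p3 [w4 [p4 [f [[Hu2 nu2] [W3 n3] [W4 n4] [Lf _ tf] nF]]]]]]]]].
move=> [sU' [sF' [u2' [w3' [p3' [w4' [p4' [f' [[Hu2' nu2'] [W3' n3'] [W4' n4'] [Lf' _ tf'] nF']]]]]]]]].
have hW := submodule_weak_state mOm; have hH := submodule_H1_0 oOm bOm G0.
have WU := in_state_space_weak sU; have WU' := in_state_space_weak sU'.
have WF := in_state_space_weak sF; have WF' := in_state_space_weak sF'.
have [HU _ _ _] := sU; have [HU' _ _ _] := sU'.
have o01 : 0 \in `[0%R, 1%R : R] by rewrite in_itv/= ler01 lexx.
have i01 : 1 \in `[0%R, 1%R : R] by rewrite in_itv/= ler01 lexx.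
have HL P : H1_0 Om G0 P -> L2pair Om P by case=> -[].
have Lw v w p s : W12H1 Om G0 v w p -> s \in `[0, 1] -> L2pair Om (w s).
  by move=> [_ + _ _] s01 => /(_ _ s01)/HL.
have bp v w p : W12H1 Om G0 v w p -> boch_h1 Om p by move=> [/L2H1_bochner].
split.
  split; [exact: (submodule_sdiff hW a WU WU')|exact: (submodule_sdiff hW a WF WF')|].
  have -> : st1 (a *: (U - U')) = a *: (st1 U - st1 U') by rewrite linearZ linearB.
  exact: (submodule_sdiff hH a HU HU').
exists (a *: (u2 - u2')), (fun s => a *: (w3 s - w3' s)), (a *: (p3 - p3')),
  (fun s => a *: (w4 s - w4' s)), (a *: (p4 - p4')), (a *: (f - f')).
have e1 : st1 (a *: (U - U')) = a *: (st1 U - st1 U') by rewrite linearZ linearB.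
have e2 : st2 (a *: (U - U')) = a *: (st2 U - st2 U') by rewrite linearZ linearB.
have e3 : st3 (a *: (U - U')) = a *: (st3 U - st3 U') by rewrite linearZ linearB.
have e4 : st4 (a *: (U - U')) = a *: (st4 U - st4 U') by rewrite linearZ linearB.
have eu : h1_fun (a *: (u2 - u2')) = a *: (h1_fun u2 - h1_fun u2') by rewrite linearZ linearB.
split.
- split; first exact: (submodule_sdiff hH a Hu2 Hu2').
  rewrite e2 eu; apply: (seminorm0_sdiff s2).
  + exact: (HL _ Hu2).1.
  + exact: weak_state2 WU.
  + exact: (HL _ Hu2').1.
  + exact: weak_state2 WU'.
  + by rewrite -nu2 L2normE.
  + by rewrite -nu2' L2normE.
- split; first by rewrite e3; exact: (W12H1_sdiff a (weak_state3 WU) (weak_state3 WU') W3 W3').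
  rewrite e1; exact: (seminorm0_sdiff sh a (Lw _ _ _ _ W3 o01) (weak_state1 WU) (Lw _ _ _ _ W3' o01) (weak_state1 WU') n3 n3').
- split; first by rewrite e4; exact: (W12H1_sdiff a (weak_state4 WU) (weak_state4 WU') W4 W4').
  exact: (seminorm0_sdiff sh a (Lw _ _ _ _ W4 o01) (HL _ Hu2) (Lw _ _ _ _ W4' o01) (HL _ Hu2') n4 n4').
- split; first exact: (submodule_sdiff (semi_inner_submodule s2) a Lf Lf').
  move=> psi Hpsi; have Lpsi := HL _ Hpsi.
  have := tf _ Hpsi; have := tf' _ Hpsi.
  rewrite (flux_dot (weak_state1 WU) (Lw _ _ _ _ W3 i01) (HL _ Hu2) (Lw _ _ _ _ W4 i01) Lpsi).
  rewrite (flux_dot (weak_state1 WU') (Lw _ _ _ _ W3' i01) (HL _ Hu2') (Lw _ _ _ _ W4' i01) Lpsi).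
  move=> t' t; rewrite (bil_sdiffl s2 a Lf Lf' Lpsi.1) e1.
  rewrite [l2dot _ f _]t [l2dot _ f' _]t'.
  rewrite (bil_sdiffl sg a (weak_state1 WU) (weak_state1 WU') Lpsi).
  rewrite (bil_sdiffl sg a (Lw _ _ _ _ W3 i01) (Lw _ _ _ _ W3' i01) Lpsi).
  rewrite (bil_sdiffl sg a (HL _ Hu2) (HL _ Hu2') Lpsi).
  rewrite (bil_sdiffl sg a (Lw _ _ _ _ W4 i01) (Lw _ _ _ _ W4' i01) Lpsi).
  rewrite /st1; ring.
- rewrite (@quadruple_sdiff R h1 (E -> R^o) (R -> h1) a (- tau^-1)).
  have WG := weak_state_generator (HL _ Hu2) Lf (bp _ _ _ W3) (bp _ _ _ W4).
  have WG' := weak_state_generator (HL _ Hu2') Lf' (bp _ _ _ W3') (bp _ _ _ W4').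
  rewrite state_normE in nF; rewrite state_normE in nF'.
  exact: (seminorm0_sdiff ss a WF WG WF' WG' nF nF').
Qed.

End weak_graph.

(** Young's inequality: |2 r x + c y|^2 >= 0, divided by 4 r. It is written for - c because the
    delayed terms enter the dissipation with a minus sign. *)
Lemma am_gm_bil (R : realType) (X : lmodType R) (S : X -> Prop) B (h : semi_inner S B)
  (r c : R) x y : 0 < r -> S x -> S y ->
  - c * B x y <= r * B x x + c ^+ 2 / (4 * r) * B y y.
Proof.
move=> r0 Sx Sy; have hS := semi_inner_submodule h; have hB := semi_inner_bil h.
have Srx := submoduleZ hS (2 * r) Sx; have Scy := submoduleZ hS c Sy.
have := semi_inner_ge0 h (submoduleD hS Srx Scy).
rewrite (bil_sqD hS hB Srx Scy) (bilZl hS hB _ Sx Srx) (bilZr hS hB _ Sx Sx).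
rewrite (bilZl hS hB _ Sx Scy) (bilZr hS hB _ Sy Sx) (bilZl hS hB _ Sy Scy) (bilZr hS hB _ Sy Sy).
move=> H; rewrite -subr_ge0.
have -> : r * B x x + c ^+ 2 / (4 * r) * B y y - - c * B x y =
  (2 * r * (2 * r * B x x) + 2 * (2 * r * (c * B x y)) + c * (c * B y y)) / (4 * r).
  by field; rewrite gt_eqF.
by rewrite divr_ge0// mulr_ge0// ltW.
Qed.

(** * Dissipation and decay *)

Section constants.
Context (R : realType).
Variables (cp c1 c2 d1 d2 : R).
Hypotheses (cp0 : 0 < cp) (d1_gt0 : 0 < d1) (c12 : 6 * c2 < c1) (c20 : 0 < 6 * c2) (d20 : 0 < d2).
Hypothesis hmax : Num.max (9 * c1 ^+ 2 * d2 ^+ 2 / (c1 ^+ 2 - 9 * c2 ^+ 2))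
                    (18 * c1 * c2 ^+ 2 * cp / (c1 ^+ 2 - 36 * c2 ^+ 2))
            <= d1 ^+ 2.

Let c2_gt0 : 0 < c2. Proof. by move: c20; rewrite pmulr_rgt0. Qed.
Let c1_gt0 : 0 < c1. Proof. exact: lt_trans c12. Qed.

Let c36 : 0 < c1 ^+ 2 - 36 * c2 ^+ 2.
Proof.
have -> : c1 ^+ 2 - 36 * c2 ^+ 2 = (c1 - 6 * c2) * (c1 + 6 * c2) by ring.
by rewrite mulr_gt0//; move: c12 c20; lra.
Qed.

Let c9 : 0 < c1 ^+ 2 - 9 * c2 ^+ 2.
Proof. by move: (sqr_ge0 c2) c36; lra. Qed.

(** For b = d1 / 6 this says d2^2 / (4 b) <= d1 / 6, the cost of absorbing the delayed velocity
    term. It follows from the first bound because c1^2 - 9 c2^2 <= c1^2. *)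
Lemma d1_d2 : 3 * d2 <= d1.
Proof.
move: hmax; rewrite ge_max => /andP[+ _]; rewrite ler_pdivrMr// => H.
have H1 : d1 ^+ 2 * (c1 ^+ 2 - 9 * c2 ^+ 2) <= d1 ^+ 2 * c1 ^+ 2.
  by rewrite ler_wpM2l ?sqr_ge0//; move: (sqr_ge0 c2); lra.
have : (9 * d2 ^+ 2) * c1 ^+ 2 <= d1 ^+ 2 * c1 ^+ 2.
  by rewrite mulrAC; exact: le_trans H H1.
rewrite ler_pM2r ?exprn_gt0// => H2.
have d20' := ltW d20; have d10' := ltW d1_gt0.
rewrite -(@ler_pXn2r _ 2)// ?nnegrE ?mulr_ge0//.
by rewrite (_ : (3 * d2) ^+ 2 = 9 * d2 ^+ 2)//; ring.
Qed.

Lemma d1_cp : 18 * c2 ^+ 2 * cp <= c1 * d1 ^+ 2.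
Proof.
move: hmax; rewrite ge_max => /andP[_ +]; rewrite ler_pdivrMr// => H.
have H1 : d1 ^+ 2 * (c1 ^+ 2 - 36 * c2 ^+ 2) <= d1 ^+ 2 * c1 ^+ 2.
  by rewrite ler_wpM2l ?sqr_ge0//; move: (sqr_ge0 c2); lra.
have H2 := le_trans H H1.
rewrite -(ler_pM2l c1_gt0) (_ : c1 * (c1 * _) = d1 ^+ 2 * c1 ^+ 2); last by ring.
by rewrite (_ : c1 * _ = 18 * c1 * c2 ^+ 2 * cp)//; ring.
Qed.

(** With a = N c1 / 2, this is the N for which c2^2 / (4 a) = d1 / 6, so that each delayed term
    costs at most (d1 / 6) |P|^2. After the loss (3/2) a |Y|^2 at s = 0, a quarter of N c1 |Y|^2 is
    left; likewise b = d1 / 6 costs a quarter of d1 |X|^2. *)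
Definition lyapN := 3 * c2 ^+ 2 / (c1 * d1).
Definition lyapa := lyapN * c1 / 2.
Definition lyapb := d1 / 6.

Lemma lyapN_gt0 : 0 < lyapN.
Proof. by rewrite divr_gt0 ?mulr_gt0 ?exprn_gt0. Qed.

Lemma lyapN_d1 : lyapN * d1 = 3 * c2 ^+ 2 / c1.
Proof. by rewrite /lyapN; field; rewrite !gt_eqF. Qed.

(** The term N |y'|^2 comes from differentiating N <y', y>; by the Poincare inequality it then costs
    at most a sixth of the damping d1 |X|^2. *)
Lemma lyapN_cp : lyapN * cp <= d1 / 6.
Proof.
have := d1_cp => H; rewrite -subr_ge0.
have -> : d1 / 6 - lyapN * cp = (c1 * d1 ^+ 2 - 18 * c2 ^+ 2 * cp) / (6 * (c1 * d1)).
  by rewrite /lyapN; field; rewrite !gt_eqF.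
by rewrite divr_ge0 ?subr_ge0// !mulr_ge0// ltW.
Qed.

Lemma c2_c1 : c2 ^+ 2 / c1 <= c1 / 36.
Proof.
rewrite ler_pdivrMr//; by move: c36; rewrite expr2; lra.
Qed.

(* zz, tt, pp stand for |Z|^2, |T|^2, |P|^2, zp and tp for <Z, P> and <T, P>,
   uu for |y'|^2, and I3, I4 for the integrals of |grad z|^2 and |grad z'|^2. *)
Lemma dissipation_scalar (xx yy zz tt xy zp tp pp uu I3 I4 : R) :
  0 <= xx -> 0 <= yy -> 0 <= pp ->
  pp = xx + 2 * lyapN * xy + lyapN ^+ 2 * yy ->
  - c2 * zp <= lyapa * zz + c2 ^+ 2 / (4 * lyapa) * pp ->
  - d2 * tp <= lyapb * tt + d2 ^+ 2 / (4 * lyapb) * pp ->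
  - (- 2 * c2 ^+ 2 / c1) * xy <= d1 / 6 * xx + (- 2 * c2 ^+ 2 / c1) ^+ 2 / (4 * (d1 / 6)) * yy ->
  uu <= cp * xx ->
  - (d1 * xx + c2 * zp + d2 * tp) + lyapN * uu - lyapN * c1 * yy
  - lyapa * (zz - 3 / 2 * yy + 2^-1 * I3) - lyapb * (tt - 3 / 2 * xx + 2^-1 * I4)
  <= - (d1 / 12 * xx + lyapN * c1 / 6 * yy + lyapa / 2 * I3 + lyapb / 2 * I4).
Proof.
move=> xx0 yy0 pp0 ppE hz ht hxy hu.
have N0 := lyapN_gt0; have Nd := lyapN_d1; have Ncp := lyapN_cp; have cc := c2_c1.
have e1 : c2 ^+ 2 / (4 * lyapa) = d1 / 6.
  by rewrite /lyapa /lyapN; field; rewrite !gt_eqF.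
have e2 : d2 ^+ 2 / (4 * lyapb) <= d1 / 6.
  rewrite /lyapb (_ : 4 * (d1 / 6) = 2 * d1 / 3); last by field.
  rewrite ler_pdivrMr ?divr_gt0 ?mulr_gt0//.
  move: d1_d2 d20 d1_gt0; nra.
have e3 : (- 2 * c2 ^+ 2 / c1) ^+ 2 / (4 * (d1 / 6)) = 2 * lyapN * (c2 ^+ 2 / c1).
  by rewrite /lyapN; field; rewrite !gt_eqF.
rewrite e1 in hz; rewrite e3 in hxy.
have {}ht : - d2 * tp <= lyapb * tt + d1 / 6 * pp.
  by apply: (le_trans ht); rewrite lerD2l ler_wpM2r.
have hNu : lyapN * uu <= d1 / 6 * xx.
  apply: (@le_trans _ _ (lyapN * (cp * xx))); first by rewrite ler_wpM2l// ltW.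
  by rewrite mulrA ler_wpM2r.
have hy : lyapN * (c2 ^+ 2 / c1) * yy <= lyapN * (c1 / 36) * yy.
  by rewrite ler_wpM2r// ler_wpM2l// ltW.
(* The two delayed terms together cost d1 / 3 times |P|^2. Since N d1 / 3 = c2^2 / c1, the cross
   term in it is 2 (c2^2 / c1) <X, Y>, which [hxy] bounds. *)
have q : d1 / 3 * pp = d1 / 3 * xx + 2 * (c2 ^+ 2 / c1) * xy + lyapN * (c2 ^+ 2 / c1) * yy.
  rewrite ppE /lyapN; field; by rewrite !gt_eqF.
have ea : lyapa * yy = lyapN * c1 * yy / 2 by rewrite /lyapa; field.
have eb : lyapb * xx = d1 * xx / 6 by rewrite /lyapb; field.
(* The coefficient of |X|^2 in units of d1 is -1 + 1/4 (at s = 0) + 1/6 (Poincare) + 1/3 (from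
   |P|^2) + 1/6 (cross term) = -1/12. That of |Y|^2 in units of N c1 is -1 + 3/4 + 3/36 = -1/6,
   where 3/36 bounds one share N c2^2 / c1 from |P|^2 and two from the cross term. *)
lra.
Qed.

Lemma exists_rate (p1 p2 p3 p4 q1 q2 q3 q4 : R) :
  0 < p1 -> 0 < p2 -> 0 < p3 -> 0 < p4 -> 0 < q1 -> 0 < q2 -> 0 < q3 -> 0 < q4 ->
  exists2 al : R, 0 < al & [/\ al * p1 <= q1, al * p2 <= q2, al * p3 <= q3 & al * p4 <= q4].
Proof.
move=> *; exists (Num.min (Num.min (q1 / p1) (q2 / p2)) (Num.min (q3 / p3) (q4 / p4))).
  by rewrite !lt_min !divr_gt0.
split; rewrite -ler_pdivlMr// !ge_min lexx ?orbT//.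
Qed.

End constants.

(** * Scalar forms of the estimates, with plain variables for the integrals *)

Section scalar_inequalities.
Context (R : realType).

(** Here x22, x21, x11 stand for |y'|^2, <y', y>, |y|^2, and y for |grad y|^2; j3, j4 are the
    unweighted history integrals and w3, w4 the weighted ones. *)
Lemma lyap_le_scalar (A N ta tb cp x22 x21 x11 y j3 j4 w3 w4 : R) :
  0 <= N -> 0 <= ta -> 0 <= tb ->
  - (- 2) * x21 <= 1 * x22 + x11 -> x11 <= cp * y -> w3 <= 3 / 2 * j3 -> w4 <= 3 / 2 * j4 ->
  2^-1 * x22 + A * y + N / 2 * (x21 + x21) + ta * w3 + tb * w4 <=
  (2^-1 + N / 2) * x22 + (A + N / 2 * cp) * y + ta * (3 / 2) * j3 + tb * (3 / 2) * j4.
Proof.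
move=> N0 ta0 tb0 hx hy h3 h4.
have H1 := ler_wpM2l N0 hx; have H2 := ler_wpM2l N0 hy.
have H3 := ler_wpM2l ta0 h3; have H4 := ler_wpM2l tb0 h4.
lra.
Qed.

(** The cross term is absorbed by a quarter of |y'|^2 and by N^2 |y|^2 <= N (N cp) |grad y|^2 <= N
    (d1 / 6) |grad y|^2, which the share N d1 / 2 of the gradient coefficient covers. *)
Lemma lyap_ge_scalar (N d1 c1 ta tb cp x22 x21 x11 y j3 j4 w3 w4 : R) :
  0 <= N -> 0 <= d1 -> 0 <= y -> 0 <= ta -> 0 <= tb -> N * cp <= d1 / 6 ->
  - N * x21 <= 4^-1 * x22 + N ^+ 2 * x11 -> x11 <= cp * y -> j3 <= w3 -> j4 <= w4 ->
  4^-1 * x22 + c1 / 2 * y + ta * j3 + tb * j4 <=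
  2^-1 * x22 + (c1 + N * d1) / 2 * y + N / 2 * (x21 + x21) + ta * w3 + tb * w4.
Proof.
move=> N0 d0 y0 ta0 tb0 Ncp hx hy h3 h4.
have H2 := ler_wpM2l N0 (ler_wpM2l N0 hy); have H1 := ler_wpM2l N0 (ler_wpM2r y0 Ncp).
have H3 := ler_wpM2l ta0 h3; have H4 := ler_wpM2l tb0 h4.
have H5 := mulr_ge0 N0 (mulr_ge0 d0 y0).
lra.
Qed.

(** The left side of the conclusion is half of dL/dt. The value of A cancels c1 <X, Y>, from testing
    with y', and N d1 <X, Y>, from testing with y; the rest is bounded by the dissipation
    inequality. The four conditions on [al] compare that bound term by term with the upper bound of
    L. *)
Lemma rate_scalar (al A N a0 b0 tau cp c1 c2 d1 d2 LU uu xx yy xy zx zy tx ty zz tt j3 j4 q3 q4 : R) :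
  2 * al * ((2^-1 + N / 2) * cp) <= d1 / 12 ->
  2 * al * (A + N / 2 * cp) <= N * c1 / 6 ->
  2 * al * (tau * a0 * (3 / 2)) <= a0 / 2 ->
  2 * al * (tau * b0 * (3 / 2)) <= b0 / 2 ->
  0 <= al -> 0 < tau -> 0 <= N -> 0 <= xx -> 0 <= yy -> 0 <= j3 -> 0 <= j4 ->
  A = (c1 + N * d1) / 2 ->
  uu <= cp * xx ->
  LU <= (2^-1 + N / 2) * uu + (A + N / 2 * cp) * yy + tau * a0 * (3 / 2) * j3 + tau * b0 * (3 / 2) * j4 ->
  2 * q3 = zz - 3 / 2 * yy + 2^-1 * j3 -> 2 * q4 = tt - 3 / 2 * xx + 2^-1 * j4 ->
  - (d1 * xx + c2 * (zx + N * zy) + d2 * (tx + N * ty)) + N * uu - N * c1 * yy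
  - a0 * (zz - 3 / 2 * yy + 2^-1 * j3) - b0 * (tt - 3 / 2 * xx + 2^-1 * j4)
  <= - (d1 / 12 * xx + N * c1 / 6 * yy + a0 / 2 * j3 + b0 / 2 * j4) ->
  2^-1 * - (c1 * xy + c2 * zx + d1 * xx + d2 * tx) + A * xy +
  N / 2 * (uu + - (c1 * yy + c2 * zy + d1 * xy + d2 * ty)) +
  tau * a0 * (- tau^-1 * q3) + tau * b0 * (- tau^-1 * q4) <= - al * LU.
Proof.
move=> h1 h2 h3 h4 al0 tau0 N0 xx0 yy0 j30 j40 AE hu hL e3 e4 D.
rewrite -e3 -e4 in D.
have t3 : tau * a0 * (- tau^-1 * q3) = - (a0 * q3) by field; rewrite gt_eqF.
have t4 : tau * b0 * (- tau^-1 * q4) = - (b0 * q4) by field; rewrite gt_eqF.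
have N12 : 0 <= 2^-1 + N / 2 by rewrite addr_ge0 ?divr_ge0 ?invr_ge0.
have H1 := ler_wpM2r xx0 h1; have H2 := ler_wpM2r yy0 h2.
have H3 := ler_wpM2r j30 h3; have H4 := ler_wpM2r j40 h4.
have H5 := ler_wpM2l al0 hL; have H6 := ler_wpM2l al0 (ler_wpM2l N12 hu).
have X : 2 * (A * xy) = c1 * xy + N * d1 * xy by rewrite AE; field.
rewrite t3 t4; move: D H1 H2 H3 H4 H5 H6 X; clear; lra.
Qed.

Lemma weighted_sum4_le (k x1 x2 x3 x4 p1 p2 p3 p4 q1 q2 q3 q4 : R) :
  0 <= x1 -> 0 <= x2 -> 0 <= x3 -> 0 <= x4 ->
  k * p1 <= q1 -> k * p2 <= q2 -> k * p3 <= q3 -> k * p4 <= q4 ->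
  (p1 * x1 + p2 * x2 + p3 * x3 + p4 * x4) * k <= q1 * x1 + q2 * x2 + q3 * x3 + q4 * x4.
Proof.
move=> x10 x20 x30 x40 h1 h2 h3 h4.
have := ler_wpM2r x10 h1; have := ler_wpM2r x20 h2.
by have := ler_wpM2r x30 h3; have := ler_wpM2r x40 h4; lra.
Qed.

Lemma cvg0_le (T : Type) (F : set_system T) {FF : Filter F} (c : R) (e D1 D2 : T -> R) :
  D1 k @[k --> F] --> (0 : R) -> D2 k @[k --> F] --> (0 : R) ->
  (\forall k \near F, 0 <= e k <= c * (D1 k + D2 k)) -> e k @[k --> F] --> (0 : R).
Proof.
move=> h1 h2 le; apply: (squeeze_cvgr le); first exact: cvg_cst.
rewrite [X in _ --> X](_ : _ = c * (0 + 0)); last by rewrite addr0 mulr0.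
by apply: cvgM; [exact: cvg_cst|exact: cvgD].
Qed.

End scalar_inequalities.

(** * Dissipation along the flow, equivalence with the energy, and decay *)

Section decay.
Context (R : realType) (d : nat) (Om G0 : set 'rV[R]_d).
Hypotheses (oOm : open Om) (bOm : bounded_set Om).
Local Notation E := 'rV[R]_d.
Local Notation mu := (@lebesgue_measure R).
Local Notation state := (state R d).
Local Notation h1 := (h1 R d).
Let mOm := open_measurable_rV oOm.
Let sh := semi_inner_h1dot mOm.
Let sg := semi_inner_graddot mOm.
Let s2 := semi_inner_l2 mOm.
Let ss := semi_inner_state mOm.
Let hL := submodule_L2pair mOm.
Let wg := semi_inner_weighted_grad mOm.

(** Testing the duality identity with (0, Q.2), where the H^1 product reduces to the gradient
    product, isolates the identity for gradients. Such a pair is in general not in H^1, but it is in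
    L^2 x (L^2)^d, where the identity is still available. *)
Lemma weak_W12_by_parts v w p : boch_h1 Om v -> weak_W12 Om v w p ->
  2 * weighted_int (weight (R:=R)) (graddot Om) v p =
  graddot Om (w 1) (w 1) - 3 / 2 * graddot Om (w 0) (w 0) +
  2^-1 * weighted_int (cst 1) (graddot Om) v v.
Proof.
move=> bv [bp Lw aw iw].
have gw s : s \in `[0, 1] -> forall Q, L2pair Om Q ->
    graddot Om (w s - w 0) Q = \int[mu]_(r in `]0, s[) graddot Om (p r) Q.
  move=> s01 Q LQ.
  have h1g P : h1dot Om P (0, Q.2) = graddot Om P Q.
    rewrite /h1dot [X in X + _](_ : _ = 0) ?add0r//.
    under eq_Rintegral do rewrite mulr0.
    by rewrite /Rintegral integral0.
  have LQ' : L2pair Om (0, Q.2).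
    by split; [exact: submodule0 (semi_inner_submodule s2)|exact: LQ.2].
  rewrite -h1g iw//; apply: eq_Rintegral => r _; exact: h1g.
have aw' : {ae mu, forall s : R, s \in `]0, 1[ -> seminorm_of (graddot Om) (v s - w s) = 0}.
  move: aw; apply: filterS; first exact: (ae_filter_ringOfSetsType mu).
  move=> s H sI; apply/eqP; rewrite eq_le seminorm_ge0 andbT -(H sI).
  by apply: ler_wsqrtr; exact: graddot_le_h1dot.
have := integral_by_parts sg (bochner_h1_grad mOm bv) (bochner_h1_grad mOm bp) Lw gw aw' 2^-1.
rewrite (_ : 1 + 2^-1 = 3 / 2 :> R); last by field.
move=> e; rewrite [LHS]e; congr (_ + _ * _).
by apply: eq_Rintegral => s _; rewrite mul1r.
Qed.

Variables (cp tau c1 c2 d1 d2 : R).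
Hypotheses (cp0 : 0 < cp) (hP : poincare_constant Om G0 cp) (tau0 : 0 < tau).
Hypotheses (d10 : 0 < d1) (c12 : 6 * c2 < c1) (c20 : 0 < 6 * c2) (d20 : 0 < d2).
Hypothesis hmax : Num.max (9 * c1 ^+ 2 * d2 ^+ 2 / (c1 ^+ 2 - 9 * c2 ^+ 2))
                    (18 * c1 * c2 ^+ 2 * cp / (c1 ^+ 2 - 36 * c2 ^+ 2))
            <= d1 ^+ 2.
Local Notation N := (lyapN c1 c2 d1).
Local Notation a0 := (lyapa c1 c2 d1).
Local Notation b0 := (lyapb d1).
Local Notation A := ((c1 + N * d1) / 2).
Local Notation L := (lyap Om A N (tau * a0) (tau * b0)).
Local Notation g := (graddot Om).
Local Notation l := (l2dot Om).
Local Notation J := (weighted_int (cst 1) g).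

Lemma poincare_graddot P : H1_0 Om G0 P -> l (h1_fun P) (h1_fun P) <= cp * g P P.
Proof.
move=> HP; have [[LP _] _] := HP; have := hP HP.
have -> : L2vec_norm Om P.2 ^+ 2 = g P P.
  by rewrite [LHS]sqr_sqrtr//; exact: (semi_inner_ge0 sg LP).
by rewrite L2normE (seminorm_sq s2)//; exact: LP.1.
Qed.

Let c1_gt0 : 0 < c1. Proof. exact: lt_trans c12. Qed.
Let N_gt0 : 0 < N. Proof. exact: lyapN_gt0. Qed.
Let a0_gt0 : 0 < a0. Proof. by rewrite /lyapa divr_gt0// mulr_gt0. Qed.
Let b0_gt0 : 0 < b0. Proof. by rewrite /lyapb divr_gt0. Qed.
Let A_gt0 : 0 < A. Proof. by rewrite divr_gt0// addr_gt0// mulr_gt0. Qed.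

Let lyapE U : L U U = 2^-1 * l (st2 U) (st2 U) + A * g (st1 U) (st1 U) +
  N / 2 * (l (st2 U) (h1_fun (st1 U)) + l (h1_fun (st1 U)) (st2 U)) +
  tau * a0 * weighted_int (weight (R:=R)) g (st3 U) (st3 U) +
  tau * b0 * weighted_int (weight (R:=R)) g (st4 U) (st4 U).
Proof. by []. Qed.

Lemma lyap_le U : weak_state Om U -> H1_0 Om G0 (st1 U) ->
  L U U <= (2^-1 + N / 2) * l (st2 U) (st2 U) + (A + N / 2 * cp) * g (st1 U) (st1 U) +
    tau * a0 * (3 / 2) * J (st3 U) (st3 U) + tau * b0 * (3 / 2) * J (st4 U) (st4 U).
Proof.
move=> WU HU; have S1 := (weak_state1 WU).1; have S2 := weak_state2 WU.
have hx := am_gm_bil s2 (- 2) ltr01 S2 S1.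
rewrite (_ : (- 2) ^+ 2 / (4 * 1) = 1 :> R) ?mul1r in hx; last by field.
have /andP[_ i3] := weighted_grad_ge mOm (weak_state3 WU).
have /andP[_ i4] := weighted_grad_ge mOm (weak_state4 WU).
rewrite lyapE (bilC (semi_inner_bil s2) S1 S2).
apply: lyap_le_scalar (poincare_graddot HU) i3 i4; [exact: ltW|exact/ltW/mulr_gt0|exact/ltW/mulr_gt0|].
by rewrite mul1r.
Qed.

Lemma lyap_ge U : weak_state Om U -> H1_0 Om G0 (st1 U) ->
  4^-1 * l (st2 U) (st2 U) + c1 / 2 * g (st1 U) (st1 U) +
  tau * a0 * J (st3 U) (st3 U) + tau * b0 * J (st4 U) (st4 U) <= L U U.
Proof.
move=> WU HU; have S1 := (weak_state1 WU).1; have S2 := weak_state2 WU.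
have r4 : 0 < 4^-1 :> R by rewrite invr_gt0.
have hx := am_gm_bil s2 N r4 S2 S1.
rewrite (_ : N ^+ 2 / (4 * 4^-1) = N ^+ 2 :> R) in hx; last by field.
have /andP[i3 _] := weighted_grad_ge mOm (weak_state3 WU).
have /andP[i4 _] := weighted_grad_ge mOm (weak_state4 WU).
rewrite lyapE (bilC (semi_inner_bil s2) S1 S2).
have gg := semi_inner_ge0 sg (weak_state1 WU).
have tA := ltW (mulr_gt0 tau0 a0_gt0); have tB := ltW (mulr_gt0 tau0 b0_gt0).
exact: (lyap_ge_scalar _ (ltW N_gt0) (ltW d10) gg tA tB (lyapN_cp d10 c12 c20 hmax) hx
  (poincare_graddot HU) i3 i4).
Qed.

Lemma energyE V : energy Om tau c1 d1 d2 V =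
  2^-1 * l (st2 V) (st2 V) + c1 / 2 * g (st1 V) (st1 V) +
  tau * d1 / 2 * J (st3 V) (st3 V) + tau * d2 / 2 * J (st4 V) (st4 V).
Proof.
have vn P : L2vec_norm Om P.2 ^+ 2 = g P P.
  rewrite [LHS]sqr_sqrtr//; apply: Rintegral_ge0 => x _.
  by apply: sumr_ge0 => i _; rewrite -expr2 sqr_ge0.
rewrite /energy vn; congr (_ * _ + _ + _ * _ + _ * _).
- rewrite [LHS]sqr_sqrtr; first by apply: eq_Rintegral => x _; rewrite expr2.
  by apply: Rintegral_ge0 => x _; rewrite sqr_ge0.
- by apply: eq_Rintegral => s _; rewrite vn mul1r.
- by apply: eq_Rintegral => s _; rewrite vn mul1r.
Qed.

(** The flux equation is tested with u2, because of the kinetic term, and with y, because of the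
    cross term; with the second weighted by N, the delayed fluxes meet the gradient of u2 + N y,
    which is P. *)
Lemma dissipation (al : R) U F :
  2 * al * ((2^-1 + N / 2) * cp) <= d1 / 12 ->
  2 * al * (A + N / 2 * cp) <= N * c1 / 6 ->
  2 * al * (tau * a0 * (3 / 2)) <= a0 / 2 ->
  2 * al * (tau * b0 * (3 / 2)) <= b0 / 2 -> 0 <= al ->
  weak_graph Om G0 tau c1 c2 d1 d2 U F -> L U F <= - al * L U U.
Proof.
move=> al1 al2 al3 al4 al0.
move=> [[WU WF HU] [u2 [w3 [p3 [w4 [p4 [f [[Hu nu] [W3 n3] [W4 n4] [Lf tf] nF]]]]]]]].
have Lu : L2pair Om u2 by case: Hu => -[].
have L1 := weak_state1 WU; have L2 := weak_state2 WU.
have b3 := weak_state3 WU; have b4 := weak_state4 WU.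
have bp3 : boch_h1 Om p3 by case: W3. have bp4 : boch_h1 Om p4 by case: W4.
have o01 : 0 \in `[0%R, 1%R : R] by rewrite in_itv/= ler01 lexx.
have i01 : 1 \in `[0%R, 1%R : R] by rewrite in_itv/= ler01 lexx.
have Lw30 : L2pair Om (w3 0) by case: W3 => _ + _ _; apply.
have Lw31 : L2pair Om (w3 1) by case: W3 => _ + _ _; apply.
have Lw40 : L2pair Om (w4 0) by case: W4 => _ + _ _; apply.
have Lw41 : L2pair Om (w4 1) by case: W4 => _ + _ _; apply.
have WS := weak_state_generator oOm tau Lu Lf bp3 bp4.
move: nF; set S := (_, _, _, _) => nF.
have lb := sym_bilinear_lyap mOm A N (tau * a0) (tau * b0).
have hW := submodule_weak_state mOm.
(* [F] and the explicit quadruple [S] are at distance 0 in the state norm, which bounds [lyap]. *)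
have -> : L U F = L U S.
  apply/eqP; rewrite -subr_eq0 -(bilBr hW lb WF WS WU) -normr_le0.
  apply: le_trans (lyap_bound mOm A N (tau * a0) (tau * b0) WU (submoduleB hW WF WS)) _.
  by rewrite nF !mulr0.
have -> : L U S = 2^-1 * l (st2 U) f + A * g (st1 U) u2 +
    N / 2 * (l (st2 U) (h1_fun u2) + l (h1_fun (st1 U)) f) +
    tau * a0 * weighted_int (weight (R:=R)) g (st3 U) (- tau^-1 *: p3) +
    tau * b0 * weighted_int (weight (R:=R)) g (st4 U) (- tau^-1 *: p4) by reflexivity.
have hb := submodule_bochner sh.
rewrite (bilZr hb (semi_inner_bil wg) (- tau^-1) bp3 b3).
rewrite (bilZr hb (semi_inner_bil wg) (- tau^-1) bp4 b4).
have P3 := weak_W12_by_parts b3 W3; have P4 := weak_W12_by_parts b4 W4.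
have sg_null x y : L2pair Om x -> L2pair Om y -> h1norm Om (x - y) = 0 -> g x x = g y y.
  move=> Lx Ly n0.
  have n0' : seminorm_of g (x - y) = 0.
    apply/eqP; rewrite eq_le seminorm_ge0 andbT -n0.
    by apply: ler_wsqrtr; exact: graddot_le_h1dot.
  by rewrite -(seminorm_sq sg Lx) -(seminorm_sq sg Ly) (seminorm_eq sg Lx Ly n0').
rewrite (sg_null _ _ Lw30 L1 n3) in P3; rewrite (sg_null _ _ Lw40 Lu n4) in P4.
have lb2 := semi_inner_bil s2.
(* [st2 U] and [u2] agree in L^2, but only [u2] carries a gradient; it takes over in the products
   that follow. *)
have e1 : l (st2 U) f = l f (h1_fun u2).
  by rewrite (bilC lb2 Lf Lu.1) (bil_eql s2 Lu.1 L2 Lf nu).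
have e2 : l (h1_fun (st1 U)) f = l f (h1_fun (st1 U)) by exact: (bilC lb2 L1.1 Lf).
have e3 : l (st2 U) (h1_fun u2) = l (h1_fun u2) (h1_fun u2).
  by rewrite (bil_eql s2 Lu.1 L2 Lu.1 nu).
have e4 : l (st2 U) (st2 U) = l (h1_fun u2) (h1_fun u2).
  by rewrite -(seminorm_sq s2 L2) -(seminorm_sq s2 Lu.1) (seminorm_eq s2 Lu.1 L2 nu).
rewrite e1 e2 e3 (tf _ Hu) (tf _ HU).
have U1 := lyap_le WU HU; rewrite e4 in U1.
have pu := poincare_graddot Hu.
have gb := semi_inner_bil sg.
have SNY := submoduleZ hL N L1.
have SP := submoduleD hL Lu SNY.
have PE : g (u2 + N *: st1 U) (u2 + N *: st1 U) =
    g u2 u2 + 2 * N * g (st1 U) u2 + N ^+ 2 * g (st1 U) (st1 U).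
  rewrite (bil_sqD hL gb Lu SNY) (bilZl hL gb N L1 SNY) !(bilZr hL gb N L1 _)//.
  by rewrite (bilC gb Lu L1); ring.
have PZ w : L2pair Om w -> g w (u2 + N *: st1 U) = g w u2 + N * g w (st1 U).
  by move=> Lw; rewrite (bilDr hL gb Lu SNY Lw) (bilZr hL gb N L1 Lw).
have hz := am_gm_bil sg c2 a0_gt0 Lw31 SP.
have ht := am_gm_bil sg d2 b0_gt0 Lw41 SP.
have d16 : 0 < d1 / 6 by rewrite divr_gt0.
have hxy := am_gm_bil sg (- 2 * c2 ^+ 2 / c1) d16 Lu L1.
rewrite (bilC gb Lu L1) in hxy.
have g0 x : L2pair Om x -> 0 <= g x x by exact: (semi_inner_ge0 sg).
have D := dissipation_scalar d10 c12 c20 d20 hmax (J (st3 U) (st3 U)) (J (st4 U) (st4 U))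
  (g0 _ Lu) (g0 _ L1) (g0 _ SP) PE hz ht hxy pu.
rewrite (PZ _ Lw31) (PZ _ Lw41) in D.
have J3 : 0 <= J (st3 U) (st3 U).
  by apply: Rintegral_ge0 => s sI; rewrite mul1r g0//; exact: bochner_L2_in b3 sI.
have J4 : 0 <= J (st4 U) (st4 U).
  by apply: Rintegral_ge0 => s sI; rewrite mul1r g0//; exact: bochner_L2_in b4 sI.
have gu := g0 _ Lu; have gy := g0 _ L1.
rewrite (bilC gb Lu L1).
exact: (rate_scalar (g (st1 U) u2) al1 al2 al3 al4 al0 tau0 (ltW N_gt0) gu gy J3 J4 erefl pu U1 P3 P4 D).
Qed.

(** By [lyap_le] and [lyap_ge], both quantities compare with positive combinations of the same four
    nonnegative terms, and [exists_rate] compares the coefficients. *)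
Lemma lyap_energy_equivalent : exists K1 K2 : R, [/\ 0 < K1, 0 < K2 & forall V,
  weak_state Om V -> H1_0 Om G0 (st1 V) ->
  energy Om tau c1 d1 d2 V <= K1 * L V V /\ L V V <= K2 * energy Om tau c1 d1 d2 V].
Proof.
have ta := mulr_gt0 tau0 a0_gt0; have tb := mulr_gt0 tau0 b0_gt0.
have i2 : 0 < 2^-1 :> R by rewrite invr_gt0.
have i4 : 0 < 4^-1 :> R by rewrite invr_gt0.
have c12' : 0 < c1 / 2 by rewrite divr_gt0.
have td1 : 0 < tau * d1 / 2 by rewrite divr_gt0// mulr_gt0.
have td2 : 0 < tau * d2 / 2 by rewrite divr_gt0// mulr_gt0.
have N2 : 0 < N / 2 by rewrite divr_gt0.
have h32 : 0 < 3 / 2 :> R by rewrite divr_gt0.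
have [k1 k1_gt0 [k11 k12 k13 k14]] := exists_rate i2 c12' td1 td2 i4 c12' ta tb.
have [k2 k2_gt0 [k21 k22 k23 k24]] := exists_rate (addr_gt0 i2 N2)
  (addr_gt0 A_gt0 (mulr_gt0 N2 cp0)) (mulr_gt0 ta h32) (mulr_gt0 tb h32) i2 c12' td1 td2.
exists k1^-1, k2^-1; split; rewrite ?invr_gt0// => V WV HV.
rewrite ![_^-1 * _]mulrC !ler_pdivlMr// energyE.
have x0 := semi_inner_ge0 s2 (weak_state2 WV).
have y0 := semi_inner_ge0 sg (weak_state1 WV).
have J_ge0 v : boch_h1 Om v -> 0 <= J v v.
  move=> bv; apply: Rintegral_ge0 => s sI; rewrite mul1r.
  exact: (semi_inner_ge0 sg (bochner_L2_in bv sI)).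
have j3 := J_ge0 _ (weak_state3 WV); have j4 := J_ge0 _ (weak_state4 WV).
have Lge := lyap_ge WV HV; have Lle := lyap_le WV HV.
split; first exact: le_trans (weighted_sum4_le x0 y0 j3 j4 k11 k12 k13 k14) Lge.
exact: le_trans (ler_wpM2r (ltW k2_gt0) Lle) (weighted_sum4_le x0 y0 j3 j4 k21 k22 k23 k24).
Qed.

(** Time increments and the fixed shift commute: the error of the time quotient of U is 1/h times
    the difference between the errors for W at the shifted and at the unshifted time. *)
Lemma scaled_increments_interchange (X : lmodType R) (k h : R) (a b c e x y : X) :
  k *: (h *: (a - b) - h *: (c - e)) - h *: (x - y) =
  h *: ((k *: (a - c) - x) - (k *: (b - e) - y)).
Proof.
rewrite -(scalerBr h) scalerA (mulrC k) -scalerA -(scalerBr h); congr (_ *: _).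
by rewrite subr_interchange scalerBr [RHS]subr_interchange.
Qed.

Lemma mild_solution_decay V0 V (al : R) : 
  2 * al * ((2^-1 + N / 2) * cp) <= d1 / 12 ->
  2 * al * (A + N / 2 * cp) <= N * c1 / 6 ->
  2 * al * (tau * a0 * (3 / 2)) <= a0 / 2 ->
  2 * al * (tau * b0 * (3 / 2)) <= b0 / 2 -> 0 <= al ->
  mild_solution Om G0 tau c1 c2 d1 d2 V0 V ->
  forall t, 0 <= t -> L (V t) (V t) <= expR (- 2 * al * t) * L (V 0) (V 0).
Proof.
move=> al1 al2 al3 al4 al0 [sV cV _ [W [[sW W0 dW] gW]]].
have SE : state_norm Om = seminorm_of (state_dot Om) by apply/funext => U; exact: state_normE.
rewrite SE in cV dW.
pose U (h t : R) : state := h^-1 *: (W (t + h) - W t).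
pose F (h t : R) : state := h^-1 *: (V (t + h) - V t).
have graphUF (h t : R) : 0 < h -> 0 <= t -> weak_graph Om G0 tau c1 c2 d1 d2 (U h t) (F h t).
  move=> h0 t0; have th0 : 0 <= t + h by rewrite addr_ge0// ltW.
  have := graph_A_sdiff oOm bOm h^-1 (gW _ th0) (gW _ t0).
  by rewrite subr_interchange subrr subr0.
have WU (h t : R) : 0 < h -> 0 <= t -> weak_state Om (U h t).
  by move=> h0 t0; have [[]] := graphUF _ _ h0 t0.
have WF (h t : R) : 0 < h -> 0 <= t -> weak_state Om (F h t).
  by move=> h0 t0; have [[]] := graphUF _ _ h0 t0.
have lb := sym_bilinear_lyap mOm A N (tau * a0) (tau * b0).
have LM := lyap_bound mOm A N (tau * a0) (tau * b0).
set M := (_ + _ + _ + _ + _ : R) in LM.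
have M0 : 0 <= M by rewrite !addr_ge0 ?mulr_ge0 ?invr_ge0.
have hW := submodule_weak_state mOm.
have wW (t : R) : 0 <= t -> weak_state Om (W t) by move=> /sW/in_state_space_weak.
have wV (t : R) : 0 <= t -> weak_state Om (V t) by move=> /sV/in_state_space_weak.
have decay (h t : R) : 0 < h -> 0 <= t ->
    L (U h t) (U h t) <= expR (- 2 * al * t) * L (U h 0) (U h 0).
  move=> h0; apply: (evolution_decay ss lb LM M0 (F := F h)).
  - by move=> s s0; exact: WU.
  - by move=> s s0; exact: WF.
  - move=> s s0; have sh0 : 0 <= s + h by rewrite addr_ge0// ltW.
    pose D1 k := seminorm_of (state_dot Om) (k^-1 *: (W (s + h + k) - W (s + h)) - V (s + h)).
    pose D2 k := seminorm_of (state_dot Om) (k^-1 *: (W (s + k) - W s) - V s).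
    have cD1 : D1 k @[k --> within [set k | k != 0 /\ 0 <= s + k] (nbhs 0)] --> (0 : R).
      (* Increments admissible at s are admissible at s + h. *)
      move=> B /(dW _ sh0); rewrite /within/=.
      apply: (@filterS _ (nbhs (0 : R)) _) => k H [k0 sk].
      by apply: H; split => //; rewrite addrAC addr_ge0// ltW.
    have cD2 : D2 k @[k --> within [set k | k != 0 /\ 0 <= s + k] (nbhs 0)] --> (0 : R) by exact: dW.
    apply: (cvg0_le (c := `|h^-1|) cD1 cD2).
    rewrite near_withinE; near=> k => -[k0 sk]; rewrite seminorm_ge0/=.
    have shk : 0 <= s + h + k by rewrite addrAC addr_ge0// ltW.
    rewrite /U /F (_ : s + k + h = s + h + k); last by rewrite addrAC.
    rewrite scaled_increments_interchange.
    have S1 := submoduleB hW (submoduleZ hW k^-1 (submoduleB hW (wW _ shk) (wW _ sh0))) (wV _ sh0).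
    have S2 := submoduleB hW (submoduleZ hW k^-1 (submoduleB hW (wW _ sk) (wW _ s0))) (wV _ s0).
    rewrite (seminormZ ss _ (submoduleB hW S1 S2)); apply: ler_wpM2l; first exact: normr_ge0.
    exact: (seminormB ss S1 S2).
  - by move=> s s0; apply: (dissipation al1 al2 al3 al4 al0); exact: graphUF.
move=> t t0.
have limU (s : R) : 0 <= s -> L (U h s) (U h s) @[h --> 0^'+] --> L (V s) (V s).
  move=> s0; apply: (cvg_bil_sq ss lb LM _ (wV _ s0)).
    by apply: filterS (nbhs_right_gt 0) => h h0; exact: WU.
  (* U(h, s) tends to V(s): this is the derivative of the primitive, restricted to h > 0. *)
  move=> B /(dW _ s0); rewrite /within/= /at_right /within/=.
  apply: (@filterS _ (nbhs (0 : R)) _) => h H h0.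
  by apply: H; split; [rewrite gt_eqF|rewrite addr_ge0// ltW].
apply: (ler_cvg_to (limU _ t0) (f := fun h => L (U h t) (U h t)) (g := fun h => expR (- 2 * al * t) * L (U h 0) (U h 0))).
  by apply: cvgM; [exact: cvg_cst|exact: limU].
by apply: filterS (nbhs_right_gt 0) => h h0; exact: decay.
Unshelve. all: end_near. Qed.

(** The rate is fixed before the solution: it depends only on the coefficients, tau and cp. *)
Lemma mild_solution_lyap_decay : exists2 al : R, 0 < al & forall V0 V,
  mild_solution Om G0 tau c1 c2 d1 d2 V0 V ->
  forall t, 0 <= t -> L (V t) (V t) <= expR (- 2 * al * t) * L (V 0) (V 0).
Proof.
have ta := mulr_gt0 tau0 a0_gt0; have tb := mulr_gt0 tau0 b0_gt0.
have two : 0 < 2 :> R by [].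
have h32 : 0 < 3 / 2 :> R by rewrite divr_gt0.
have N2 : 0 < N / 2 by rewrite divr_gt0.
have N12 : 0 < 2^-1 + N / 2 by rewrite addr_gt0// invr_gt0.
have q1 : 0 < d1 / 12 by rewrite divr_gt0.
have q2 : 0 < N * c1 / 6 by rewrite divr_gt0// mulr_gt0.
have q3 : 0 < a0 / 2 by rewrite divr_gt0.
have q4 : 0 < b0 / 2 by rewrite divr_gt0.
have [al al_gt0 [al1 al2 al3 al4]] := exists_rate (mulr_gt0 two (mulr_gt0 N12 cp0))
  (mulr_gt0 two (addr_gt0 A_gt0 (mulr_gt0 N2 cp0))) (mulr_gt0 two (mulr_gt0 ta h32))
  (mulr_gt0 two (mulr_gt0 tb h32)) q1 q2 q3 q4.
exists al => // V0 V; rewrite !(mulrA al) !(mulrC al 2) in al1 al2 al3 al4.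
by apply: mild_solution_decay => //; exact: ltW.
Qed.

Lemma mild_solution_energy_decay V0 V : mild_solution Om G0 tau c1 c2 d1 d2 V0 V ->
  exists alpha C : R, [/\ 0 < alpha, 0 < C &
    forall t : R, 0 <= t ->
      energy Om tau c1 d1 d2 (V t) <=
      C * expR (- 2 * alpha * t) * energy Om tau c1 d1 d2 (V 0)].
Proof.
move=> mV; have [al al_gt0 /(_ _ _ mV) decay] := mild_solution_lyap_decay.
have [K1 [K2 [K1_gt0 K2_gt0 K12]]] := lyap_energy_equivalent.
have [sV _ _ _] := mV.
exists al, (K1 * K2); split => [//||t t0]; first exact: mulr_gt0.
have [Vt _] := K12 _ (in_state_space_weak (sV _ t0)) (let: And4 HV _ _ _ := sV _ t0 in HV).
have [_ V00] := K12 _ (in_state_space_weak (sV _ (lexx 0))) (let: And4 HV _ _ _ := sV _ (lexx 0) in HV).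
apply: (le_trans Vt); rewrite -2!(mulrA K1) ler_pM2l//.
apply: (le_trans (decay _ t0)).
by rewrite (mulrC K2) -(mulrA (expR _)); apply: ler_wpM2l; [exact: expR_ge0|exact: V00].
Qed.

End decay.

Theorem theorem3p3 (R : realType) (d : nat) (Om G0 G1 : set 'rV[R]_d)
  (hOm : bounded_lipschitz_domain Om)
  (hG0 : relatively_open (bdry Om) G0)
  (hG1 : relatively_open (bdry Om) G1)
  (hG : bdry Om = closure G0 `|` closure G1)
  (hG01 : closure G0 `&` closure G1 = set0)
  (hG0n : G0 !=set0)
  (cp : R) (hcp : 0 < cp) (hP : poincare_constant Om G0 cp)
  (tau c1 c2 d1 d2 : R)
  (htau : 0 < tau) (hd1 : 0 < d1)
  (hc12 : 6 * c2 < c1) (hc2 : 0 < 6 * c2) (hd2 : 0 < d2)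
  (hd1max : Num.max (9 * c1 ^+ 2 * d2 ^+ 2 / (c1 ^+ 2 - 9 * c2 ^+ 2))
                    (18 * c1 * c2 ^+ 2 * cp / (c1 ^+ 2 - 36 * c2 ^+ 2))
            <= d1 ^+ 2)
  (V0 : state R d) (hV0 : in_state_space Om G0 V0)
  (V : R -> state R d)
  (hV : mild_solution Om G0 tau c1 c2 d1 d2 V0 V) :
  exists alpha C : R, [/\ 0 < alpha, 0 < C &
    forall t : R, 0 <= t ->
      energy Om tau c1 d1 d2 (V t) <=
      C * expR (- 2 * alpha * t) * energy Om tau c1 d1 d2 (V 0)].
Proof.
have [oOm _ bOm _] := hOm.
exact: (mild_solution_energy_decay oOm bOm hcp hP htau hd1 hc12 hc2 hd2 hd1max hV).
Qed.
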